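(* Let $d\ge4$ and let $\mu$ be a probability measure on the unit sphere $S^d$ whose Fréchet mean $\bar\mu$ is unique, and suppose that $\mu$ is absolutely continuous and rotationally symmetric about $\bar\mu$, i.e. $d\mu(q)=f(\mathbf{d}(\bar\mu,q))\,dV(q)$. Assume in addition that (i) the density $f$ is bounded in an open neighborhood of the cut locus $\mathcal{C}_{\bar\mu}$ (the antipode of $\bar\mu$); (ii) $\alpha_d=0$; and (iii) $\beta_d>0$. Let $X_1,X_2,\dots$ be i.i.d. with law $\mu$, let $\bar\mu_n$ be any measurable choice of sample Fréchet mean of $X_1,\dots,X_n$, and let $\mathcal{N}$ be the tangent limit distribution of $\mu$. Then $$n^{1/6}\log_{\bar\mu}\bar\mu_n\xrightarrow{\ \mathcal{D}\ }H_\sharp\mathcal{N},$$ where $H:T_{\bar\mu}S^d\to T_{\bar\mu}S^d$ is the map $H(Z)=6^{1/3}\beta_d^{-1/3}\|Z\|^{-2/3}Z$ (with $H(0)=0$), i.e. the inverse of the map $Z\mapsto\frac{\beta_d}{6}\|Z\|^2Z$.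
   Context: $S^d$ carries its standard round metric; $\mathbf{d}$ is the great-circle distance, $dV$ the volume element, $V(S^k)$ the volume of the $k$-dimensional unit sphere, and $\log_{p}$ the inverse of the Riemannian exponential map at $p$ (defined off the antipode of $p$). The Fréchet function of a probability measure $\nu$ is $x\mapsto\int\frac12\mathbf{d}^2(y,x)\,d\nu(y)$; its Fréchet mean set is the set of its global minimizers. The sample Fréchet mean set is the Fréchet mean set of the empirical measure $\mu_n=\frac1n\sum_{i=1}^n\delta_{X_i}$. The tangent limit distribution $\mathcal{N}$ of $\mu$ is the Gaussian law on $T_{\bar\mu}S^d$ that is the limit in distribution of $n^{1/2}\cdot\frac1n\sum_{i=1}^n\log_{\bar\mu}X_i$ (i.e. $n^{1/2}$ times the Euclidean mean of the pushforward of $\mu_n$ under $\log_{\bar\mu}$). $H_\sharp$ denotes pushforward of measures by $H$ and $\xrightarrow{\mathcal{D}}$ convergence in distribution. With $a_k=\int_0^\pi\sin^kx\,dx$, $$\alpha_d=\frac{V(S^{d-1})}{d}\int_0^\pi f(\varphi)\,d\big(\varphi\sin^{d-1}\varphi\big),$$ $$\beta_d=\frac{a_dV(S^{d-2})}{d+2}\int_0^\pi f(\varphi)\,d\Big(\sin^{d-3}\varphi\,\big(2\varphi\sin^2\varphi+3\cos\varphi\sin\varphi-3\varphi\big)\Big),$$ where $\int_0^\pi f(\varphi)\,d(g(\varphi))$ means $\int_0^\pi f(\varphi)g'(\varphi)\,d\varphi$. *)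

(* Defs.v *)
From HB Require Import structures.
From mathcomp Require Import all_boot all_order all_algebra finmap.
From mathcomp Require Import all_classical all_reals all_analysis.

Set Implicit Arguments.
Unset Strict Implicit.
Unset Printing Implicit Defensive.

Import Order.TTheory GRing.Theory Num.Theory.
Import numFieldNormedType.Exports.

Local Open Scope classical_set_scope.
Local Open Scope ring_scope.

(* Matrices over a realType carry their Borel sigma-algebra. *)
Section borel_matrix.
Context (R : realType) (m n : nat).

Definition mx_borel : set (set 'M[R]_(m, n)) :=
  <<s [set U : set 'M[R]_(m, n) | open U] >>.

Let mx_borel0 : mx_borel set0. Proof. exact: sigma_algebra0. Qed.

Let mx_borelC (A : set 'M[R]_(m, n)) : mx_borel A -> mx_borel (~` A).
Proof. exact: sigma_algebraC. Qed.

Let mx_borelU (F : (set 'M[R]_(m, n))^nat) :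
  (forall i, mx_borel (F i)) -> mx_borel (\bigcup_i F i).
Proof. exact: sigma_algebra_bigcup. Qed.

HB.instance Definition _ := @isMeasurable.Build
  (sigma_display [set U : set 'M[R]_(m, n) | open U]) 'M[R]_(m, n)
  mx_borel mx_borel0 mx_borelC mx_borelU.

End borel_matrix.

Section round_sphere.
Context (R : realType).

(* The topology of 'rV[R]_n is the usual one, but its library norm is the sup
   norm; the Euclidean structure is therefore given here. *)
Definition dotp n (u v : 'rV[R]_n) : R := \sum_(i < n) u 0 i * v 0 i.

Definition enorm n (u : 'rV[R]_n) : R := Num.sqrt (dotp u u).

Definition sphere k : set 'rV[R]_k.+1 := [set x | enorm x = 1].

Definition sdist k (x y : 'rV[R]_k.+1) : R := acos (dotp x y).

Definition cut_locus k (p : 'rV[R]_k.+1) : set 'rV[R]_k.+1 := [set - p].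

(* The tangent space T_p S^k, as a linear subspace of the ambient space. *)
Definition tangent k (p : 'rV[R]_k.+1) : set 'rV[R]_k.+1 :=
  [set v | dotp p v = 0].

Definition sexp k (p v : 'rV[R]_k.+1) : 'rV[R]_k.+1 :=
  cos (enorm v) *: p + (sin (enorm v) / enorm v) *: v.

(* Inverse of the exponential map on the open ball of radius pi of T_p S^k; it
   takes the default value 0 at the antipode of p. *)
Definition slog k (p q : 'rV[R]_k.+1) : 'rV[R]_k.+1 :=
  xget 0 [set v | [/\ tangent p v, enorm v < pi & sexp p v = q]].

Definition polar k (t : R) (u : 'rV[R]_k.+1) : 'rV[R]_k.+2 :=
  row_mx (cos t)%:M (sin t *: u) : 'rV[R]_(1 + k.+1).

(* Riemannian volume: in geodesic polar coordinates (t, u), with t in [0, pi]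
   and u in S^k, the round metric of S^(k+1) is dt^2 + sin(t)^2 g_(S^k), so that
   dV_(S^(k+1)) = sin(t)^k dt dV_(S^k); dV_(S^0) is the counting measure of
   S^0 = {1, -1}. It is a Borel measure on R^(k+1) concentrated on S^k. *)
Fixpoint svol k : set 'rV[R]_k.+1 -> \bar R :=
  match k return set 'rV[R]_k.+1 -> \bar R with
  | 0 => fun A =>
      (\d_(const_mx 1%R : 'rV[R]_1) A + \d_(const_mx (- 1)%R : 'rV[R]_1) A)%E
  | k'.+1 => fun A =>
      (\int[@lebesgue_measure R]_(t in `[0%R, pi])
         ((sin t ^+ k')%:E * svol (polar t @^-1` A)))%E
  end.

Definition sphere_volume k : R := fine (svol (@sphere k)).

End round_sphere.

Arguments sphere R k : clear implicits.
Arguments svol R k : clear implicits.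
Arguments sphere_volume R k : clear implicits.

Section frechet_means.
Local Open Scope ereal_scope.
Context (R : realType) (k : nat).
Implicit Type nu : {measure set 'rV[R]_k.+1 -> \bar R}.

Definition frechet_fun nu (x : 'rV[R]_k.+1) : \bar R :=
  \int[nu]_(y in sphere R k) (2^-1 * sdist y x ^+ 2)%:E.

Definition frechet_mean_set nu : set 'rV[R]_k.+1 :=
  [set x | sphere R k x /\
    forall y, sphere R k y -> frechet_fun nu x <= frechet_fun nu y].

Definition empirical (X : nat -> 'rV[R]_k.+1) (n : nat) :
    {measure set 'rV[R]_k.+1 -> \bar R} :=
  mscale ((n%:R : R)^-1%:nng)%R (msum (fun i => \d_(X i)) n).

End frechet_means.

Section probabilistic_notions.
Context d (T : measurableType d) (R : realType) (P : probability T R).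

Definition mutually_independent d' (V : measurableType d')
    (X : nat -> {RV P >-> V}) : Prop :=
  forall (J : {fset nat}) (A : nat -> set V), (forall i, measurable (A i)) ->
    P (\bigcap_(i in [set` J]) (X i @^-1` A i)) =
    (\prod_(i <- J) P (X i @^-1` A i))%E.

Definition identically_distributed d' (V : measurableType d')
    (X : nat -> {RV P >-> V}) (mu : probability V R) : Prop :=
  forall i A, measurable A -> distribution P (X i) A = mu A.

Definition cvg_in_distribution m (Y : nat -> T -> 'rV[R]_m)
    (nu : set 'rV[R]_m -> \bar R) : Prop :=
  forall g : 'rV[R]_m -> R, continuous g -> (exists M : R, forall x, `|g x| <= M) ->
    ('E_P[g \o Y n] @[n --> \oo] --> \int[nu]_x (g x)%:E)%E.

(* Gaussian laws on R^m, possibly degenerate: every one-dimensional marginal is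
   normal, where N(a, 0) is the Dirac mass at a (the library's normal_prob a 0
   is a uniform law instead). *)
Definition gaussian m (nu : probability 'rV[R]_m R) : Prop :=
  forall u : 'rV[R]_m, exists a s : R, forall A : set R, measurable A ->
    nu (dotp u @^-1` A) = if s == 0 then \d_a A else normal_prob a s A.

(* N is the Gaussian law on T_p S^k which is the limit in distribution of
   n^(1/2) times the mean of log_p X_0, ..., log_p X_(n-1). *)
Definition tangent_limit_distribution k (X : nat -> {RV P >-> 'rV[R]_k.+1})
    (p : 'rV[R]_k.+1) (N : probability 'rV[R]_k.+1 R) : Prop :=
  [/\ N (tangent p) = 1%E, gaussian N &
      cvg_in_distribution (fun n w =>
        (n%:R `^ 2^-1) *: (n%:R^-1 *: \sum_(i < n) slog p (X i w))) N].

End probabilistic_notions.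

Section constants.
Context (R : realType).
Notation leb := (@lebesgue_measure R).

Definition sin_int (k : nat) : R := \int[leb]_(x in `[0, pi]) (sin x ^+ k).

(* The integral of f dg, for f and g on [0, pi]. *)
Definition int_d (f g : R -> R) : R :=
  \int[leb]_(x in `[0, pi]) (f x * g^`()%classic x).

Definition alpha (d : nat) (f : R -> R) : R :=
  sphere_volume R d.-1 / d%:R * int_d f (fun x => x * sin x ^+ d.-1).

Definition beta (d : nat) (f : R -> R) : R :=
  sin_int d * sphere_volume R d.-2 / (d + 2)%:R *
  int_d f (fun x => sin x ^+ (d - 3) *
                    (2 * x * sin x ^+ 2 + 3 * cos x * sin x - 3 * x)).

Definition smear n (b : R) (Z : 'rV[R]_n) : 'rV[R]_n :=
  (6 `^ (1 / 3) * b `^ (- (1 / 3)) * enorm Z `^ (- (2 / 3))) *: Z.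

End constants.

(* Main.v *)
(* A point of the sphere is written cos t p + sin t w, with w a unit vector
   orthogonal to the mean p. Half the squared distance from it to a sample point
   y is expanded in t to fourth order; the coefficients blow up like inverse
   powers of the distance from y to the antipode of p, which are integrable as
   f is bounded there and d >= 4. Averaged over y the expansion does not depend
   on w: the odd terms vanish, the second-order term is alpha_d / 2 = 0 and the
   fourth-order term is beta_d / 24, while uniqueness of the mean gives a global
   lower bound c t^4.

   The empirical Frechet function at (t, w) minus its value at p is
   - t <w, S_n> plus the empirical mean of the nonlinear increment, where S_n is
   the mean of the log_p X_i. The increment is bounded with second moment
   O(t^4), so Bernstein's inequality on a polynomially fine net of pairs (t, w)
   shows that its empirical mean is, uniformly and with probability tending to
   1, within o(max(t^4, n^(-2/3))) of its expectation. At the scale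
   h = n^(1/6) t w the sample mean therefore almost minimizes
   beta_d / 24 |h|^4 - <h, Z_n> with Z_n = n^(1/2) S_n, whose minimizer is
   H(Z_n), and |h|^4 >= |a|^4 + 4 |a|^2 <a, h - a> + |h - a|^4 / 3 forces h to be
   close to H(Z_n). As H is continuous, Slutsky's argument concludes.

   The reduction of integrals over the sphere to the angles from p and from w
   needs the rotation invariance of the recursively defined volume: integrating
   it over all radii gives iterated Lebesgue measure, which is invariant under
   the shears composing a planar rotation. *)

Require Import Defs.
From HB Require Import structures.
From mathcomp Require Import all_boot all_order all_algebra finmap.
From mathcomp Require Import all_classical all_reals all_analysis measurable_realfun.
From mathcomp Require Import ring lra.
Set Implicit Arguments.
Unset Strict Implicit.
Unset Printing Implicit Defensive.
Import Order.TTheory GRing.Theory Num.Theory.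
Import numFieldNormedType.Exports.
Local Open Scope classical_set_scope.
Local Open Scope ring_scope.


(** * Differentiation rules *)

(** The obstacle is that half the squared distance to y is singular at the antipode of y, so that no
    uniform bound allows differentiating the Frechet function four times under the integral. Its
    derivatives along a geodesic are expressed through those of acos^2 / 2 in the cosine, which stay
    bounded as the distance tends to 0; each derivative of the cosine along the geodesic gains one
    power of the distance to the antipode, so that the fourth derivative costs only the inverse
    cube. Remainder bounds of that strength hold for all t, even beyond the range where Taylor's
    formula applies, and dominated convergence does the rest.

    The threshold max(t^4, n^(-2/3)) is flat below t = n^(-1/6), the scale of the limit. A fixed
    small tilt in Bernstein's inequality gives probability exp(- c n^(1/3)) for one pair (t, w),
    with the same c at all scales t, and this beats the polynomial size of the net. The exceptional
    event is the finite union over the net, hence measurable; inside a cell the increments obey a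
    Holder bound valid for every sample point. *)

Section derivative_rules.
Context (R : realType).
Implicit Types (f g : R -> R) (x a b : R).

Lemma der_eq f x a b : is_derive x 1 f a -> a = b -> is_derive x 1 f b.
Proof. by move=> ? <-. Qed.

Lemma der_cst x a : is_derive x 1 (fun _ : R => a) 0.
Proof. exact: is_derive_cst. Qed.

Lemma der_id x : is_derive x 1 (fun t : R => t) 1.
Proof. exact: is_derive_id. Qed.

Lemma der_add f g x a b : is_derive x 1 f a -> is_derive x 1 g b ->
  is_derive x 1 (fun t => f t + g t) (a + b).
Proof. by move=> ? ?; exact: (is_deriveD (f := f) (g := g)). Qed.

Lemma der_opp f x a : is_derive x 1 f a -> is_derive x 1 (fun t => - f t) (- a).
Proof. by move=> ?; exact: (is_deriveN (f := f)). Qed.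

Lemma der_mul f g x a b : is_derive x 1 f a -> is_derive x 1 g b ->
  is_derive x 1 (fun t => f t * g t) (a * g x + f x * b).
Proof.
by move=> ? ?; apply: is_derive_eq; rewrite /GRing.scale/=; ring.
Qed.

Lemma der_exp f n x a : is_derive x 1 f a ->
  is_derive x 1 (fun t => f t ^+ n) (n%:R * f x ^+ n.-1 * a).
Proof.
by move=> fa; have := is_deriveX n fa; rewrite exprfctE.
Qed.

Lemma der_inv f x a : f x != 0 -> is_derive x 1 f a ->
  is_derive x 1 (fun t => (f t)^-1) (- a / f x ^+ 2).
Proof.
by move=> f0 fa; apply: (der_eq (is_deriveV f0 fa)); rewrite /GRing.scale/=; field.
Qed.

Lemma der_comp f g x a b : is_derive x 1 g b -> is_derive (g x) 1 f a ->
  is_derive x 1 (fun t => f (g t)) (a * b).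
Proof.
by move=> gb fa; exact: (is_derive1_comp fa gb).
Qed.

Lemma der_sin g x b : is_derive x 1 g b ->
  is_derive x 1 (fun t => sin (g t)) (cos (g x) * b).
Proof. by move=> ?; apply: der_comp. Qed.

Lemma der_cos g x b : is_derive x 1 g b ->
  is_derive x 1 (fun t => cos (g t)) (- sin (g x) * b).
Proof. by move=> ?; apply: der_comp. Qed.

Lemma der_continuous f x a : is_derive x 1 f a -> {for x, continuous f}.
Proof.
move=> fa; apply: differentiable_continuous; apply/derivable1_diffP.
exact: ex_derive.
Qed.

End derivative_rules.

Ltac der_step := lazymatch goal with
  | |- is_derive _ _ (fun _ => ?c) _ => exact: der_cst
  | D : is_derive ?x ?v ?f _ |- is_derive ?x ?v ?f _ => exact: D
  | |- is_derive _ _ ( *%R ?a) _ =>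
      eapply (@der_mul _ (fun _ => a) (fun t => t)); [exact: der_cst|exact: der_id]
  | |- is_derive _ _ -%R _ => eapply (@der_opp _ (fun t => t)); exact: der_id
  | |- is_derive _ _ cos _ => exact: is_derive_cos
  | |- is_derive _ _ sin _ => exact: is_derive_sin
  | |- is_derive _ _ (fun t => t) _ => exact: der_id
  | |- is_derive _ _ (fun t => _ + _) _ => eapply der_add
  | |- is_derive _ _ (fun t => - _) _ => eapply der_opp
  | |- is_derive _ _ (fun t => _ * _) _ => eapply der_mul
  | |- is_derive _ _ (fun t => _ ^+ _) _ => eapply der_exp
  | |- is_derive _ _ (fun t => _ ^-1) _ => eapply der_inv
  | |- is_derive _ _ (fun t => sin _) _ => eapply der_sin
  | |- is_derive _ _ (fun t => cos _) _ => eapply der_cos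
  end.
(** The derivative is built as an existential variable by [der_step], driven by the shape of the
    function. What remains are the nonvanishing conditions of the inverses, then one algebraic
    equation with the announced derivative. *)
Ltac der := eapply der_eq; [repeat der_step|rewrite /=].

(** * Change of variables and Borel row vectors *)

Section weighted_transport.
Local Open Scope ereal_scope.
Context d1 d2 (X : measurableType d1) (Y : measurableType d2) (R : realType).
Variables (m : {measure set X -> \bar R}) (nu : {measure set Y -> \bar R}).
Variables (w : Y -> R) (phi : Y -> X).
Hypothesis w_ge0 : forall y, (0 <= w y)%R.
Hypothesis w_meas : measurable_fun setT w.
Hypothesis phi_meas : measurable_fun setT phi.
Hypothesis mE : forall A, measurable A ->
  m A = \int[nu]_y ((w y)%:E * (\1_A (phi y))%:E).

Import HBNNSimple.

Let transport_nnsfun (h : {nnsfun X >-> R}) :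
  \int[m]_x (h x)%:E = \int[nu]_y ((w y)%:E * (h (phi y))%:E).
Proof.
have mi r : measurable_fun setT (fun y => (\1_(h @^-1` [set r]) (phi y))%:E : \bar R).
  by apply/measurable_EFinP; apply: measurableT_comp.
rewrite integralT_nnsfun sintegralE.
have -> : \int[nu]_y ((w y)%:E * (h (phi y))%:E) =
  \int[nu]_y \sum_(r \in range h)
     (r%:E * ((w y)%:E * (\1_(h @^-1` [set r]) (phi y))%:E)).
  apply: eq_integral => y _; rewrite fimfunE -fsumEFin//.
  rewrite ge0_mule_fsumr; last first.
    by move=> r; rewrite EFinM nnfun_muleindic_ge0.
  by apply: eq_fsbigr => r _; rewrite EFinM muleCA.
rewrite ge0_integral_fsum//; last 2 first.
- move=> r; apply: emeasurable_funM; first exact: measurable_cst.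
  by apply: emeasurable_funM => //; apply/measurable_EFinP.
- move=> r y _; rewrite muleCA mule_ge0 ?lee_fin//.
  exact: nnfun_muleindic_ge0.
apply: eq_fsbigr => r /[!inE] -[x _ hxr].
rewrite ge0_integralZl//.
- by rewrite mE.
- by apply: emeasurable_funM => //; apply/measurable_EFinP.
- by move=> y _; rewrite mule_ge0// lee_fin.
- by rewrite lee_fin -hxr.
Qed.

(** By [mE], [m] is the image under [phi] of the measure of density [w]. The formula is linear, so
    it passes to simple functions, and then to limits by monotone convergence. Weight and map are
    kept together because polar coordinates have both a Jacobian and a parametrization. *)
Lemma ge0_integral_transport (g : X -> \bar R) :
  measurable_fun setT g -> (forall x, 0 <= g x) ->
  \int[m]_x g x = \int[nu]_y ((w y)%:E * g (phi y)).
Proof.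
move=> mg g0; pose f_ := nnsfun_approx measurableT mg.
transitivity (limn (fun n => \int[m]_x (f_ n x)%:E)).
  rewrite -monotone_convergence//.
  - apply: eq_integral => y _; apply/esym/cvg_lim => //.
    by apply: cvg_nnsfun_approx.
  - by move=> n; exact/measurable_EFinP/measurable_funP.
  - by move=> n y _; rewrite lee_fin.
  - by move=> y _ a b ab; rewrite lee_fin; exact/lefP/nd_nnsfun_approx.
under eq_fun do rewrite transport_nnsfun.
rewrite -monotone_convergence//.
- apply: eq_integral => y _; apply/cvg_lim => //.
  apply: cvgeZl => //.
  by apply: (@cvg_nnsfun_approx _ _ _ _ measurableT _ mg).
- move=> n; apply: emeasurable_funM; first exact/measurable_EFinP.
  by apply/measurable_EFinP; apply: measurableT_comp.
- by move=> n y _; rewrite mule_ge0// lee_fin.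
- move=> y _ a b ab; apply: lee_wpmul2l; rewrite ?lee_fin//.
  by exact/lefP/nd_nnsfun_approx.
Qed.

Lemma integral_transport (g : X -> \bar R) : measurable_fun setT g ->
  \int[m]_x g x = \int[nu]_y ((w y)%:E * g (phi y)).
Proof.
move=> mg; rewrite integralE [RHS]integralE; congr (_ - _).
- rewrite ge0_integral_transport//; last exact: measurable_funepos.
  apply: eq_integral => y _; rewrite !funeposE maxe_pMr ?mule0//.
  by rewrite lee_fin.
- rewrite ge0_integral_transport//; last exact: measurable_funeneg.
  apply: eq_integral => y _; rewrite !funenegE maxe_pMr ?mule0 ?muleN//.
  by rewrite lee_fin.
Qed.

End weighted_transport.

(** * Borel measurability of matrix-valued maps *)

Section borel_row_vectors.
Context (R : realType).

Lemma open_mx_measurable m n (U : set 'M[R]_(m, n)) : open U -> measurable U.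
Proof. by move=> oU; apply: sub_sigma_algebra. Qed.

Lemma continuous_mx_measurable m n (f : 'M[R]_(m, n) -> R) :
  continuous f -> measurable_fun setT f.
Proof.
move=> cf; apply: (measurability _ (RGenOInfty.measurableE R)) => _ [_ [a -> <-]].
rewrite setTI; apply: open_mx_measurable.
by move/continuousP: cf; apply; exact: interval_open.
Qed.

(** An open set is the union of the balls with rational centre and radius 1/(k+1) that it contains.
    These are countably many, and each is a box in the sup norm, so its preimage is a finite
    intersection of preimages under the entries. *)
Lemma measurable_fun_mx d (T : measurableType d) m n (h : T -> 'M[R]_(m, n)) :
  (forall i j, measurable_fun setT (fun t => h t i j)) -> measurable_fun setT h.
Proof.
move=> hm.
pose sc (q : 'M[rat]_(m, n) * nat) : 'M[R]_(m, n) := map_mx ratr q.1.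
pose V (q : 'M[rat]_(m, n) * nat) : set 'M[R]_(m, n) :=
   ball (sc q) (q.2.+1%:R^-1).
have Vm q : measurable (h @^-1` V q).
  have -> : h @^-1` V q = \bigcap_(i in [set: 'I_m * 'I_n])
      ((fun t => h t i.1 i.2) @^-1` ball (sc q i.1 i.2) (q.2.+1%:R^-1)).
    apply/seteqP; split => t /=.
      by move=> [_ H] [i j] _; exact: (H i j).
    by move=> H; split => // i j; exact: (H (i, j)).
  apply: fin_bigcap_measurable => // -[i j] _.
  rewrite -[X in measurable X]setTI; apply: hm => //.
  exact: measurable_ball.
apply: measurability => //.
move=> _ [U oU <-].
rewrite setTI.
have -> : h @^-1` U = \bigcup_(q in [set q | V q `<=` U]) (h @^-1` V q).
  apply/seteqP; split => t /=; last by move=> [q /= VU]; exact: VU.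
  move=> Ut.
  have [e /= e0 eU] : nbhs_ball (h t) U by rewrite nbhs_ballE; exact: open_nbhs_nbhs.
  have [k ke] : exists k, k.+1%:R^-1 < e / 2.
    have e2 : 0 < e / 2 by rewrite divr_gt0.
    by have [k _ /(_ k (leqnn k)) H] := near_infty_natSinv_lt (PosNum e2); exists k.
  have [q qP] : exists q : 'M[rat]_(m, n), forall i j,
      `|h t i j - ratr (q i j)| < k.+1%:R^-1.
    pose P (i : 'I_m) (j : 'I_n) (r : rat) := `|h t i j - ratr r| < k.+1%:R^-1.
    have Pex i j : exists r, P i j r.
      have [|r] := @rat_in_itvoo R (h t i j - k.+1%:R^-1) (h t i j + k.+1%:R^-1).
        by rewrite ltrD2l gtrN ?invr_gt0.
      rewrite in_itv/= => /andP[r1 r2]; exists r.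
      rewrite /P ltr_norml; move: r1 r2; move: k.+1%:R^-1 (h t i j) (ratr r) => a b c *.
      by apply/andP; split; lra.
    exists (\matrix_(i, j) sval (cid (Pex i j))) => i j.
    by rewrite mxE; case: cid.
  exists (q, k); last by split => [|i j]; rewrite ?invr_gt0//; rewrite /sc mxE /ball/= distrC.
  move=> z [_ zP] /=; apply: eU; split => // i j.
  rewrite /ball_; have := zP i j; have := qP i j; rewrite /sc mxE /ball/=.
  move: (z i j) (h t i j) (ratr (q i j)) => a b c h1 h2.
  have -> : b - a = (b - c) + (c - a) by ring.
  apply: (le_lt_trans (ler_normD _ _)).
  by move: ke h1 h2; move: (k.+1%:R^-1) => x *; lra.
rewrite bigcup_mkcond; apply: countable_bigcupT_measurable => // q.
by case: ifPn.
Qed.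

End borel_row_vectors.

(** * The recursive volume as a finite Borel measure *)

Section volume_measure.
Context (R : realType).
Local Notation leb := (@lebesgue_measure R).

Lemma coord_mx_measurable m n (i : 'I_m) (j : 'I_n) :
  measurable_fun setT (fun M : 'M[R]_(m, n) => M i j).
Proof. by apply: continuous_mx_measurable; exact: coord_continuous. Qed.

Lemma measurable_fun_coord d (T : measurableType d) m n (h : T -> 'M[R]_(m, n)) i j :
  measurable_fun setT h -> measurable_fun setT (fun t => h t i j).
Proof. by move=> mh; apply: (measurableT_comp (coord_mx_measurable i j)). Qed.

Lemma measurable_fun_row_mx d (T : measurableType d) m n
    (a : T -> 'rV[R]_m) (b : T -> 'rV[R]_n) :
  measurable_fun setT a -> measurable_fun setT b ->
  measurable_fun setT (fun t => row_mx (a t) (b t)).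
Proof.
move=> ma mb; apply: measurable_fun_mx => i j; rewrite -(splitK j).
by case: (fintype.split j) => l /=; under eq_fun do rewrite ?row_mxEl ?row_mxEr;
  exact: measurable_fun_coord.
Qed.

Lemma measurable_fun_scalemx d (T : measurableType d) m n
    (a : T -> R) (b : T -> 'M[R]_(m, n)) :
  measurable_fun setT a -> measurable_fun setT b ->
  measurable_fun setT (fun t => a t *: b t).
Proof.
move=> ma mb; apply: measurable_fun_mx => i j; under eq_fun do rewrite mxE.
by apply: measurable_funM => //; exact: measurable_fun_coord.
Qed.

Lemma measurable_fun_scalar_mx1 d (T : measurableType d) (a : T -> R) :
  measurable_fun setT a -> measurable_fun setT (fun t => (a t)%:M : 'M[R]_1).
Proof.
by move=> ma; apply: measurable_fun_mx => i j; under eq_fun do rewrite mxE;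
  rewrite !ord1 eqxx.
Qed.

Lemma measurable_polar k :
  measurable_fun setT (fun z : R * 'rV[R]_k.+1 => polar z.1 z.2).
Proof.
have := @measurable_fun_row_mx _ (R * 'rV[R]_k.+1)%type 1 k.+1
  (fun z => (cos z.1)%:M) (fun z => sin z.1 *: z.2).
apply.
- apply: measurable_fun_scalar_mx1; apply: measurableT_comp => //.
  by apply: continuous_measurable_fun; exact: continuous_cos.
- apply: measurable_fun_scalemx => //; apply: measurableT_comp => //.
  by apply: continuous_measurable_fun; exact: continuous_sin.
Qed.

Lemma measurable_polar_dir k (t : R) :
  measurable_fun setT (@polar R k t).
Proof.
by apply: (measurableT_comp (@measurable_polar k) (measurable_pair1 t)).
Qed.

Lemma measurable_sinX k : measurable_fun setT (fun t : R => sin t ^+ k).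
Proof.
apply: measurable_funX; apply: continuous_measurable_fun; exact: continuous_sin.
Qed.

Lemma sin_ge0_itv (t : R) : `[0, pi]%classic t -> 0 <= sin t.
Proof. by rewrite /= in_itv/= => ?; exact: sin_ge0_pi. Qed.

Local Open Scope ereal_scope.

Lemma svolS k A : svol R k.+1 A =
  \int[leb]_(t in `[0%R, pi]) ((sin t ^+ k)%:E * svol R k (polar t @^-1` A)).
Proof. by []. Qed.

Let svol_step k (m : {finite_measure set 'rV[R]_k.+1 -> \bar R}) :
  (forall A, svol R k A = m A) -> forall A, measurable A ->
  measurable_fun setT (fun t : R => svol R k (polar t @^-1` A)).
Proof.
move=> mE A mA.
pose S := [set z : R * 'rV[R]_k.+1 | A (polar z.1 z.2)].
have mS : measurable S by rewrite -[S]setTI; exact: measurable_polar.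
have := measurable_fun_xsection m mS.
congr measurable_fun; apply/funext => t /=.
by rewrite mE; congr (m _); apply/seteqP; split => u; rewrite /xsection /= ?inE.
Qed.

(** Finiteness has to be carried through the induction with the measure axioms: the measurability in
    t of the slices, which sigma-additivity in the next dimension requires, comes from a section
    theorem for finite measures. *)
Lemma svol_is_measure k : [/\ svol R k set0 = 0, forall A, 0 <= svol R k A,
  semi_sigma_additive (svol R k) & fin_num_fun (svol R k)].
Proof.
elim: k => [|k [s0 sge sadd sfin]].
  split.
  - by rewrite /= !measure0 adde0.
  - by move=> A /=; rewrite adde_ge0.
  - have -> : svol R 0 = measure_add (\d_(const_mx 1%R : 'rV[R]_1)) (\d_(const_mx (-1)%R : 'rV[R]_1)).
      by apply/funext => A; rewrite measure_addE.
    exact: measure_semi_sigma_additive.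
  - by move=> A mA /=; rewrite fin_numD !fin_num_measure.
pose mm : {measure set 'rV[R]_k.+1 -> \bar R} :=
  HB.pack (svol R k) (isMeasure.Build _ _ _ (svol R k) s0 sge sadd).
pose m : {finite_measure set 'rV[R]_k.+1 -> \bar R} :=
  HB.pack (Measure.sort mm) (Measure_isFinite.Build _ _ _ mm sfin).
have mpol A : measurable A -> measurable_fun setT (fun t : R => svol R k (polar t @^-1` A)).
  exact: (@svol_step _ m).
have msin : measurable_fun setT (fun t : R => (sin t ^+ k)%:E).
  by apply/measurable_EFinP; exact: measurable_sinX.
have pge A (t : R) : `[0%R, pi]%classic t -> 0 <= (sin t ^+ k)%:E * svol R k (polar t @^-1` A).
  by move=> /sin_ge0_itv t0; rewrite mule_ge0// lee_fin exprn_ge0.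
split => //.
- rewrite /= integral0_eq// => t _; rewrite preimage_set0 s0 mule0//.
- by move=> A; apply: integral_ge0 => t; exact: pge.
- move=> F mF tF mUF /=.
  have -> : \int[leb]_(t in `[0%R, pi]) ((sin t ^+ k)%:E * svol R k (polar t @^-1` (\bigcup_n F n)))
      = \int[leb]_(t in `[0%R, pi]) (\sum_(n <oo) ((sin t ^+ k)%:E * svol R k (polar t @^-1` F n))).
    apply: eq_integral => t /[!inE] t0.
    rewrite nneseriesZl//; congr (_ * _).
    rewrite preimage_bigcup.
    have mP n : measurable (polar t @^-1` F n).
      by rewrite -[X in measurable X]setTI; exact: measurable_polar_dir.
    apply/esym/cvg_lim => //.
    apply: (@measure_semi_sigma_additive _ _ _ m) => //.
    - move=> i j _ _ [u [Fi Fj]]; apply: (tF i j I I); by exists (polar t u).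
    - by apply: bigcup_measurable => n _; exact: mP.
  rewrite integral_nneseries//.
  + apply: is_cvg_nneseries => n _ _; apply: integral_ge0 => t; exact: pge.
  + move=> n; apply: measurable_funTS; apply: emeasurable_funM => //.
    exact: mpol.
  + by move=> n t; exact: pge.
- move=> A mA; rewrite svolS ge0_fin_numE; last by apply: integral_ge0 => t; exact: pge.
  apply: (@le_lt_trans _ _ (\int[leb]_(t in `[0%R, pi]) (cst (svol R k setT) t))).
    apply: ge0_le_integral => //.
    - by move=> t; exact: pge.
    - apply: measurable_funTS; apply: emeasurable_funM => //; exact: mpol.
    - move=> t /sin_ge0_itv t0; rewrite -[leRHS]mul1e lee_pmul//.
      + by rewrite lee_fin exprn_ge0.
      + by rewrite lee_fin exprn_ile1// sin_le1.
      + apply: (le_measure m); rewrite ?inE//.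
        by rewrite -[X in measurable X]setTI; exact: measurable_polar_dir.
  rewrite integral_cst//= lebesgue_measure_itv/= lte_fin pi_gt0 sube0.
  by rewrite lte_mul_pinfty// ?lte_fin ?ltey_eq ?sfin// ?sge.
Qed.

HB.instance Definition _ k := isMeasure.Build _ _ _ (svol R k)
  (let: And4 h _ _ _ := svol_is_measure k in h)
  (let: And4 _ h _ _ := svol_is_measure k in h)
  (let: And4 _ _ h _ := svol_is_measure k in h).

HB.instance Definition _ k := Measure_isFinite.Build _ _ _ (svol R k)
  (let: And4 _ _ _ h := svol_is_measure k in h).


(** The indicator keeps the weight nonnegative on the whole line, as the transport formula demands;
    [sin t ^+ k] alone takes negative values outside the interval when k is odd. *)
Lemma measurable_sin_weight k :
  measurable_fun setT (fun t : R => (\1_`[0%R, pi] t * sin t ^+ k)%R).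
Proof.
by apply: measurable_funM; [exact: measurable_indic|exact: measurable_sinX].
Qed.

Lemma sin_weight_ge0 k (t : R) : (0 <= \1_`[0%R, pi] t * sin t ^+ k)%R.
Proof.
rewrite indicE; case: (boolP (t \in _)); last by rewrite mul0r.
by rewrite inE => /sin_ge0_itv ?; rewrite mul1r exprn_ge0.
Qed.

Lemma integral_sin_weight k (G : R -> \bar R) :
  \int[leb]_t ((\1_`[0%R, pi] t * sin t ^+ k)%:E * G t) =
  \int[leb]_(t in `[0%R, pi]) ((sin t ^+ k)%:E * G t).
Proof.
rewrite [RHS]integral_mkcond; apply: eq_integral => t _.
by rewrite patchE indicE; case: ifP; rewrite ?mul1r ?mul0r ?mul0e.
Qed.

Lemma svol_transport k A : measurable A -> svol R k.+1 A =
  \int[leb \x svol R k]_z ((\1_`[0%R, pi] z.1 * sin z.1 ^+ k)%:E *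
    (\1_A (polar z.1 z.2))%:E).
Proof.
move=> mA.
have mP : measurable_fun setT
    (fun z : R * 'rV[R]_k.+1 => (\1_A (polar z.1 z.2))%:E : \bar R).
  apply/measurable_EFinP; exact: (measurableT_comp (measurable_indic _) (@measurable_polar _)).
rewrite svolS -integral_sin_weight fubini_tonelli1//=; first last.
- by move=> z; rewrite mule_ge0// lee_fin ?sin_weight_ge0.
- apply: emeasurable_funM => //; apply/measurable_EFinP.
  by apply: (measurableT_comp (measurable_sin_weight k)).
apply: eq_integral => t _; rewrite /fubini_F/=.
rewrite ge0_integralZl ?lee_fin ?sin_weight_ge0//.
- congr (_ * _); rewrite -(setIT (_ @^-1` _)) -integral_indic//.
  by rewrite -[X in measurable X]setTI; exact: measurable_polar_dir.
- by apply: measurable_fun_pair2 mP.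
Qed.

Lemma ge0_integral_svolS k (g : 'rV[R]_k.+2 -> \bar R) :
  measurable_fun setT g -> (forall x, 0 <= g x) ->
  \int[svol R k.+1]_x g x = \int[leb]_(t in `[0%R, pi])
    ((sin t ^+ k)%:E * \int[svol R k]_u g (polar t u)).
Proof.
move=> mg g0.
have mP : measurable_fun setT (fun z : R * 'rV[R]_k.+1 => g (polar z.1 z.2)).
  exact: (measurableT_comp mg (@measurable_polar _)).
rewrite (@ge0_integral_transport _ _ _ _ _ _ (leb \x svol R k) 
    (fun z => \1_`[0%R, pi] z.1 * sin z.1 ^+ k)%R (fun z => polar z.1 z.2))//.
- rewrite fubini_tonelli1//=; first last.
  + by move=> z; rewrite mule_ge0// lee_fin ?sin_weight_ge0.
  + apply: emeasurable_funM => //; apply/measurable_EFinP.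
    by apply: (measurableT_comp (measurable_sin_weight k)).
  rewrite -integral_sin_weight; apply: eq_integral => t _; rewrite /fubini_F/=.
  rewrite ge0_integralZl ?lee_fin ?sin_weight_ge0//.
  by apply: measurable_fun_pair2 mP.
- by move=> z; exact: sin_weight_ge0.
- by apply: (measurableT_comp (measurable_sin_weight k)).
- exact: measurable_polar.
- exact: svol_transport.
Qed.

End volume_measure.

(** * Substitutions in one-dimensional Lebesgue integrals *)

Section real_substitutions.
Context (R : realType).
Local Notation leb := (@lebesgue_measure R).
Local Open Scope ereal_scope.

Lemma FTC2_is_derive (F f : R -> R) (a b : R) : (a < b)%R ->
  (forall x, (a <= x <= b)%R -> is_derive x (1%R : R) F (f x)) ->
  (forall x, (a <= x <= b)%R -> {for x, continuous f}) ->
  \int[leb]_(x in `[a, b]) (f x)%:E = (F b - F a)%:E.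
Proof.
move=> ab dF cf.
have cF x : (a <= x <= b)%R -> {for x, continuous F}.
  move=> /dF dFx; apply: differentiable_continuous; apply/derivable1_diffP.
  exact: ex_derive.
rewrite (@continuous_FTC2 _ f F _ _ ab).
- by rewrite EFinB.
- apply: continuous_in_subspaceT => x; rewrite inE/= in_itv/= => /cf.
  by apply.
- split.
  + move=> x; rewrite in_itv/= => /andP[ax xb].
    by have := dF x; rewrite !ltW// => /(_ isT) /@ex_derive.
  + by apply: cvg_at_right_filter; apply: cF; rewrite lexx ltW.
  + by apply: cvg_at_left_filter; apply: cF; rewrite lexx ltW.
- move=> x; rewrite in_itv/= => /andP[ax xb].
  have := dF x; rewrite !ltW// => /(_ isT) /@derive_val.
  by rewrite derive1E.
Qed.

Section leb_transport.
Variables (w phi : R -> R).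
Hypothesis w_ge0 : forall y, (0 <= w y)%R.
Hypothesis w_meas : measurable_fun setT w.
Hypothesis phi_meas : measurable_fun setT phi.
Hypothesis wE : forall a b, (a < b)%R ->
  \int[leb]_y ((w y)%:E * (\1_`]a, b] (phi y))%:E) = (b - a)%:E.

Let mw (A : set (measurableTypeR R)) := \int[leb]_y ((w y)%:E * (\1_A (phi y))%:E).

Let mw0 : mw set0 = 0.
Proof. by rewrite /mw integral0_eq// => y _; rewrite indic0 mule0. Qed.

Let wge A y : 0 <= (w y)%:E * (\1_A (phi y))%:E.
Proof. by rewrite mule_ge0// lee_fin. Qed.

Let mw_ge0 A : 0 <= mw A.
Proof. by apply: integral_ge0 => y _; exact: wge. Qed.

Let mw_additive : semi_sigma_additive mw.
Proof.
move=> F mF tF mUF.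
have -> : mw (\bigcup_n F n) =
    \int[leb]_y (\sum_(n <oo) ((w y)%:E * (\1_(F n) (phi y))%:E)).
  apply: eq_integral => y _; rewrite nneseriesZl; last by move=> *; rewrite lee_fin.
  congr (_ * _); rewrite indicE -diracE.
  have -> : \sum_(0 <= i <oo) (\1_(F i) (phi y))%:E = \sum_(0 <= i <oo) \d_(phi y) (F i) :> \bar R.
    by apply: eq_eseriesr => i _; rewrite indicE diracE.
  by apply/esym/cvg_lim => //; apply: measure_semi_sigma_additive.
rewrite integral_nneseries//.
- by apply: is_cvg_nneseries => n _ _; apply: mw_ge0.
- move=> n; apply: emeasurable_funM; first exact/measurable_EFinP.
  apply/measurable_EFinP.
  exact: (measurableT_comp (measurable_indic (mF n)) phi_meas).
Qed.

HB.instance Definition _ := isMeasure.Build _ _ _ mw mw0 mw_ge0 mw_additive.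

(** The set function [mw] is a measure, and [wE] says that it agrees with Lebesgue measure on
    half-open intervals; by uniqueness they coincide. A substitution is thus verified on intervals
    only. *)
Lemma ge0_integral_leb_transport (h : R -> \bar R) :
  measurable_fun setT h -> (forall x, 0 <= h x) ->
  \int[leb]_x h x = \int[leb]_y ((w y)%:E * h (phi y)).
Proof.
move=> mh h0; apply: ge0_integral_transport => // A mA.
rewrite -[RHS]/(mw A); apply: (@lebesgue_measure_unique R mw) => // _ [[a b]] _ <-/=.
rewrite lebesgue_measure_itv/= lte_fin; case: ltP => ab.
  by rewrite /mw wE// EFinB.
by rewrite set_itv_ge ?bnd_simp -?leNgt//; rewrite -leNgt.
Qed.

End leb_transport.

Lemma ge0_integral_shift (h : R -> \bar R) (a : R) :
  measurable_fun setT h -> (forall x, 0 <= h x) ->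
  \int[leb]_x h (x + a)%R = \int[leb]_x h x.
Proof.
move=> mh h0; rewrite [RHS](@ge0_integral_leb_transport (cst 1%R) (fun x => x + a)%R)//.
- by apply: eq_integral => x _; rewrite mul1e.
- by apply: measurable_funD.
- move=> x y xy; under eq_integral do rewrite mul1e.
  have -> : \int[leb]_z (\1_`]x, y] (z + a)%R)%:E =
            \int[leb]_z (\1_`](x - a)%R, (y - a)%R] z)%:E.
    apply: eq_integral => z _; rewrite !indicE; congr (nat_of_bool _)%:R%:E.
    by apply/idP/idP; rewrite !inE /= !in_itv/= ltrBlDr lerBrDr.
  rewrite integral_indic// setIT/= lebesgue_measure_itv/= lte_fin ltrD2r xy -EFinB.
  by congr (_%:E); ring.
Qed.

Lemma ge0_integral_scale (h : R -> \bar R) (a : R) : (0 < a)%R ->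
  measurable_fun setT h -> (forall x, 0 <= h x) ->
  \int[leb]_x h x = \int[leb]_x (a%:E * h (a * x)%R).
Proof.
move=> a0 mh h0; apply: (@ge0_integral_leb_transport (cst a) (fun x => a * x)%R) => //.
- by move=> x; exact: ltW.
- exact: mulrl_measurable.
- move=> x y xy; rewrite /cst ge0_integralZl//; last 2 first.
  + by apply/measurable_EFinP; apply: (measurableT_comp (measurable_indic _)).
  + by rewrite lee_fin ltW.
  have -> : \int[leb]_z (\1_`]x, y] (a * z)%R)%:E =
            \int[leb]_z (\1_`](x / a)%R, (y / a)%R] z)%:E.
    apply: eq_integral => z _; rewrite !indicE; congr (nat_of_bool _)%:R%:E.
    by apply/idP/idP; rewrite !inE /= !in_itv/= ltr_pdivrMr// ler_pdivlMr// mulrC.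
  rewrite integral_indic// setIT/= lebesgue_measure_itv/= lte_fin.
  rewrite ltr_pM2r ?invr_gt0// xy -EFinB -EFinM.
  by congr (_%:E); field; rewrite gt_eqF.
Qed.

Definition cot (t : R) : R := (cos t / sin t)%R.

Lemma is_derive_cot (t : R) : sin t != 0%R ->
  is_derive t (1%R : R) (fun x => - cot x)%R (sin t ^- 2)%R.
Proof.
move=> st; rewrite /cot; der; first by [].
have -> : (- (- sin t / sin t + cos t * (- cos t / sin t ^+ 2)) =
   (cos t ^+ 2 + sin t ^+ 2) * sin t ^- 2)%R by field.
by rewrite cos2Dsin2 mul1r.
Qed.

Lemma ler_tan :
  {in `](- (pi / 2)), (pi / 2)[%R &, {mono (@tan R) : x y / (x <= y)%R}}.
Proof. by apply: le_mono_in => x y xI yI xy; rewrite ltr_tan. Qed.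

Lemma cotE (t : R) : cot t = tan (pi / 2 - t).
Proof.
by rewrite /cot /tan sinB cosB sin_pihalf cos_pihalf !mul0r !mul1r add0r subr0.
Qed.

Lemma measurable_invr : measurable_fun setT (@GRing.inv R).
Proof.
have -> : [set: R] = [set~ 0%R] `|` [set 0%R] by rewrite setUC setUv.
have o0 : open [set~ (0:R)%R].
  by apply: closed_openC; exact: closed_eq.
apply/measurable_funU => //; first exact: open_measurable.
split; last exact: measurable_fun_set1.
apply: open_continuous_measurable_fun => // x /[!inE] /= x0.
by apply: inv_continuous; apply/eqP.
Qed.

Lemma measurable_cot : measurable_fun setT cot.
Proof.
apply: measurable_funM; first by apply: continuous_measurable_fun; exact: continuous_cos.
apply: (measurableT_comp measurable_invr).
by apply: continuous_measurable_fun; exact: continuous_sin.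
Qed.

(** The substitution x = cot t, with |dx| = dt / sin(t)^2. At a fixed height y, the point y cot t
    runs through a horizontal line as t runs through the directions of the upper half-plane. *)
Lemma ge0_integral_cot (h : R -> \bar R) :
  measurable_fun setT h -> (forall x, 0 <= h x) ->
  \int[leb]_x h x = \int[leb]_(t in `]0%R, pi[) ((sin t ^- 2)%:E * h (cot t)).
Proof.
move=> mh h0.
have -> : \int[leb]_(t in `]0%R, pi[) ((sin t ^- 2)%:E * h (cot t)) =
  \int[leb]_t ((\1_`]0%R, pi[ t * sin t ^- 2)%:E * h (cot t)).
  rewrite [LHS]integral_mkcond; apply: eq_integral => t _.
  by rewrite patchE indicE; case: ifP; rewrite ?mul1r ?mul0r ?mul0e.
apply: ge0_integral_leb_transport => //.
- by move=> y; rewrite mulr_ge0// invr_ge0 exprn_even_ge0.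
- apply: measurable_funM; first exact: measurable_indic.
  apply: (measurableT_comp measurable_invr); exact: measurable_sinX.
- exact: measurable_cot.
move=> a b ab; set al := (pi / 2 - atan b)%R; set al' := (pi / 2 - atan a)%R.
have alal' : (al < al')%R by rewrite ltrD2l ltrN2 lt_atan.
have al0 : (0 < al)%R by rewrite subr_gt0 atan_ltpi2.
have al'pi : (al' < pi)%R.
  by rewrite /al'; have := atan_gtNpi2 a; lra.
transitivity (\int[leb]_(t in `[al, al'[) (sin t ^- 2)%:E).
  rewrite [RHS]integral_mkcond; apply: eq_integral => t _.
  rewrite patchE mem_setE indicE mem_setE indicE mem_setE -EFinM.
  have [t0pi|t0pi] := boolP (t \in `]0%R, pi[).
    rewrite mul1r (_ : (cot t \in `]a, b]) = (t \in `[al, al'[)).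
      by case: ifP; rewrite ?mulr1 ?mulr0.
    move: t0pi; rewrite !in_itv/= => /andP[t0 tpi].
    rewrite cotE /al /al' -[in LHS](atanK a) -[in LHS](atanK b).
    have inI (x : R) : (atan x \in `](- (pi / 2)), (pi / 2)[)%R.
      by rewrite in_itv/= atan_gtNpi2 atan_ltpi2.
    have tI : (pi / 2 - t \in `](- (pi / 2)), (pi / 2)[)%R.
      by rewrite in_itv/=; apply/andP; split; lra.
    rewrite (ltr_tan (inI _) tI) (ler_tan tI (inI _)).
    by apply/idP/idP => /andP[*]; apply/andP; split; lra.
  rewrite mul0r mul0r; case: ifPn => // /[!in_itv]/= /andP[t1 t2].
  by move: t0pi; rewrite in_itv/= (lt_le_trans al0 t1) (lt_trans t2 al'pi).
have sal t : (al <= t <= al')%R -> sin t != 0%R.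
  move=> /andP[t1 t2]; rewrite gt_eqF// sin_gt0_pi//.
  by rewrite (lt_le_trans al0 t1) (le_lt_trans t2 al'pi).
rewrite integral_itv_bndo_bndc; last first.
  apply/measurable_EFinP; apply: measurable_funTS.
  apply: (measurableT_comp measurable_invr); exact: measurable_sinX.
have dcot x : (al <= x <= al')%R ->
    is_derive x (1%R : R) (fun x => - cot x)%R (sin x ^- 2)%R.
  by move=> /sal; exact: is_derive_cot.
have csin x : (al <= x <= al')%R -> {for x, continuous (fun x : R => sin x ^- 2)%R}.
  move=> /sal sx; eapply der_continuous; repeat der_step.
  by rewrite expf_neq0.
rewrite (FTC2_is_derive alal' dcot csin).
by rewrite !cotE /al /al' !subKr !atanK opprK addrC.
Qed.

End real_substitutions.

(** * Rotation invariance of the volume of the sphere *)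

Section planar_integrals.
Local Open Scope ereal_scope.

Lemma ge0_tonelli_in d1 d2 (T1 : measurableType d1) (T2 : measurableType d2) (R : realType)
  (m1 : {sigma_finite_measure set T1 -> \bar R})
  (m2 : {sigma_finite_measure set T2 -> \bar R}) (D1 : set T1) (D2 : set T2)
  (F : T1 * T2 -> \bar R) : measurable D1 -> measurable D2 ->
  measurable_fun setT F -> (forall z, 0 <= F z) ->
  \int[m1]_(x in D1) \int[m2]_(y in D2) F (x, y) =
  \int[m2]_(y in D2) \int[m1]_(x in D1) F (x, y).
Proof.
move=> mD1 mD2 mF F0.
pose G z := ((\1_D1 z.1 : R) * (\1_D2 z.2 : R))%:E * F z.
have i1 x : ((\1_D1 x : R)%:E : \bar R) >= 0 by rewrite lee_fin.
have i2 x : ((\1_D2 x : R)%:E : \bar R) >= 0 by rewrite lee_fin.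
have mG : measurable_fun setT G.
  apply: emeasurable_funM => //; apply/measurable_EFinP.
  by apply: measurable_funM; apply: (measurableT_comp (measurable_indic _)).
have G0 z : 0 <= G z by rewrite mule_ge0// lee_fin mulr_ge0.
have := @fubini_tonelli _ _ _ _ _ m1 m2 G mG G0; rewrite /fubini_F /fubini_G => H.
have L : \int[m1]_x \int[m2]_y G (x, y) = \int[m1]_(x in D1) \int[m2]_(y in D2) F (x, y).
  rewrite [RHS]integral_mkcond; apply: eq_integral => x _; rewrite patchE /G/= indicE.
  case: ifP => xD; last by rewrite integral0_eq// => y _; rewrite mul0r mul0e.
  rewrite [RHS]integral_mkcond; apply: eq_integral => y _; rewrite patchE indicE mul1r.
  by case: ifP; rewrite ?mul1e ?mul0e.
have L2 : \int[m2]_y \int[m1]_x G (x, y) = \int[m2]_(y in D2) \int[m1]_(x in D1) F (x, y).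
  rewrite [RHS]integral_mkcond; apply: eq_integral => x _; rewrite patchE /G/=.
  under eq_integral do rewrite [X in X%:E * _]mulrC [\1_D2 _]indicE.
  case: ifP => xD; last by rewrite integral0_eq// => y _; rewrite mul0r mul0e.
  rewrite [RHS]integral_mkcond; apply: eq_integral => y _; rewrite patchE indicE mul1r.
  by case: ifP; rewrite ?mul1e ?mul0e.
by rewrite -L -L2.
Qed.

Context (R : realType).
Local Notation leb := (@lebesgue_measure R).
Local Notation P := `]0%R, +oo[%classic.

Lemma ge0_integral_scale_pos (h : R -> \bar R) (a : R) : (0 < a)%R ->
  measurable_fun setT h -> (forall x, 0 <= h x) ->
  \int[leb]_(x in P) h x = \int[leb]_(x in P) (a%:E * h (a * x)%R).
Proof.
move=> a0 mh h0.
rewrite integral_mkcond (ge0_integral_scale a0).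
- rewrite [RHS]integral_mkcond; apply: eq_integral => x _.
  rewrite !patchE !mem_setE !in_itv/= !andbT pmulr_rgt0//.
  by case: ifP; rewrite ?mule0.
- by apply/(measurable_restrictT _ _).1 => //; exact: measurable_funTS.
- by move=> x; rewrite patchE; case: ifP.
Qed.

(** Two one-dimensional substitutions separated by Tonelli: x = y cot t at fixed y, then y = r sin t
    at fixed t. The Jacobians y / sin(t)^2 and sin t multiply to r. *)
Lemma planar_polar (K : R * R -> \bar R) :
  measurable_fun setT K -> (forall z, 0 <= K z) ->
  \int[leb]_x \int[leb]_(y in P) K (x, y) =
  \int[leb]_(r in P) \int[leb]_(t in `[0%R, pi])
     (r%:E * K (r * cos t, r * sin t)%R).
Proof.
move=> mK K0.
have mcos : measurable_fun setT (@cos R).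
  by apply: continuous_measurable_fun; exact: continuous_cos.
have msin : measurable_fun setT (@sin R).
  by apply: continuous_measurable_fun; exact: continuous_sin.
have K1 z r : (0 < r)%R -> 0 <= r%:E * K z by move=> r0; rewrite mule_ge0// lee_fin ltW.
apply: (etrans (ge0_tonelli_in leb leb measurableT (measurable_itv _) mK K0)).
transitivity (\int[leb]_(y in P) \int[leb]_(t in `]0%R, pi[)
   ((sin t ^- 2)%:E * (y%:E * K (y * cot t, y)%R))).
  apply: eq_integral => y /[!inE]; rewrite /= in_itv/= andbT => y0.
  have my : measurable_fun setT (fun x => K (x, y)) by exact: measurable_fun_pair1 mK.
  rewrite (ge0_integral_scale y0)// ge0_integral_cot//.
  - apply: emeasurable_funM; first exact: measurable_cst.
    by apply: (measurableT_comp my); exact: mulrl_measurable.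
  - by move=> x; exact: K1.
pose F z := (sin z.2 ^- 2)%:E * (`|z.1|%:E * K (z.1 * cot z.2, z.1)%R).
have mF : measurable_fun setT F.
  apply: emeasurable_funM.
    apply/measurable_EFinP; apply: (measurableT_comp (@measurable_invr R)).
    by apply: measurable_funX; apply: (measurableT_comp msin).
  apply: emeasurable_funM.
    by apply/measurable_EFinP; apply: (measurableT_comp (@normr_measurable R setT)).
  apply: (measurableT_comp mK); apply/measurable_fun_pairP; split => //=.
  - by apply: measurable_funM => //; apply: (measurableT_comp (@measurable_cot R)).
  - exact: measurable_fst.
have F0 z : 0 <= F z.
  by rewrite mule_ge0 ?mule_ge0// lee_fin// invr_ge0 exprn_even_ge0.
transitivity (\int[leb]_(y in P) \int[leb]_(t in `]0%R, pi[) F (y, t)).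
  apply: eq_integral => y /[!inE]; rewrite /= in_itv/= andbT => y0.
  by apply: eq_integral => t _; rewrite /F/= gtr0_norm.
apply: (etrans (ge0_tonelli_in leb leb (measurable_itv _) (measurable_itv _) mF F0)).
pose G z := `|z.1|%:E * K (z.1 * cos z.2, z.1 * sin z.2)%R.
have mG : measurable_fun setT G.
  apply: emeasurable_funM.
    by apply/measurable_EFinP; apply: (measurableT_comp (@normr_measurable R setT)).
  apply: (measurableT_comp mK); apply/measurable_fun_pairP; split => //=.
  - by apply: measurable_funM => //; apply: (measurableT_comp mcos).
  - by apply: measurable_funM => //; apply: (measurableT_comp msin).
have G0 z : 0 <= G z by rewrite mule_ge0// lee_fin.
transitivity (\int[leb]_(t in `]0%R, pi[) \int[leb]_(r in P) G (r, t)).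
  apply: eq_integral => t /[!inE]; rewrite /= in_itv/= => t0pi.
  have s0 : (0 < sin t)%R by exact: sin_gt0_pi.
  rewrite (ge0_integral_scale_pos s0)//; last exact: measurable_fun_pair1 mF.
  apply: eq_integral => r /[!inE]; rewrite /= in_itv/= andbT => r0.
  rewrite /F /G/= !muleA -!EFinM normrM !gtr0_norm//.
  congr (_%:E * K _).
    by field; rewrite gt_eqF.
  congr (_, _); last by rewrite mulrC.
  by rewrite /cot; field; rewrite gt_eqF.
apply: (etrans (esym (ge0_tonelli_in leb leb (measurable_itv _) (measurable_itv _) mG G0))).
apply: eq_integral => r /[!inE]; rewrite /= in_itv/= andbT => r0.
rewrite -(@integral_itv_bndoo _ _ _ _ true false); last first.
  by apply: measurable_funTS; exact: measurable_fun_pair2 mG.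
by apply: eq_integral => t _; rewrite /G/= gtr0_norm.
Qed.

(** Lebesgue measure of R^n as an iterated integral: coordinates are split off one at a time, in
    step with the recursion that defines [svol]. *)
Fixpoint lebint n : ('rV[R]_n -> \bar R) -> \bar R :=
  match n with
  | 0 => fun g => g 0%R
  | n'.+1 => fun g => \int[leb]_x lebint (fun v : 'rV[R]_n' => g (row_mx x%:M v))
  end.

Lemma lebintS n (g : 'rV[R]_n.+1 -> \bar R) :
  lebint g = \int[leb]_x lebint (fun v : 'rV[R]_n => g (row_mx x%:M v)).
Proof. by []. Qed.

Lemma lebint_ge0 n (g : 'rV[R]_n -> \bar R) : (forall v, 0 <= g v) -> 0 <= lebint g.
Proof.
elim: n g => [|n IH] g g0 //=; apply: integral_ge0 => x _; exact: IH.
Qed.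

Lemma measurable_cons n d (T : measurableType d) (a : T -> R) (b : T -> 'rV[R]_n) :
  measurable_fun setT a -> measurable_fun setT b ->
  measurable_fun setT (fun t => row_mx (a t)%:M (b t) : 'rV[R]_n.+1).
Proof.
move=> ma mb; have := @measurable_fun_row_mx R _ T 1 n (fun t => (a t)%:M) b.
by apply => //; exact: measurable_fun_scalar_mx1.
Qed.

Lemma measurable_lebint n d (T : measurableType d) (G : T * 'rV[R]_n -> \bar R) :
  measurable_fun setT G -> (forall z, 0 <= G z) ->
  measurable_fun setT (fun t => lebint (fun v => G (t, v))).
Proof.
elim: n d T G => [|n IH] d T G mG G0 /=; first exact: measurable_fun_pair1 mG.
pose G' (z : (T * R) * 'rV[R]_n) := G (z.1.1, row_mx z.1.2%:M z.2 : 'rV[R]_n.+1).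
have mG' : measurable_fun setT G'.
  apply: (measurableT_comp mG); apply/measurable_fun_pairP; split => //=.
    exact: (measurableT_comp measurable_fst measurable_fst).
  by apply: measurable_cons => //; exact: (measurableT_comp measurable_snd measurable_fst).
apply: (@measurable_fun_fubini_tonelli_F _ _ _ _ _ leb (fun z => lebint (fun v => G' (z, v)))).
- by apply: (IH _ _ G') => // z; exact: G0.
- by move=> z; apply: lebint_ge0 => v; exact: G0.
Qed.

Lemma ge0_integral_svol0 (h : 'rV[R]_1 -> \bar R) :
  measurable_fun setT h -> (forall v, 0 <= h v) ->
  \int[svol R 0]_u h u = h (const_mx 1%R) + h (const_mx (-1)%R).
Proof.
move=> mh h0.
pose da : {measure set 'rV[R]_1 -> \bar R} := \d_(const_mx 1%R).
pose db : {measure set 'rV[R]_1 -> \bar R} := \d_(const_mx (-1)%R).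
rewrite (eq_measure_integral (measure_add da db)).
  by rewrite ge0_integral_measure_add// !integral_dirac// !diracT !mul1e.
by move=> A mA _; exact: (esym (measure_addE da db A)).
Qed.

Lemma ge0_integral_symm (h : R -> \bar R) :
  measurable_fun setT h -> (forall v, 0 <= h v) ->
  \int[leb]_x h x = \int[leb]_(r in P) (h r + h (- r)%R).
Proof.
move=> mh h0.
have mhN : measurable_fun setT (fun x : R => h (- x)%R).
  exact: (measurableT_comp mh (@oppr_measurable R setT)).
rewrite ge0_integralD//; [|exact: measurable_funTS..].
rewrite [X in _ + X]integral_itv_obnd_cbnd; last exact: measurable_funTS.
rewrite [X in _ + X]ge0_integration_by_substitution0//.
under [X in _ + X]eq_integral do rewrite opprK.
rewrite -ge0_integral_setU//.
- by rewrite setUC -itv_bndbnd_setU// set_itvNyy.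
- exact: measurable_funTS.
- apply/disj_setPS => x [] /=; rewrite !in_itv/= andbT => x0 x1.
  by move: x1; rewrite leNgt x0.
Qed.

(** By induction the coordinates after the first are in polar form with a radius rho and weight
    rho^k; the pair formed by the first coordinate and rho lies in the upper half-plane. Planar
    polar coordinates turn rho into r sin t, and r (r sin t)^k is r^(k+1) times the weight sin(t)^k
    of [svol] in the next dimension. *)
Lemma lebint_cone k (g : 'rV[R]_k.+1 -> \bar R) :
  measurable_fun setT g -> (forall v, 0 <= g v) ->
  lebint g = \int[leb]_(r in P) ((r ^+ k)%:E * \int[svol R k]_u g (r *: u)).
Proof.
elim: k g => [|k IH] g mg g0.
  rewrite lebintS /= ge0_integral_symm//; last first.
    by apply: (measurableT_comp mg); exact: measurable_cons.
  apply: eq_integral => r _; rewrite mul1e ge0_integral_svol0//; last first.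
    apply: (measurableT_comp mg).
    exact: (@measurable_fun_scalemx _ _ _ _ _ (cst r) id).
  have E x : row_mx x%:M (0%R : 'rV[R]_0) = x *: (const_mx 1%R : 'rV[R]_1).
    apply/rowP => i; rewrite !mxE mulr1; case: splitP => [j _|[//]].
    by rewrite ord1 mxE mulr1n.
  have -> : r *: (const_mx (-1)%R : 'rV[R]_1) = (- r) *: const_mx 1%R.
    by apply/rowP => i; rewrite !mxE mulr1 mulrN1.
  by rewrite -!E.
rewrite lebintS.
pose G (z : R * R) := \int[svol R k]_u g (row_mx z.1%:M (z.2 *: u) : 'rV[R]_k.+2).
have mg' : measurable_fun setT
    (fun z : (R * R) * 'rV[R]_k.+1 => g (row_mx z.1.1%:M (z.1.2 *: z.2) : 'rV[R]_k.+2)).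
  apply: (measurableT_comp mg); apply: measurable_cons.
    exact: (measurableT_comp measurable_fst measurable_fst).
  apply: measurable_fun_scalemx => //.
  exact: (measurableT_comp measurable_snd measurable_fst).
have mG : measurable_fun setT G.
  exact: (@measurable_fun_fubini_tonelli_F _ _ _ _ _ (svol R k) _ mg').
have G0 z : 0 <= G z by apply: integral_ge0.
pose K (z : R * R) := (`|z.2| ^+ k)%:E * G z.
have mK : measurable_fun setT K.
  apply: emeasurable_funM => //; apply/measurable_EFinP; apply: measurable_funX.
  exact: (measurableT_comp (@normr_measurable R setT) measurable_snd).
have K0 z : 0 <= K z by rewrite mule_ge0// lee_fin.
transitivity (\int[leb]_x \int[leb]_(y in P) K (x, y)).
  apply: eq_integral => x _; rewrite IH//; last first.
    by apply: (measurableT_comp mg); exact: measurable_cons.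
  apply: eq_integral => r /[!inE]; rewrite /= in_itv/= andbT => r0.
  by rewrite /K/= gtr0_norm.
rewrite planar_polar//.
apply: eq_integral => r /[!inE]; rewrite /= in_itv/= andbT => r0.
have mgr : measurable_fun setT (fun u : 'rV[R]_k.+2 => g (r *: u)).
  apply: (measurableT_comp mg).
  exact: (@measurable_fun_scalemx _ _ _ _ _ (cst r) id).
rewrite ge0_integral_svolS//.
pose H (t : R) := (sin t ^+ k)%:E * \int[svol R k]_u g (r *: polar t u).
have mH : measurable_fun setT H.
  apply: emeasurable_funM; first by apply/measurable_EFinP; exact: measurable_sinX.
  apply: (@measurable_fun_fubini_tonelli_F _ _ _ _ _ (svol R k)
    (fun z : R * 'rV[R]_k.+1 => g (r *: polar z.1 z.2))) => //.
  exact: (measurableT_comp mgr (@measurable_polar R k)).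
have H0 t : `[0%R, pi]%classic t -> 0 <= H t.
  by move=> /sin_ge0_itv t0; rewrite mule_ge0 ?integral_ge0// lee_fin exprn_ge0.
transitivity (\int[leb]_(t in `[0%R, pi]) ((r ^+ k.+1)%:E * H t)); last first.
  apply: ge0_integralZl => //; first exact: measurable_funTS.
  by rewrite lee_fin exprn_ge0 ?ltW.
apply: eq_integral => t /[!inE] /sin_ge0_itv t0.
rewrite /K/= /G /H !muleA -!EFinM ger0_norm ?mulr_ge0 ?(ltW r0)//.
congr (_%:E * _); first by rewrite exprMn exprS mulrA.
apply: eq_integral => u _; congr g.
by have := @scale_row_mx R 1 1 k.+1 r (cos t)%:M (sin t *: u);
  rewrite scalerA scale_scalar_mx => <-.
Qed.

End planar_integrals.

Section euclidean.
Context (R : realType).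

Lemma dotpC n (u v : 'rV[R]_n) : dotp u v = dotp v u.
Proof. by apply: eq_bigr => i _; rewrite mulrC. Qed.

Lemma dotpDl n (u v w : 'rV[R]_n) : dotp (u + v) w = dotp u w + dotp v w.
Proof. by rewrite /dotp -big_split; apply: eq_bigr => i _; rewrite mxE mulrDl. Qed.

Lemma dotpZl n a (u v : 'rV[R]_n) : dotp (a *: u) v = a * dotp u v.
Proof. by rewrite /dotp mulr_sumr; apply: eq_bigr => i _; rewrite mxE mulrA. Qed.

Lemma dotpDr n (u v w : 'rV[R]_n) : dotp w (u + v) = dotp w u + dotp w v.
Proof. by rewrite dotpC dotpDl !(dotpC w). Qed.

Lemma dotpZr n a (u v : 'rV[R]_n) : dotp u (a *: v) = a * dotp u v.
Proof. by rewrite dotpC dotpZl dotpC. Qed.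

Lemma dotpNl n (u v : 'rV[R]_n) : dotp (- u) v = - dotp u v.
Proof. by rewrite -scaleN1r dotpZl mulN1r. Qed.

Lemma dotpNr n (u v : 'rV[R]_n) : dotp u (- v) = - dotp u v.
Proof. by rewrite dotpC dotpNl dotpC. Qed.

Lemma dotp0l n (v : 'rV[R]_n) : dotp 0 v = 0.
Proof. by rewrite -(scale0r v) dotpZl mul0r. Qed.

Lemma dotp0r n (v : 'rV[R]_n) : dotp v 0 = 0.
Proof. by rewrite dotpC dotp0l. Qed.

Lemma dotp_ge0 n (u : 'rV[R]_n) : 0 <= dotp u u.
Proof. by apply: sumr_ge0 => i _; rewrite -expr2 sqr_ge0. Qed.

Lemma dotp_eq0 n (u : 'rV[R]_n) : (dotp u u == 0) = (u == 0).
Proof.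
apply/idP/eqP => [|->]; last by rewrite dotp0l.
rewrite psumr_eq0 => [/allP H|i _]; last by rewrite -expr2 sqr_ge0.
apply/rowP => i; rewrite mxE; apply/eqP.
by have := H i (mem_index_enum i); rewrite -expr2 sqrf_eq0.
Qed.

Lemma enorm_ge0 n (u : 'rV[R]_n) : 0 <= enorm u.
Proof. exact: sqrtr_ge0. Qed.

Lemma enorm_sqr n (u : 'rV[R]_n) : enorm u ^+ 2 = dotp u u.
Proof. by rewrite sqr_sqrtr ?dotp_ge0. Qed.

Lemma enorm_eq0 n (u : 'rV[R]_n) : (enorm u == 0) = (u == 0).
Proof. by rewrite -dotp_eq0 -enorm_sqr sqrf_eq0. Qed.

Lemma enorm0 n : enorm (0 : 'rV[R]_n) = 0.
Proof. by apply/eqP; rewrite enorm_eq0. Qed.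

Lemma enormZ n a (u : 'rV[R]_n) : enorm (a *: u) = `|a| * enorm u.
Proof.
by rewrite /enorm dotpZl dotpZr mulrA -expr2 sqrtrM ?sqr_ge0// sqrtr_sqr.
Qed.

Lemma sphereE k (x : 'rV[R]_k.+1) : sphere R k x <-> dotp x x = 1.
Proof.
rewrite /sphere/=; split => [H|H]; last by rewrite /enorm H sqrtr1.
by rewrite -enorm_sqr H expr1n.
Qed.

Lemma dotp_mulmx n (u v : 'rV[R]_n) : dotp u v = (u *m v^T) 0 0.
Proof. by rewrite mxE; apply: eq_bigr => i _; rewrite mxE. Qed.

Lemma dotp_row_mx m n (a c : 'rV[R]_m) (b d : 'rV[R]_n) :
  dotp (row_mx a b) (row_mx c d) = dotp a c + dotp b d.
Proof.
rewrite /dotp big_split_ord/=.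
by congr (_ + _); apply: eq_bigr => i _; rewrite ?row_mxEl ?row_mxEr.
Qed.

Lemma dotp_scalar1 (a b : R) : dotp (a%:M : 'rV_1) b%:M = a * b.
Proof. by rewrite /dotp big_ord1 !mxE !mulr1n. Qed.

Lemma CauchySchwarz n (u v : 'rV[R]_n) : `|dotp u v| <= enorm u * enorm v.
Proof.
have [->|v0] := eqVneq v 0; first by rewrite dotp0r normr0 mulr_ge0 ?enorm_ge0.
have vv : 0 < dotp v v by rewrite lt_neqAle eq_sym dotp_eq0 v0 dotp_ge0.
have := dotp_ge0 (dotp v v *: u - dotp u v *: v).
rewrite dotpDl !dotpDr !dotpNl !dotpNr !dotpZl !dotpZr (dotpC v u) => H.
have {}H : 0 <= dotp v v * (dotp u u * dotp v v - dotp u v ^+ 2).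
  by rewrite (le_trans H)// le_eqVlt; apply/orP; left; apply/eqP; ring.
rewrite pmulr_rge0// subr_ge0 in H.
rewrite -ler_sqr ?nnegrE ?mulr_ge0 ?enorm_ge0//.
by rewrite exprMn !enorm_sqr real_normK// num_real.
Qed.

Definition orthmx n (Q : 'M[R]_n) := forall u v, dotp (u *m Q) (v *m Q) = dotp u v.

Lemma orthmx_mulmxT n (Q : 'M[R]_n) : orthmx Q -> Q *m Q^T = 1%:M.
Proof.
move=> oQ; apply/matrixP => i j.
transitivity (dotp (row i Q) (row j Q)).
  by rewrite mxE; apply: eq_bigr => l _; rewrite !mxE.
by rewrite !rowE oQ dotp_mulmx trmx_delta mul_delta_mx_cond mulmxnE !mxE/=.
Qed.

Lemma orthmx_mul n (Q Q' : 'M[R]_n) : orthmx Q -> orthmx Q' -> orthmx (Q *m Q').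
Proof. by move=> oQ oQ' u v; rewrite !mulmxA oQ' oQ. Qed.

Lemma enorm_orthmx n (Q : 'M[R]_n) u : orthmx Q -> enorm (u *m Q) = enorm u.
Proof. by move=> oQ; rewrite /enorm oQ. Qed.

Lemma measurable_fun_mulmxr d (T : measurableType d) m n (Q : 'M[R]_(m, n))
    (h : T -> 'rV[R]_m) :
  measurable_fun setT h -> measurable_fun setT (fun t => h t *m Q).
Proof.
move=> mh; apply: measurable_fun_mx => i j; under eq_fun do rewrite mxE.
apply: measurable_sum => l; apply: measurable_funM => //.
exact: measurable_fun_coord.
Qed.

Lemma measurable_dotp d (T : measurableType d) n (a b : T -> 'rV[R]_n) :
  measurable_fun setT a -> measurable_fun setT b ->
  measurable_fun setT (fun t => dotp (a t) (b t)).
Proof.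
move=> ma mb; apply: measurable_sum => l.
by apply: measurable_funM; exact: measurable_fun_coord.
Qed.

Lemma measurable_enorm d (T : measurableType d) n (a : T -> 'rV[R]_n) :
  measurable_fun setT a -> measurable_fun setT (fun t => enorm (a t)).
Proof.
move=> ma; apply: (measurableT_comp _ (measurable_dotp ma ma)).
by apply: continuous_measurable_fun; exact: sqrt_continuous.
Qed.

Lemma measurable_sphere k : measurable (sphere R k).
Proof.
have -> : sphere R k = (fun x => enorm x) @^-1` [set 1] by [].
rewrite -[X in measurable X]setTI.
exact: (@measurable_enorm _ _ _ id).
Qed.

End euclidean.

(** * Rotations of the first two coordinates preserve iterated Lebesgue measure *)

Section rotations.
Context (R : realType).
Local Notation leb := (@lebesgue_measure R).

Definition rotmx n (c s : R) : 'M[R]_(1 + (1 + n)) :=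
  block_mx c%:M (row_mx s%:M 0) (col_mx (- s)%:M 0)
    (block_mx c%:M 0 0 1%:M).

Lemma mul_rotmx n c s (x y : R) (v : 'rV[R]_n) :
  row_mx x%:M (row_mx y%:M v) *m rotmx n c s =
  row_mx (c * x - s * y)%:M (row_mx (s * x + c * y)%:M v).
Proof.
rewrite /rotmx mul_row_block mul_row_col mul_mx_row mul_row_block.
rewrite !mulmx0 !addr0 add0r mulmx1 add_row_mx add0r -!scalar_mxM -!raddfD.
by congr (row_mx _%:M (row_mx _%:M _)); ring.
Qed.

Lemma orthmx_rotmx n c s : c ^+ 2 + s ^+ 2 = 1 -> orthmx (rotmx n c s).
Proof.
move=> cs u v; rewrite -[u]hsubmxK -[rsubmx u]hsubmxK -[v]hsubmxK -[rsubmx v]hsubmxK.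
rewrite (mx11_scalar (lsubmx u)) (mx11_scalar (lsubmx (rsubmx u))).
rewrite (mx11_scalar (lsubmx v)) (mx11_scalar (lsubmx (rsubmx v))).
rewrite !mul_rotmx !dotp_row_mx !dotp_scalar1 !addrA; congr (_ + _).
move: (_ 0 0) (_ 0 0) (_ 0 0) (_ 0 0) => x y z t.
have -> : t * y + z * x = (c ^+ 2 + s ^+ 2) * (t * y + z * x) by rewrite cs mul1r.
by ring.
Qed.

Definition diag1mx n (Q : 'M[R]_n) : 'M[R]_(1 + n) := block_mx 1%:M 0 0 Q.

Lemma mul_diag1mx n (Q : 'M[R]_n) (a : 'rV[R]_1) b :
  row_mx a b *m diag1mx Q = row_mx a (b *m Q).
Proof. by rewrite mul_row_block !mulmx0 mulmx1 addr0 add0r. Qed.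

Lemma orthmx_diag1mx n (Q : 'M[R]_n) : orthmx Q -> orthmx (diag1mx Q).
Proof.
move=> oQ u v; rewrite -[u]hsubmxK -[v]hsubmxK !mul_diag1mx.
by rewrite !dotp_row_mx oQ.
Qed.

Local Open Scope ereal_scope.

Lemma planar_shift1 (K : R * R -> \bar R) (a : R) :
  measurable_fun setT K -> (forall z, 0 <= K z) ->
  \int[leb]_x \int[leb]_y K (x + a * y, y)%R = \int[leb]_x \int[leb]_y K (x, y).
Proof.
move=> mK K0.
have mK' : measurable_fun setT (fun z : R * R => K (z.1 + a * z.2, z.2)%R).
  apply: (measurableT_comp mK); apply/measurable_fun_pairP; split => //=.
  + by apply: measurable_funD => //; apply: measurable_funM.
  + exact: measurable_snd.
rewrite (ge0_tonelli_in leb leb measurableT measurableT mK (fun z => K0 z)).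
apply: (etrans (ge0_tonelli_in leb leb measurableT measurableT mK' (fun z => K0 _))).
apply: eq_integral => y _ /=.
rewrite (ge0_integral_shift (h := fun x => K (x, y)))//.
exact: measurable_fun_pair1 mK.
Qed.

Lemma planar_shift2 (K : R * R -> \bar R) (a : R) :
  measurable_fun setT K -> (forall z, 0 <= K z) ->
  \int[leb]_x \int[leb]_y K (x, y + a * x)%R = \int[leb]_x \int[leb]_y K (x, y).
Proof.
move=> mK K0; apply: eq_integral => x _.
rewrite (ge0_integral_shift (h := fun y => K (x, y)))//.
exact: measurable_fun_pair2 mK.
Qed.

(** A horizontal shear by a, a vertical one by s and again a horizontal one by a compose to the
    rotation, where a = (c - 1) / s is minus the tangent of the half angle. Each shear is a
    translation in one variable. The half-turn, where s = 0, escapes this decomposition. *)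
Lemma planar_rotation (K : R * R -> \bar R) (c s : R) :
  (c ^+ 2 + s ^+ 2 = 1)%R -> s != 0%R ->
  measurable_fun setT K -> (forall z, 0 <= K z) ->
  \int[leb]_x \int[leb]_y K (c * x - s * y, s * x + c * y)%R =
  \int[leb]_x \int[leb]_y K (x, y).
Proof.
move=> cs s0 mK K0; pose a : R := ((c - 1) / s)%R.
have mshear1 : measurable_fun setT (fun z : R * R => (z.1 + a * z.2, z.2)%R).
  apply/measurable_fun_pairP; split => //=.
  + by apply: measurable_funD => //; apply: measurable_funM.
  + exact: measurable_snd.
have mshear2 : measurable_fun setT (fun z : R * R => (z.1, z.2 + s * z.1)%R).
  apply/measurable_fun_pairP; split => //=; first exact: measurable_fst.
  by apply: measurable_funD => //; apply: measurable_funM.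
pose K1 z := K (z.1 + a * z.2, z.2)%R.
have mK1 : measurable_fun setT K1 by exact: (measurableT_comp mK mshear1).
pose K2 z := K1 (z.1, z.2 + s * z.1)%R.
have mK2 : measurable_fun setT K2 by exact: (measurableT_comp mK1 mshear2).
have := @planar_shift1 K2 a mK2 (fun z => K0 _).
rewrite (@planar_shift2 K1 s mK1 (fun z => K0 _)) (@planar_shift1 K a mK K0) => <-.
apply: eq_integral => x _; apply: eq_integral => y _; rewrite /K2 /K1/=.
have sa : (s * a = c - 1)%R by rewrite /a; field.
have E1 : (s * x + c * y = y + s * (x + a * y))%R by rewrite mulrDr mulrA sa; ring.
congr (K (_, _)) => //; rewrite -E1.
apply: (mulfI s0).
have -> : (s * (x + a * y + a * (s * x + c * y)) = s * x + (s * a) * y + (s * a) * (s * x + c * y))%R by ring.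
rewrite sa.
have -> : (s * (c * x - s * y) = s * c * x - (c ^+ 2 + s ^+ 2) * y + c ^+ 2 * y)%R by ring.
by rewrite cs; ring.
Qed.

Lemma lebint_rotmx n (g : 'rV[R]_(1 + (1 + n)) -> \bar R) (c s : R) :
  (c ^+ 2 + s ^+ 2 = 1)%R -> s != 0%R ->
  measurable_fun setT g -> (forall v, 0 <= g v) ->
  lebint (fun v => g (v *m rotmx n c s)) = lebint (g : 'rV[R]_n.+2 -> \bar R).
Proof.
move=> cs s0 mg g0; rewrite !lebintS.
pose K (z : R * R) := lebint (fun v : 'rV[R]_n => g (row_mx z.1%:M (row_mx z.2%:M v))).
have mK : measurable_fun setT K.
  apply: (@measurable_lebint _ n _ (R * R)%type (fun z => g (row_mx z.1.1%:M (row_mx z.1.2%:M z.2)))) => //.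
  apply: (measurableT_comp mg); apply: (@measurable_cons _ (1 + n)).
    exact: (measurableT_comp measurable_fst measurable_fst).
  by apply: measurable_cons => //; exact: (measurableT_comp measurable_snd measurable_fst).
rewrite -[RHS](planar_rotation cs s0 mK); last by move=> z; exact: lebint_ge0.
apply: eq_integral => x _; rewrite lebintS; apply: eq_integral => y _; rewrite /K/=.
by congr lebint; apply/funext => v; rewrite mul_rotmx.
Qed.

End rotations.

Section rotation_invariance.
Context (R : realType).
Local Notation leb := (@lebesgue_measure R).
Local Open Scope ereal_scope.

Lemma polar_dotp k (t : R) (u v : 'rV[R]_k.+1) (s : R) :
  dotp (polar t u) (polar s v) = (cos t * cos s + sin t * sin s * dotp u v)%R.
Proof.
have := dotp_row_mx (cos t)%:M (cos s)%:M (sin t *: u) (sin s *: v).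
by rewrite dotp_scalar1 dotpZl dotpZr mulrA; exact.
Qed.

Lemma sphere_polar k (t : R) (u : 'rV[R]_k.+1) :
  sphere R k u -> sphere R k.+1 (polar t u).
Proof.
move=> /sphereE u1; apply/sphereE.
by rewrite polar_dotp u1 mulr1 -!expr2 cos2Dsin2.
Qed.

Lemma svol_sphereC k : svol R k (~` sphere R k) = 0.
Proof.
elim: k => [|k IH].
  have n1 : enorm (const_mx 1%R : 'rV[R]_1) = 1%R.
    by apply/sphereE; rewrite /dotp big_ord1 !mxE mulr1.
  have nN1 : enorm (const_mx (-1)%R : 'rV[R]_1) = 1%R.
    by apply/sphereE; rewrite /dotp big_ord1 !mxE mulrNN mulr1.
  by rewrite /= !diracE !memNset ?adde0//= /sphere/=; exact.
rewrite svolS integral0_eq// => t _.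
suff -> : svol R k (polar t @^-1` (~` sphere R k.+1)) = 0 by rewrite mule0.
apply: (@subset_measure0 _ _ _ (svol R k) _ (~` sphere R k)) => //.
- rewrite -[X in measurable X]setTI; apply: measurable_polar_dir => //.
  by apply: measurableC; exact: measurable_sphere.
- by apply: measurableC; exact: measurable_sphere.
- by move=> u /= H /(sphere_polar t).
Qed.

Definition svol_invariant k (Q : 'M[R]_k.+1) :=
  forall A, measurable A -> svol R k [set x | A (x *m Q)] = svol R k A.

Lemma unit_ball_cone k : exists2 C : R, (0 < C)%R &
  \int[leb]_(r in `]0%R, +oo[) ((r ^+ k)%:E * (\1_`]0%R, 1%R] r)%:E) = C%:E.
Proof.
exists (k.+1%:R^-1)%R; first by rewrite invr_gt0.
transitivity (\int[leb]_(r in `[0%R, 1%R]) (r ^+ k)%:E).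
  rewrite -(integral_itv_obnd_cbnd (f := fun r => (r ^+ k)%:E)); last first.
    by apply/measurable_EFinP; exact: exprn_measurable.
  rewrite integral_mkcond [RHS]integral_mkcond; apply: eq_integral => r _.
  rewrite !patchE indicE !mem_setE !in_itv/= andbT.
  by case: (0 < r)%R => //=; case: (r <= 1)%R => //=; rewrite ?mule1 ?mule0.
have dF (x : R) : (0 <= x <= 1)%R ->
    is_derive x (1%R : R) (fun x : R => x ^+ k.+1 / k.+1%:R)%R (x ^+ k)%R.
  by move=> _; der; rewrite mulr0 addr0 mulr1 mulrAC divff ?mul1r// pnatr_eq0.
have cF (x : R) : (0 <= x <= 1)%R -> {for x, continuous (fun x : R => x ^+ k)%R}.
  by move=> _; exact: exprn_continuous.
rewrite (FTC2_is_derive ltr01 dF cF).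
by rewrite expr1n expr0n/= mul0r subr0 mul1r.
Qed.

(** The indicator of the cone over A in the unit ball, with the origin removed so that the direction
    is defined. *)
Let cone_indic (k : nat) (A : set 'rV[R]_k.+1) (v : 'rV[R]_k.+1) : R :=
  (\1_`]0%R, 1%R] (enorm v) * \1_A ((enorm v)^-1 *: v))%R.

Let cone_indic_ge0 k A v : 0 <= (@cone_indic k A v)%:E.
Proof. by rewrite lee_fin mulr_ge0. Qed.

Let measurable_cone_indic k A : measurable A ->
  measurable_fun setT (fun v => (@cone_indic k A v)%:E).
Proof.
move=> mA; apply/measurable_EFinP.
have mn : measurable_fun setT (@enorm R k.+1) by exact: (@measurable_enorm _ _ _ _ id).
apply: measurable_funM; first exact: (measurableT_comp (measurable_indic _)).
apply: (measurableT_comp (measurable_indic mA)).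
apply: (@measurable_fun_scalemx _ _ _ _ _ (fun v => (enorm v)^-1)%R id) => //.
exact: (measurableT_comp (@measurable_invr R)).
Qed.

(** The cone over A has Lebesgue measure proportional to [svol R k A]. The constant is positive and
    finite, so it can be cancelled, and an invariance of Lebesgue measure under a linear isometry
    descends to the sphere. *)
Lemma lebint_cone_indic k : exists2 C : R, (0 < C)%R &
  forall A : set 'rV[R]_k.+1, measurable A ->
  lebint (fun v => (cone_indic A v)%:E) = C%:E * svol R k A.
Proof.
have [C C0 CE] := unit_ball_cone k; exists C => // A mA.
rewrite lebint_cone//; last exact: measurable_cone_indic.
transitivity (\int[leb]_(r in `]0%R, +oo[) (((r ^+ k)%:E * (\1_`]0%R, 1%R] r)%:E) * svol R k A)).
  apply: eq_integral => r /[!inE]; rewrite /= in_itv/= andbT => r0.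
  rewrite -muleA; congr (_ * _).
  transitivity (\int[svol R k]_u ((\1_`]0%R, 1%R] r)%:E * (\1_A u)%:E)).
    (* The two integrands agree on the sphere only; A is an arbitrary Borel set of the ambient
       space, but the complement of the sphere is null. *)
    apply: ae_eq_integral => //.
    - apply: (measurableT_comp (measurable_cone_indic mA)).
      exact: (@measurable_fun_scalemx _ _ _ _ _ (cst r) id).
    - apply: emeasurable_funM; first exact: measurable_cst.
      by apply/measurable_EFinP; exact: measurable_indic.
    exists (~` sphere R k); split.
    + by apply: measurableC; exact: measurable_sphere.
    + exact: svol_sphereC.
    + move=> u /= /not_implyP[_]; apply: contra_not => u1.
      rewrite /cone_indic enormZ u1 mulr1 gtr0_norm// scalerA mulVf ?scale1r ?EFinM//.
      by rewrite gt_eqF.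
  rewrite ge0_integralZl//.
  - by rewrite integral_indic// setIT.
  - by apply/measurable_EFinP; exact: measurable_indic.
rewrite ge0_integralZr//.
- by rewrite CE.
- apply: emeasurable_funM; apply/measurable_EFinP; first exact: exprn_measurable.
  exact: measurable_indic.
- move=> r; rewrite /= in_itv/= andbT => r0.
  by rewrite mule_ge0// lee_fin// exprn_ge0// ltW.
Qed.

Lemma svol_invariant_rotmx k (c s : R) : (c ^+ 2 + s ^+ 2 = 1)%R -> s != 0%R ->
  svol_invariant (rotmx k c s : 'M[R]_k.+2).
Proof.
move=> cs s0 A mA; have [C C0 CE] := lebint_cone_indic k.+1.
have mQ : measurable [set x | A (x *m (rotmx k c s : 'M[R]_k.+2))].
  rewrite -[X in measurable X]setTI.
  exact: (@measurable_fun_mulmxr _ _ _ _ _ (rotmx k c s : 'M[R]_k.+2) id).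
have := lebint_rotmx cs s0 (measurable_cone_indic mA) (@cone_indic_ge0 k.+1 A).
rewrite CE//.
have -> : (fun v => (cone_indic A (v *m (rotmx k c s : 'M[R]_k.+2)))%:E) =
    (fun v => (cone_indic [set x | A (x *m (rotmx k c s : 'M[R]_k.+2))] v)%:E).
  apply/funext => v; rewrite /cone_indic.
  rewrite enorm_orthmx; last exact: orthmx_rotmx.
  congr (_ * _)%:E; rewrite !indicE; congr (nat_of_bool _)%:R.
  by apply/idP/idP; rewrite !inE/= -scalemxAl.
rewrite CE// -[svol R k.+1 A]fineK ?fin_num_measure//.
rewrite -[svol R k.+1 [set _ | _]]fineK ?fin_num_measure//.
by rewrite -!EFinM => -[/mulfI ->]//; rewrite gt_eqF.
Qed.

Lemma svol_invariant_mul k (Q Q' : 'M[R]_k.+1) :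
  svol_invariant Q -> svol_invariant Q' -> svol_invariant (Q *m Q').
Proof.
move=> iQ iQ' A mA; rewrite -(iQ' A mA) -(iQ [set x | A (x *m Q')]); last first.
  rewrite -[X in measurable X]setTI.
  exact: (@measurable_fun_mulmxr _ _ _ _ _ Q' id).
by congr (svol R k _); apply/seteqP; split => x /=; rewrite mulmxA.
Qed.

Lemma svol_invariant_diag1mx k (Q : 'M[R]_k.+1) :
  svol_invariant Q -> svol_invariant (diag1mx Q : 'M[R]_k.+2).
Proof.
move=> iQ A mA; rewrite !svolS; apply: eq_integral => t _; congr (_ * _).
rewrite -(iQ (polar t @^-1` A)); last first.
  by rewrite -[X in measurable X]setTI; exact: measurable_polar_dir.
congr (svol R k _); apply/seteqP.
by have H u := @mul_diag1mx R _ Q (cos t)%:M (sin t *: u);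
  split => u /=; have := H u; rewrite -scalemxAl /polar => ->.
Qed.

Definition pole k : 'rV[R]_k.+1 := delta_mx ord0 ord0.

Lemma pole_row k : pole k.+1 = row_mx (1%R)%:M (0%R : 'rV[R]_k.+1) :> 'rV[R]_(1 + k.+1).
Proof.
apply/rowP => i; rewrite !mxE; case: splitP => j ij.
  by rewrite mxE -(val_eqE i)/= ij ord1.
by rewrite mxE -(val_eqE i)/= ij.
Qed.

(** Invariance under every orthogonal matrix is more than the reduction uses: one invariant isometry
    carrying the pole to p is enough. Writing p = (a, b), a planar rotation sends the pole to a
    vector of first coordinate a and the right length in the second, and an isometry fixing the
    pole, given by induction, turns the remaining coordinates towards b. *)
Lemma svol_transitive k (p : 'rV[R]_k.+1) : sphere R k p ->
  exists Q : 'M[R]_k.+1, [/\ orthmx Q, svol_invariant Q & pole k *m Q = p].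
Proof.
elim: k p => [|k IH] p.
  move=> /sphereE; rewrite /dotp big_ord1; set a := p 0%R 0%R => aa.
  exists a%:M; split.
  - by move=> u v; rewrite !mul_mx_scalar dotpZl dotpZr mulrA aa mul1r.
  - move=> A mA; have /eqP : (a ^+ 2 == 1)%R by rewrite expr2 aa.
    move=> /eqP; rewrite sqrf_eq1 => /orP[] /eqP ->.
      by congr (svol R 0 _); apply/seteqP; split => x /=; rewrite mulmx1.
    have E b : (const_mx b : 'rV[R]_1) *m (-1)%:M = const_mx (- b)%R.
      by rewrite mul_mx_scalar; apply/rowP => i; rewrite !mxE mulN1r.
    have D (x : 'rV[R]_1) : \d_x [set y | A (y *m (-1)%:M)] = \d_(x *m (-1)%:M) A :> \bar R.
      by rewrite !diracE; congr (nat_of_bool _)%:R%:E; apply/idP/idP; rewrite !inE.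
    by rewrite /= !D !E opprK addeC.
  - by rewrite mul_mx_scalar; apply/rowP => i; rewrite !mxE !ord1 mulr1.
have := @hsubmxK R 1 1 k.+1 p; rewrite (mx11_scalar (@lsubmx R 1 1 k.+1 p)).
move: (_ ord0 ord0) (@rsubmx R 1 1 k.+1 p) => a b <- /sphereE.
have -> := dotp_row_mx a%:M a%:M b b; rewrite dotp_scalar1 => ab.
have poleE : pole k.+1 = row_mx 1%:M (row_mx (0%:M) 0) :> 'rV[R]_(1 + (1 + k)).
  by rewrite pole_row raddf0 row_mx0.
have rotE c s : pole k.+1 *m (rotmx k c s : 'M[R]_k.+2) =
    row_mx c%:M (s *: pole k) :> 'rV[R]_(1 + k.+1).
  have := @mul_rotmx R k c s 1 0 0.
  rewrite -poleE !mulr1 !mulr0 subr0 addr0 => ->.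
  congr (row_mx _ _); apply/rowP => i.
  rewrite !mxE; case: splitP => j ij; rewrite !mxE -(val_eqE i)/= ij ?ord1/=.
    by rewrite mulr1.
  by rewrite mulr0.
have [b0|b0] := eqVneq b 0%R.
  have : (a ^+ 2 == 1)%R by rewrite -ab b0 dotp0l addr0 expr2.
  rewrite b0 sqrf_eq1 => /orP[] /eqP ->.
    exists 1%:M; split.
    - by move=> u v; rewrite !mulmx1.
    - by move=> A mA; congr (svol R _ _); apply/seteqP; split => x /=; rewrite mulmx1.
    - by rewrite mulmx1 pole_row.
  (* Here p is the opposite pole. The half-turn is not a product of the shears above, so it is
     obtained as two quarter turns. *)
  have c0s1 : (0 ^+ 2 + 1 ^+ 2 = 1 :> R)%R by rewrite expr0n expr1n add0r.
  pose T : 'M[R]_k.+2 := rotmx k 0 1.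
  have oT : orthmx T by exact: orthmx_rotmx.
  have iT : svol_invariant T by apply: svol_invariant_rotmx => //; exact: oner_neq0.
  exists (T *m T); split; [exact: orthmx_mul|exact: svol_invariant_mul|].
  rewrite mulmxA poleE /T.
  have -> : row_mx (1%R)%:M (row_mx (0%R)%:M (0%R : 'rV[R]_k)) *m rotmx k 0 1 =
      row_mx (0%R)%:M (row_mx (1%R)%:M 0%R).
    by rewrite mul_rotmx; congr (row_mx _%:M (row_mx _%:M _)); ring.
  have -> : row_mx (0%R)%:M (row_mx (1%R)%:M (0%R : 'rV[R]_k)) *m rotmx k 0 1 =
      row_mx (-1)%R%:M (row_mx (0%R)%:M 0%R).
    by rewrite mul_rotmx; congr (row_mx _%:M (row_mx _%:M _)); ring.
  by rewrite raddf0 row_mx0.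
have s0 : enorm b != 0%R by rewrite enorm_eq0.
have b1 : sphere R k ((enorm b)^-1 *: b).
  by apply/sphereE; rewrite dotpZl dotpZr -enorm_sqr; field.
have [Q' [oQ' iQ' Q'b]] := IH _ b1.
have cs : (a ^+ 2 + enorm b ^+ 2 = 1)%R by rewrite enorm_sqr expr2.
exists ((rotmx k a (enorm b) : 'M[R]_k.+2) *m (diag1mx Q' : 'M[R]_k.+2)); split.
- by apply: orthmx_mul; [exact: orthmx_rotmx|exact: orthmx_diag1mx].
- by apply: svol_invariant_mul; [exact: svol_invariant_rotmx|exact: svol_invariant_diag1mx].
- rewrite mulmxA rotE.
  have := @mul_diag1mx R _ Q' a%:M (enorm b *: pole k) => ->.
  by rewrite -scalemxAl Q'b scalerA divff// scale1r.
Qed.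

End rotation_invariance.

(** * Zonal integrals *)

Section zonal_law.
Context (R : realType).
Local Notation leb := (@lebesgue_measure R).

Lemma dotp_sphere_itv k (x y : 'rV[R]_k.+1) :
  sphere R k x -> sphere R k y -> -1 <= dotp x y <= 1.
Proof.
by move=> x1 y1; rewrite -ler_norml (le_trans (CauchySchwarz x y))// x1 y1 mulr1.
Qed.

Lemma sdist_itv k (x y : 'rV[R]_k.+1) :
  sphere R k x -> sphere R k y -> 0 <= sdist x y <= pi.
Proof.
by move=> x1 y1; rewrite acos_ge0 ?acos_lepi//; exact: dotp_sphere_itv.
Qed.

Lemma ler_acos (x y : R) : -1 <= x -> x <= y -> y <= 1 -> acos y <= acos x.
Proof.
move=> x1 xy y1; have xI : -1 <= x <= 1 by rewrite x1 (le_trans xy).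
have yI : -1 <= y <= 1 by rewrite y1 (le_trans x1).
rewrite leNgt; apply/negP => xy'.
have := @ltr_cos R (acos x) (acos y).
rewrite !in_itv/= !acos_ge0// !acos_lepi// => /(_ isT isT).
rewrite !acosK ?in_itv//= xy' => /esym.
by rewrite ltNge xy.
Qed.

(* [acos] is unspecified outside [-1, 1]; this is its monotone extension. *)
Definition acosr (c : R) : R := acos (Num.max (-1) (Num.min 1 c)).

Lemma clamp_itv (c : R) : -1 <= Num.max (-1) (Num.min 1 c) <= 1.
Proof. by rewrite le_max lexx ge_max ge_min lexx !andbT/=; lra. Qed.

Lemma acosrE (c : R) : -1 <= c <= 1 -> acosr c = acos c.
Proof. by move=> /andP[c1 c2]; rewrite /acosr min_r// max_r. Qed.

Lemma acosr_itv (c : R) : 0 <= acosr c <= pi.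
Proof. by rewrite acos_ge0 ?acos_lepi//; exact: clamp_itv. Qed.

Lemma acosr_cos (t : R) : 0 <= t <= pi -> acosr (cos t) = t.
Proof.
by move=> tI; rewrite acosrE ?cosK ?in_itv//=; rewrite cos_geN1 cos_le1.
Qed.

Lemma sdistE k (x y : 'rV[R]_k.+1) :
  sphere R k x -> sphere R k y -> sdist x y = acosr (dotp x y).
Proof. by move=> *; rewrite acosrE//; exact: dotp_sphere_itv. Qed.

Lemma measurable_acosr : measurable_fun setT acosr.
Proof.
apply: nonincreasing_measurable => // x y xy.
have /andP[x1 _] := clamp_itv x; have /andP[_ y1] := clamp_itv y.
by apply: ler_acos => //; rewrite ge_max le_max lexx/= le_max le_min2 ?orbT.
Qed.

Local Open Scope ereal_scope.

Lemma ge0_integral_svol_invariant k (Q : 'M[R]_k.+1) (g : 'rV[R]_k.+1 -> \bar R) :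
  svol_invariant Q -> measurable_fun setT g -> (forall x, 0 <= g x) ->
  \int[svol R k]_x g (x *m Q) = \int[svol R k]_x g x.
Proof.
move=> iQ mg g0.
have mQ : measurable_fun setT (fun x : 'rV[R]_k.+1 => x *m Q).
  exact: (@measurable_fun_mulmxr _ _ _ _ _ Q id).
rewrite [RHS](@ge0_integral_transport _ _ _ _ _ _ (svol R k) (cst 1%R) (fun x => x *m Q))//.
  by apply: eq_integral => x _; rewrite mul1e.
move=> A mA; under eq_integral do rewrite mul1e.
apply: (etrans (esym (iQ A mA))).
rewrite -[X in svol R k X]setIT -integral_indic//.
  by rewrite -[X in measurable X]setTI; exact: mQ.
Qed.

Lemma ge0_integral_zonal1 k (w : 'rV[R]_k.+2) (h : R -> \bar R) :
  sphere R k.+1 w -> measurable_fun setT h -> (forall x, 0 <= h x) ->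
  \int[svol R k.+1]_u h (dotp w u) =
  \int[leb]_(s in `[0%R, pi]) ((sin s ^+ k)%:E * (h (cos s) * svol R k setT)).
Proof.
move=> w1 mh h0; have [Q [oQ iQ Qw]] := svol_transitive w1.
have md (v : 'rV[R]_k.+2) : measurable_fun setT (fun u : 'rV[R]_k.+2 => h (dotp v u)).
  by apply: (measurableT_comp mh); exact: measurable_dotp.
rewrite -(ge0_integral_svol_invariant iQ (md w))//.
transitivity (\int[svol R k.+1]_x h (dotp (pole R k.+1) x)).
  by apply: eq_integral => x _; rewrite -Qw oQ.
rewrite ge0_integral_svolS//.
apply: eq_integral => s _; congr (_ * _).
have E u : dotp (pole R k.+1) (polar s u) = cos s.
  have := dotp_row_mx 1%:M (cos s)%:M 0%R (sin s *: u).
  by rewrite -pole_row dotp_scalar1 dotp0l mul1r addr0; exact.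
rewrite -integral_cst//; by apply: eq_integral => u _; rewrite E.
Qed.

(** An invariant isometry moves p to the pole, so that <p, x> becomes cos t. The image of w is
    orthogonal to the pole, hence is (0, w') with w' a unit vector one dimension lower, and the
    one-coordinate formula applies to w' in each slice. *)
Lemma ge0_integral_zonal2 k (p w : 'rV[R]_k.+3) (g : R * R -> \bar R) :
  sphere R k.+2 p -> sphere R k.+2 w -> dotp p w = 0%R ->
  measurable_fun setT g -> (forall x, 0 <= g x) ->
  \int[svol R k.+2]_x g (dotp p x, dotp w x) =
  \int[leb]_(t in `[0%R, pi]) ((sin t ^+ k.+1)%:E *
    \int[leb]_(s in `[0%R, pi]) ((sin s ^+ k)%:E *
       (g (cos t, sin t * cos s)%R * svol R k setT))).
Proof.
move=> p1 w1 pw mg g0; have [Q [oQ iQ Qp]] := svol_transitive p1.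
have md (v v' : 'rV[R]_k.+3) : measurable_fun setT (fun u : 'rV[R]_k.+3 => g (dotp v u, dotp v' u)).
  apply: (measurableT_comp mg); apply/measurable_fun_pairP; split => /=; exact: measurable_dotp.
rewrite -(ge0_integral_svol_invariant iQ (md p w))//.
pose w0 := w *m Q^T.
have w0Q : w0 *m Q = w.
  by rewrite -mulmxA (mulmx1C (orthmx_mulmxT oQ)) mulmx1.
transitivity (\int[svol R k.+2]_x g (dotp (pole R k.+2) x, dotp w0 x)).
  by apply: eq_integral => x _; rewrite -Qp -w0Q !oQ.
rewrite ge0_integral_svolS//.
have w01 : dotp w0 w0 = 1%R by apply/sphereE; rewrite /sphere/= -(enorm_orthmx _ oQ) w0Q.
have pw0 : dotp (pole R k.+2) w0 = 0%R by rewrite -(oQ (pole R k.+2)) Qp w0Q.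
have [w' [w'1 w'E]] : exists w' : 'rV[R]_k.+2, sphere R k.+1 w' /\
    w0 = row_mx (0%R)%:M w' :> 'rV[R]_(1 + k.+2).
  move: w01 pw0; have := @hsubmxK R 1 1 k.+2 w0.
  rewrite (mx11_scalar (@lsubmx R 1 1 k.+2 w0)).
  move: (_ ord0 ord0) (@rsubmx R 1 1 k.+2 w0) => a b <-.
  have -> := dotp_row_mx a%:M a%:M b b; rewrite pole_row.
  have -> := dotp_row_mx 1%:M a%:M 0%R b.
  rewrite !dotp_scalar1 dotp0l mul1r addr0 => + a0; rewrite a0 mul0r add0r => b1.
  by exists b; split => //; exact/sphereE.
apply: eq_integral => t _; congr (_ * _).
have E u : dotp (pole R k.+2) (polar t u) = cos t.
  have := dotp_row_mx 1%:M (cos t)%:M 0%R (sin t *: u).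
  by rewrite -pole_row dotp_scalar1 dotp0l mul1r addr0; exact.
have E' u : dotp w0 (polar t u) = (sin t * dotp w' u)%R.
  have := dotp_row_mx (0%R)%:M (cos t)%:M w' (sin t *: u).
  by rewrite -w'E dotp_scalar1 mul0r add0r dotpZr; exact.
transitivity (\int[svol R k.+1]_u g (cos t, sin t * dotp w' u)%R).
  by apply: eq_integral => u _; rewrite E E'.
rewrite (@ge0_integral_zonal1 _ w' (fun y => g (cos t, sin t * y)%R))//.
apply: (measurableT_comp mg); apply/measurable_fun_pairP; split => //=.
- exact: measurable_cst.
- exact: mulrl_measurable.
Qed.

End zonal_law.

Section rotationally_symmetric.
Context (R : realType) (k : nat).
Local Notation leb := (@lebesgue_measure R).
Local Notation d := k.+2.
Variables (mu : probability 'rV[R]_d.+1 R) (p : 'rV[R]_d.+1) (f : R -> R).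
Hypothesis p1 : sphere R d p.
Hypothesis f_meas : measurable_fun `[0, pi] f.
Hypothesis f_ge0 : forall t, 0 <= t <= pi -> 0 <= f t.
Hypothesis mu_density : forall A, measurable A ->
  mu A = (\int[svol R d]_(q in A `&` sphere R d) (f (sdist p q))%:E)%E.

(** Nothing is known of [f] outside the interval; its extension by 0 is measurable and nonnegative
    everywhere, as the transport formula requires of a weight. *)
Let f0 : R -> R := f \_ `[0, pi].

Let f0E t : 0 <= t <= pi -> f0 t = f t.
Proof. by move=> tI; rewrite /f0 patchE mem_setE in_itv/= tI. Qed.

Let f0_ge0 t : 0 <= f0 t.
Proof.
by rewrite /f0 patchE mem_setE in_itv/=; case: ifP => //; exact: f_ge0.
Qed.

Let f0_meas : measurable_fun setT f0.
Proof. exact/(measurable_restrictT _ _).1. Qed.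

Let F (c : R) := f0 (acosr c).

Let F_meas : measurable_fun setT F.
Proof. exact: (measurableT_comp f0_meas (@measurable_acosr R)). Qed.

Local Open Scope ereal_scope.

Let dp_meas (q : 'rV[R]_d.+1) :
  measurable_fun setT (fun x : 'rV[R]_d.+1 => dotp q x).
Proof. exact: measurable_dotp. Qed.

Lemma integral_symmetric (g : 'rV[R]_d.+1 -> \bar R) : measurable_fun setT g ->
  \int[mu]_x g x = \int[svol R d]_x ((F (dotp p x))%:E * g x).
Proof.
move=> mg.
have SF x : sphere R d x -> F (dotp p x) = f (sdist p x).
  by move=> x1; rewrite /F -sdistE// f0E// sdist_itv.
apply: integral_transport => //.
- by move=> x; exact: f0_ge0.
- exact: (measurableT_comp F_meas).
move=> A mA; apply: (etrans (mu_density mA)).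
have mFA B : measurable B -> measurable_fun setT
    (fun x : 'rV[R]_d.+1 => (F (dotp p x))%:E * (\1_B x)%:E).
  move=> mB; apply: emeasurable_funM; apply/measurable_EFinP.
    exact: (measurableT_comp F_meas).
  exact: measurable_indic.
transitivity (\int[svol R d]_x ((F (dotp p x))%:E * (\1_(A `&` sphere R d) x)%:E)).
  rewrite integral_mkcond; apply: eq_integral => x _; rewrite patchE indicE.
  case: ifPn => [|_]; last by rewrite mule0.
  by rewrite inE => -[_ x1]; rewrite SF// mule1.
apply: ae_eq_integral => //.
- by apply: mFA; apply: measurableI => //; exact: measurable_sphere.
- exact: mFA.
exists (~` sphere R d); split.
+ by apply: measurableC; exact: measurable_sphere.
+ exact: svol_sphereC.
+ move=> x /= /not_implyP[_]; apply: contra_not => x1.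
  by rewrite !indicE in_setI (mem_set x1) andbT.
Qed.

Lemma ge0_integral_zonal (w : 'rV[R]_d.+1) (g : R * R -> \bar R) :
  sphere R d w -> dotp p w = 0%R ->
  measurable_fun setT g -> (forall z, 0 <= g z) ->
  \int[mu]_x g (dotp p x, dotp w x) =
  \int[leb]_(t in `[0%R, pi]) ((sin t ^+ k.+1)%:E *
    \int[leb]_(s in `[0%R, pi]) ((sin s ^+ k)%:E *
       ((f t)%:E * g (cos t, sin t * cos s)%R * svol R k setT))).
Proof.
move=> w1 pw mg g0.
have mpw : measurable_fun setT (fun x : 'rV[R]_d.+1 => (dotp p x, dotp w x)).
  by apply/measurable_fun_pairP; split; exact: dp_meas.
rewrite integral_symmetric; last exact: (measurableT_comp mg mpw).
pose G (z : R * R) := (F z.1)%:E * g z.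
have mG : measurable_fun setT G.
  apply: emeasurable_funM => //; apply/measurable_EFinP.
  exact: (measurableT_comp F_meas measurable_fst).
have G0 z : 0 <= G z by rewrite mule_ge0// lee_fin f0_ge0.
apply: (etrans (ge0_integral_zonal2 p1 w1 pw mG G0)).
apply: eq_integral => t /[!inE]; rewrite /= in_itv/= => tI; congr (_ * _).
by apply: eq_integral => s _; rewrite /G /F acosr_cos// f0E.
Qed.

(** The right side of [ge0_integral_zonal] does not mention w. Applied to the positive and the
    negative part of g, it yields the equality for signed functions as an identity of extended
    reals. *)
Lemma integral_zonal_eq (w w' : 'rV[R]_d.+1) (g : R * R -> \bar R) :
  sphere R d w -> dotp p w = 0%R -> sphere R d w' -> dotp p w' = 0%R ->
  measurable_fun setT g ->
  \int[mu]_x g (dotp p x, dotp w x) = \int[mu]_x g (dotp p x, dotp w' x).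
Proof.
move=> w1 pw w'1 pw' mg; rewrite integralE [RHS]integralE; congr (_ - _).
- have mh := @measurable_funepos _ _ _ _ _ mg.
  have h0 z : 0 <= g^\+ z by exact: funepos_ge0.
  transitivity (\int[mu]_x (g^\+ (dotp p x, dotp w x))).
    by apply: eq_integral => x _; rewrite !funeposE.
  apply: (etrans (ge0_integral_zonal w1 pw mh h0)).
  apply: (etrans (esym (ge0_integral_zonal w'1 pw' mh h0))).
  by apply: eq_integral => x _; rewrite !funeposE.
- have mh := @measurable_funeneg _ _ _ _ _ mg.
  have h0 z : 0 <= g^\- z by exact: funeneg_ge0.
  transitivity (\int[mu]_x (g^\- (dotp p x, dotp w x))).
    by apply: eq_integral => x _; rewrite !funenegE.
  apply: (etrans (ge0_integral_zonal w1 pw mh h0)).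
  apply: (etrans (esym (ge0_integral_zonal w'1 pw' mh h0))).
  by apply: eq_integral => x _; rewrite !funenegE.
Qed.

End rotationally_symmetric.

(** * Taylor expansion of the squared distance along a geodesic *)

Section mean_value.
Context (R : realType).
Implicit Types (f g : R -> R).

Lemma mvt_is_derive g (g' : R -> R) (x y : R) : x < y ->
  (forall z, x <= z <= y -> is_derive z 1 g (g' z)) ->
  exists2 z, x < z < y & g y - g x = g' z * (y - x).
Proof.
move=> xy dg; have [||z] := @MVT R g g' x y xy.
- by move=> z; rewrite in_itv/= => /andP[? ?]; apply: dg; rewrite !ltW.
- apply: derivable_within_continuous => z; rewrite in_itv/= => zI.
  by apply: ex_derive; exact: dg.
- by rewrite in_itv/=; exists z.
Qed.

(** The mean value theorem replaces integration: the factor 1/(n+1) is lost, which only affects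
    constants. *)
Lemma mvt_power_bound g (g' : R -> R) (x B : R) n :
  (forall z, 0 <= z <= x -> is_derive z 1 g (g' z)) -> g 0 = 0 ->
  (forall z, 0 <= z <= x -> `|g' z| <= B * z ^+ n) ->
  forall z, 0 <= z <= x -> `|g z| <= B * z ^+ n.+1.
Proof.
move=> dg g0 Bg z /andP[]; rewrite le_eqVlt => /predU1P[<- _|z0 zx].
  by rewrite g0 normr0 expr0n/= mulr0.
have [y /andP[y0 yz]] : exists2 y, 0 < y < z & g z - g 0 = g' y * (z - 0).
  apply: mvt_is_derive => // y /andP[y0 yz]; apply: dg.
  by rewrite y0 (le_trans yz).
rewrite g0 !subr0 => ->.
have yI : 0 <= y <= x by rewrite (ltW y0) (le_trans (ltW yz)).
rewrite normrM (gtr0_norm z0) exprSr mulrA ler_wpM2r ?(ltW z0)//.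
rewrite (le_trans (Bg y yI))//.
have := Bg y yI => /(le_trans (normr_ge0 _)).
rewrite pmulr_lge0 ?exprn_gt0// => B0.
by rewrite ler_wpM2l// lerXn2r ?nnegrE ?ltW// (lt_trans y0).
Qed.

Lemma taylor2_bound (g0 g1 g2 : R -> R) (x A B : R) :
  (forall z, 0 <= z <= x -> is_derive z 1 g0 (g1 z)) ->
  (forall z, 0 <= z <= x -> is_derive z 1 g1 (g2 z)) ->
  (forall z, 0 <= z <= x -> `|g2 z - A| <= B) ->
  forall z, 0 <= z <= x ->
    `|g0 z - (g0 0 + g1 0 * z + A / 2 * z ^+ 2)| <= B * z ^+ 2.
Proof.
move=> d0 d1 H.
apply: (@mvt_power_bound _ (fun z => g1 z - (g1 0 + A * z))).
- move=> z zI; have := d0 z zI => D; der.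
  by field.
- by rewrite expr0n/= !mulr0; ring.
apply: (@mvt_power_bound _ (fun z => g2 z - A)).
- move=> z zI; have := d1 z zI => D; der.
  by ring.
- by ring.
- by move=> z zI; rewrite mulr1; exact: H.
Qed.

(** Subtract the polynomial and go down through the derivatives with [mvt_power_bound]. The free
    value A allows two uses: A = 0 gives a remainder bound from the size of the fourth derivative,
    while A equal to its value at 0 gives the sharp expansion near 0. *)
Lemma taylor4_bound (g0 g1 g2 g3 g4 : R -> R) (x A B : R) :
  (forall z, 0 <= z <= x -> is_derive z 1 g0 (g1 z)) ->
  (forall z, 0 <= z <= x -> is_derive z 1 g1 (g2 z)) ->
  (forall z, 0 <= z <= x -> is_derive z 1 g2 (g3 z)) ->
  (forall z, 0 <= z <= x -> is_derive z 1 g3 (g4 z)) ->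
  (forall z, 0 <= z <= x -> `|g4 z - A| <= B) ->
  forall z, 0 <= z <= x ->
    `|g0 z - (g0 0 + g1 0 * z + g2 0 / 2 * z ^+ 2 + g3 0 / 6 * z ^+ 3 +
        A / 24 * z ^+ 4)| <= B * z ^+ 4.
Proof.
move=> d0 d1 d2 d3 H.
apply: (@mvt_power_bound _ (fun z => g1 z - (g1 0 + g2 0 * z + g3 0 / 2 * z ^+ 2 +
   A / 6 * z ^+ 3))).
- move=> z zI; have := d0 z zI => D; der.
  by field.
- by rewrite !expr0n/= !mulr0; ring.
apply: (@mvt_power_bound _ (fun z => g2 z - (g2 0 + g3 0 * z + A / 2 * z ^+ 2))).
- move=> z zI; have := d1 z zI => D; der.
  by field.
- by rewrite !expr0n/= !mulr0; ring.
apply: (@mvt_power_bound _ (fun z => g3 z - (g3 0 + A * z))).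
- move=> z zI; have := d2 z zI => D; der.
  by field.
- by rewrite !expr0n/= !mulr0; ring.
apply: (@mvt_power_bound _ (fun z => g4 z - A)).
- move=> z zI; have := d3 z zI => D; der.
  by ring.
- by ring.
- by move=> z zI; rewrite mulr1; exact: H.
Qed.

End mean_value.

(** * Derivatives of acos^2 / 2 with respect to the cosine *)

Section squared_distance_profile.
Context (R : realType).
Implicit Types t x y : R.

(* [psi k t] is the k-th derivative of c |-> acos(c)^2 / 2 at c = cos t; the
   recursion comes from the differential equation
   (1 - c^2) psi'' - c psi' = 1, differentiated k times. *)
Definition psi1 t : R := - t / sin t.
Definition psi2 t : R := (1 + cos t * psi1 t) / sin t ^+ 2.
Definition psi3 t : R := (3 * cos t * psi2 t + psi1 t) / sin t ^+ 2.
Definition psi4 t : R := (5 * cos t * psi3 t + 4 * psi2 t) / sin t ^+ 2.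

Lemma is_derive_psi1 t : sin t != 0 -> is_derive t 1 psi1 (- sin t * psi2 t).
Proof.
by move=> s0; rewrite /psi1; der; rewrite // /psi2 /psi1; field.
Qed.

Lemma is_derive_psi2 t : sin t != 0 -> is_derive t 1 psi2 (- sin t * psi3 t).
Proof.
move=> s0; have D := is_derive_psi1 s0; rewrite /psi2; der.
  by rewrite expf_neq0.
by rewrite /psi3 /psi2; field.
Qed.

Lemma is_derive_psi3 t : sin t != 0 -> is_derive t 1 psi3 (- sin t * psi4 t).
Proof.
move=> s0; have D := is_derive_psi1 s0; have D' := is_derive_psi2 s0.
rewrite /psi3; der; first by rewrite expf_neq0.
by rewrite /psi4 /psi3; field.
Qed.

Lemma sin_ge_eighth t : 0 <= t <= pi / 2 -> t / 8 <= sin t.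
Proof.
move=> /andP[t0 t1]; have p2 := @pihalf_02 R; have p1 := @pihalf_ge1 R.
have H (z : R) : 0 <= z <= 1 -> z - 3 / 4 * z ^+ 2 <= sin z.
  move=> zI.
  (* The second derivative - sin lies in [-1, 0], of centre -1/2 and radius 1/2; hence sin z >= z -
     z^2 / 4 - z^2 / 2. *)
  have := @taylor2_bound R sin cos (fun x => - sin x) 1 (- 2^-1) 2^-1 _ _ _ z zI.
  have ds (x : R) : 0 <= x <= 1 -> is_derive x 1 (@sin R) (cos x).
    by move=> _; exact: is_derive_sin.
  have dc (x : R) : 0 <= x <= 1 -> is_derive x 1 (@cos R) (- sin x).
    by move=> _; exact: is_derive_cos.
  have b (x : R) : 0 <= x <= 1 -> `|- sin x - - 2^-1| <= 2^-1.
    move=> /andP[x0 x1]; have s1 := sin_le1 x.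
    have s0 : 0 <= sin x by apply: sin_ge0_pi; apply/andP; split => //; lra.
    by rewrite ler_norml; apply/andP; split; lra.
  move=> /(_ ds dc b); rewrite sin0 cos0 ler_norml => /andP[].
  by move: (z ^+ 2) => zz; lra.
have [tle|tge] := leP t 1.
  have := H t; rewrite t0 tle => /(_ isT); nra.
(* Beyond 1 monotonicity suffices: sin 1 >= 1/4, whereas t / 8 <= 1/4 because pi / 2 <= 2. *)
have := H 1; rewrite ler01 lexx => /(_ isT); rewrite expr1n => H1.
have : sin 1 < sin t by rewrite ltr_sin ?in_itv//=; apply/andP; split; lra.
by lra.
Qed.

Lemma ler_sin_pihalf x t : 0 <= x -> x <= t -> t <= pi / 2 -> 0 <= sin x <= sin t.
Proof.
move=> x0 xt t1; have := pi_gt0 R => p0; apply/andP; split.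
  by apply: sin_ge0_pi; apply/andP; split; lra.
move: xt; rewrite le_eqVlt => /predU1P[->//|xt].
by apply: ltW; rewrite ltr_sin ?in_itv//=; apply/andP; split; lra.
Qed.

Lemma sin_pihalf_gt0 t : 0 < t <= pi / 2 -> 0 < sin t.
Proof.
move=> /andP[t0 t1]; apply: sin_gt0_pi; rewrite t0/=.
by have := pi_gt0 R; lra.
Qed.

(** A removable singularity at 0: u is the quotient of G by sin^(n+1), and G vanishes at 0 with a
    derivative of order sin^n. The mean value theorem bounds G by B sin(t)^n t, since sin increases
    up to pi / 2, and t <= 8 sin t concludes. *)
Let mvt_quotient (G G' : R -> R) (u : R -> R) n B t : 0 < t <= pi / 2 -> 0 <= B ->
  (forall x, 0 <= x <= t -> is_derive x 1 G (G' x)) -> G 0 = 0 ->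
  (forall x, 0 < x <= t -> `|G' x| <= B * sin x ^+ n) ->
  G t = sin t ^+ n.+1 * u t -> `|u t| <= 8 * B.
Proof.
move=> tI B0 dG G0 BG Gu.
have /andP[t0 t1] := tI; have st := sin_pihalf_gt0 tI.
have [x /andP[x0 xt]] : exists2 x, 0 < x < t & G t - G 0 = G' x * (t - 0).
  exact: mvt_is_derive.
rewrite G0 !subr0 Gu => E.
have xI : 0 < x <= t by rewrite x0 ltW.
have : sin t ^+ n.+1 * `|u t| <= B * sin t ^+ n * t.
  rewrite -[sin t ^+ _ ]gtr0_norm ?exprn_gt0// -normrM E normrM (gtr0_norm t0).
  rewrite ler_wpM2r ?(ltW t0)// (le_trans (BG x xI))// ler_wpM2l//.
  have /andP[? ?] := ler_sin_pihalf (ltW x0) (ltW xt) t1.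
  by rewrite lerXn2r ?nnegrE// ltW.
have tI' : 0 <= t <= pi / 2 by rewrite ltW.
have := sin_ge_eighth tI'; set s := sin t in st * => H1 H2.
have : s ^+ n * (s * `|u t|) <= s ^+ n * (s * (8 * B)).
  apply: (@le_trans _ _ (B * s ^+ n * t)); first by rewrite mulrA -exprSr.
  have -> : B * s ^+ n * t = s ^+ n * (B * t) by rewrite mulrCA mulrA.
  by rewrite ler_wpM2l ?exprn_ge0 ?(ltW st)//; nra.
by rewrite ler_pM2l ?exprn_gt0// ler_pM2l.
Qed.

(** Over the common denominator sin^(2k-1), the numerator of [psi]_k vanishes at 0 and its
    derivative is a multiple of [psi]_(k-1) sin^(2k-2), with factors -1, -4 and -9 for k = 2, 3, 4.
    Each bound therefore follows from the previous one, through [mvt_quotient]. *)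
Lemma psi_bound_left : exists2 C : R, 0 < C & forall t, 0 < t <= pi / 2 ->
  [/\ `|psi1 t| <= C, `|psi2 t| <= C, `|psi3 t| <= C & `|psi4 t| <= C].
Proof.
have s0 t (tI : 0 < t <= pi / 2) : sin t != 0 by rewrite gt_eqF// sin_pihalf_gt0.
have B1 t : 0 < t <= pi / 2 -> `|psi1 t| <= 8.
  move=> tI; have st := sin_pihalf_gt0 tI; have /andP[t0 t1] := tI.
  rewrite /psi1 normrM normrN (gtr0_norm t0) normfV (gtr0_norm st).
  by rewrite ler_pdivrMr//; have := @sin_ge_eighth t; rewrite (ltW t0) t1 => /(_ isT); lra.
have sub t x : 0 < t <= pi / 2 -> 0 < x <= t -> 0 < x <= pi / 2.
  by move=> /andP[_ t1] /andP[-> xt]; rewrite (le_trans xt).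
have B2 t : 0 < t <= pi / 2 -> `|psi2 t| <= 8 * 8.
  move=> tI; apply: (@mvt_quotient (fun t => sin t - t * cos t) (fun t => t * sin t) psi2 2%N 8) => //.
  - by move=> x _; der; ring.
  - by rewrite sin0; ring.
  - move=> x /(sub _ _ tI) xI.
    have -> : x * sin x = - psi1 x * sin x ^+ 2 by rewrite /psi1; field; exact: s0.
    rewrite normrM normrN (@ger0_norm _ (sin x ^+ 2)) ?sqr_ge0//.
    by rewrite ler_wpM2r ?sqr_ge0// B1.
  - by rewrite /psi2 /psi1; field; exact: s0.
have B3 t : 0 < t <= pi / 2 -> `|psi3 t| <= 8 * (4 * (8 * 8)).
  move=> tI; apply: (@mvt_quotient (fun t => 3 * cos t * (sin t - t * cos t) - t * sin t ^+ 2)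
    (fun t => - 4 * sin t * (sin t - t * cos t)) psi3 4%N (4 * (8 * 8))) => //.
  - by move=> x _; der; ring.
  - by rewrite sin0; ring.
  - move=> x /(sub _ _ tI) xI.
    have -> : - 4 * sin x * (sin x - x * cos x) = (- 4 * psi2 x) * sin x ^+ 4.
      by rewrite /psi2 /psi1; field; exact: s0.
    rewrite normrM (@ger0_norm _ (sin x ^+ 4)) ?exprn_even_ge0//.
    rewrite ler_wpM2r ?exprn_even_ge0// normrM normrN (@ger0_norm _ 4)//.
    by have := B2 x xI; lra.
  - by rewrite /psi3 /psi2 /psi1; field; exact: s0.
have B4 t : 0 < t <= pi / 2 -> `|psi4 t| <= 8 * (9 * (8 * (4 * (8 * 8)))).
  move=> tI; apply: (@mvt_quotient (fun t => 5 * cos t * (3 * cos t * (sin t - t * cos t) - t * sin t ^+ 2) +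
      4 * sin t ^+ 2 * (sin t - t * cos t))
    (fun t => - 9 * sin t * (3 * cos t * (sin t - t * cos t) - t * sin t ^+ 2)) psi4 6%N (9 * (8 * (4 * (8 * 8))))) => //.
  - by move=> x _; der; ring.
  - by rewrite sin0; ring.
  - move=> x /(sub _ _ tI) xI.
    have -> : - 9 * sin x * (3 * cos x * (sin x - x * cos x) - x * sin x ^+ 2) =
       (- 9 * psi3 x) * sin x ^+ 6.
      by rewrite /psi3 /psi2 /psi1; field; exact: s0.
    rewrite normrM (@ger0_norm _ (sin x ^+ 6)) ?exprn_even_ge0//.
    rewrite ler_wpM2r ?exprn_even_ge0// normrM normrN (@ger0_norm _ 9)//.
    by have := B3 x xI; lra.
  - by rewrite /psi4 /psi3 /psi2 /psi1; field; exact: s0.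
exists (8 * (9 * (8 * (4 * (8 * 8))))) => // t tI; split; last exact: B4.
- by have := B1 t tI; lra.
- by have := B2 t tI; lra.
- by have := B3 t tI; lra.
Qed.

(** Up to pi / 2 the functions are bounded and pi - t <= 4 absorbs the powers. Beyond, sin t >= (pi
    - t) / 8, so each step of the recursion costs a factor 64 / (pi - t)^2; starting from the
    exponent 1 this gives 3, 5 and 7. *)
Lemma psi_bound : exists2 C : R, 0 < C & forall t, 0 < t < pi ->
  [/\ `|psi1 t| <= C / (pi - t), `|psi2 t| <= C / (pi - t) ^+ 3,
      `|psi3 t| <= C / (pi - t) ^+ 5 & `|psi4 t| <= C / (pi - t) ^+ 7].
Proof.
have [B B0 HB] := psi_bound_left.
have /andP[_ pi2] := @pihalf_02 R; have p4 : pi <= 4 :> R by lra.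
pose A1 : R := 32; pose A2 : R := 64 * 34.
pose A3 : R := 64 * (3 * A2 + 4 * A1); pose A4 : R := 64 * (5 * A3 + 16 * A2).
have [A12 A23 A34] : [/\ A1 <= A4, A2 <= A4 & A3 <= A4].
  by rewrite /A4 /A3 /A2 /A1; split; lra.
have A40 : 0 < A4 by rewrite /A4 /A3 /A2 /A1; lra.
exists (B * 4 ^+ 7 + A4) => [|t /andP[t0 tpi]].
  by rewrite addr_gt0 // mulr_gt0 // exprn_gt0.
have r0 : 0 < pi - t by lra.
have [tle|tgt] := leP t (pi / 2).
  have L u n : `|u| <= B -> (n <= 7)%N -> `|u| <= (B * 4 ^+ 7 + A4) / (pi - t) ^+ n.
    move=> uB n7; rewrite ler_pdivlMr ?exprn_gt0//.
    apply: (@le_trans _ _ (B * 4 ^+ 7)); last by rewrite lerDl ltW.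
    apply: ler_pM => //; first by rewrite exprn_ge0 ?ltW.
    apply: (@le_trans _ _ (4 ^+ n)); first by rewrite lerXn2r ?nnegrE//; lra.
    by rewrite ler_weXn2l//; lra.
  have [|h1 h2 h3 h4] := HB t; first by rewrite t0.
  by rewrite -[pi - t]expr1; split; rewrite -?exprM; apply: L.
set r := pi - t in r0 *.
have r2 : r <= 2 by rewrite /r; lra.
have sr : r / 8 <= sin t.
  have -> : sin t = sin r by rewrite /r sinB sinpi cospi; ring.
  by apply: sin_ge_eighth; rewrite /r; apply/andP; split; lra.
have s0 : 0 < sin t by lra.
have B1 : `|psi1 t| * r <= A1.
  rewrite /psi1 normrM normrN normfV (gtr0_norm t0) (gtr0_norm s0).
  by rewrite mulrAC ler_pdivrMr// /A1; nra.
have rec (u v w a b : R) : 0 <= a -> 0 <= b ->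
    w = (a * cos t * u + b * v) / sin t ^+ 2 -> `|w| * r ^+ 2 <= 64 * (a * `|u| + b * `|v|).
  move=> a0 b0 ->; rewrite normrM normfV (@ger0_norm _ (sin t ^+ 2)) ?sqr_ge0//.
  rewrite mulrAC ler_pdivrMr ?exprn_gt0//.
  have N : `|a * cos t * u + b * v| <= a * `|u| + b * `|v|.
    rewrite (le_trans (ler_normD _ _))// !normrM (ger0_norm a0) (ger0_norm b0) lerD2r.
    rewrite -mulrA ler_wpM2l// -[leRHS]mul1r ler_wpM2r//.
    by rewrite ler_norml cos_geN1 cos_le1.
  have rs : r ^+ 2 <= 64 * sin t ^+ 2 by nra.
  apply: (le_trans (ler_pM _ _ N rs)); rewrite ?sqr_ge0//.
  by rewrite le_eqVlt; apply/orP; left; apply/eqP; ring.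
have B2 : `|psi2 t| * r ^+ 3 <= A2.
  have E : psi2 t = (1 * cos t * psi1 t + 1 * 1) / sin t ^+ 2.
    by rewrite /psi2 !mul1r addrC.
  have := rec _ _ _ _ _ ler01 ler01 E; rewrite normr1 !mul1r => H.
  have -> : `|psi2 t| * r ^+ 3 = (`|psi2 t| * r ^+ 2) * r by ring.
  by rewrite /A2; move: H B1; rewrite /A1; move: (`|psi2 t| * r ^+ 2) `|psi1 t| => y z *; nra.
have B3 : `|psi3 t| * r ^+ 5 <= A3.
  have E : psi3 t = (3 * cos t * psi2 t + 1 * psi1 t) / sin t ^+ 2.
    by rewrite /psi3 mul1r.
  have := rec _ _ _ _ _ (ler0n _ _) ler01 E; rewrite mul1r => H.
  have -> : `|psi3 t| * r ^+ 5 = (`|psi3 t| * r ^+ 2) * r ^+ 3 by ring.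
  apply: (le_trans (ler_wpM2r _ H)); first by rewrite exprn_ge0 ?ltW.
  have -> : 64 * (3 * `|psi2 t| + `|psi1 t|) * r ^+ 3 =
    64 * (3 * (`|psi2 t| * r ^+ 3) + r ^+ 2 * (`|psi1 t| * r)) by ring.
  rewrite /A3; have rr : r ^+ 2 <= 4 by nra.
  have : r ^+ 2 * (`|psi1 t| * r) <= 4 * A1 by apply: ler_pM; rewrite ?sqr_ge0 ?mulr_ge0 ?(ltW r0).
  by lra.
have B4 : `|psi4 t| * r ^+ 7 <= A4.
  have E : psi4 t = (5 * cos t * psi3 t + 4 * psi2 t) / sin t ^+ 2 by [].
  have H := rec _ _ _ _ _ (ler0n _ _) (ler0n _ _) E.
  have -> : `|psi4 t| * r ^+ 7 = (`|psi4 t| * r ^+ 2) * r ^+ 5 by ring.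
  apply: (le_trans (ler_wpM2r _ H)); first by rewrite exprn_ge0 ?ltW.
  have -> : 64 * (5 * `|psi3 t| + 4 * `|psi2 t|) * r ^+ 5 =
    64 * (5 * (`|psi3 t| * r ^+ 5) + 4 * (r ^+ 2 * (`|psi2 t| * r ^+ 3))) by ring.
  rewrite /A4; have rr : r ^+ 2 <= 4 by nra.
  have : r ^+ 2 * (`|psi2 t| * r ^+ 3) <= 4 * A2.
    by apply: ler_pM; rewrite ?sqr_ge0 ?mulr_ge0 ?exprn_ge0 ?(ltW r0).
  by lra.
have BK : 0 <= B * 4 ^+ 7 by rewrite mulr_ge0 ?exprn_ge0 ?ltW.
by split; rewrite ler_pdivlMr ?exprn_gt0//; move: BK; move: (B * 4 ^+ 7) => *; lra.
Qed.

End squared_distance_profile.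

Section geodesic_profile.
Context (R : realType).
Implicit Types (a b x z : R).

Lemma der_acos (g : R -> R) x b : -1 < g x < 1 -> is_derive x 1 g b ->
  is_derive x 1 (fun t => acos (g t)) (- (sin (acos (g x)))^-1 * b).
Proof.
move=> gx gb; have /andP[g1 g2] := gx.
apply: (der_comp gb).
by rewrite sin_acos ?(ltW g1) ?(ltW g2)//; exact: is_derive1_acos.
Qed.

(* Along the geodesic x(s) = cos s p + sin s w, a point y with a = <p, y> and
   b = <w, y> is at distance [gdist a b s] from x(s). *)
Definition gcos a b x : R := a * cos x + b * sin x.
Definition gcos' a b x : R := b * cos x - a * sin x.
Definition gdist a b x : R := acos (gcos a b x).

(** [geo1] to [geo4] are the successive derivatives of [geo0] along the geodesic, by the chain rule
    for the function acos^2 / 2 of [gcos], whose second derivative is - [gcos]. *)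
Definition geo0 a b x : R := 2^-1 * gdist a b x ^+ 2.
Definition geo1 a b x : R := psi1 (gdist a b x) * gcos' a b x.
Definition geo2 a b x : R :=
  psi2 (gdist a b x) * gcos' a b x ^+ 2 - gcos a b x * psi1 (gdist a b x).
Definition geo3 a b x : R :=
  psi3 (gdist a b x) * gcos' a b x ^+ 3
  - 3 * gcos a b x * gcos' a b x * psi2 (gdist a b x)
  - gcos' a b x * psi1 (gdist a b x).
Definition geo4 a b x : R :=
  psi4 (gdist a b x) * gcos' a b x ^+ 4
  - 6 * gcos a b x * gcos' a b x ^+ 2 * psi3 (gdist a b x)
  + (3 * gcos a b x ^+ 2 - 4 * gcos' a b x ^+ 2) * psi2 (gdist a b x)
  + gcos a b x * psi1 (gdist a b x).

(** For a unit vector y the strict inequality means that y is off the great circle through p and w.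
    The geodesic then meets neither y nor its antipode, and the distance is smooth along all of
    it. *)
Variables (a b : R).
Hypothesis ab1 : a ^+ 2 + b ^+ 2 < 1.

Lemma gcos_sqr x : gcos a b x ^+ 2 + gcos' a b x ^+ 2 = a ^+ 2 + b ^+ 2.
Proof.
rewrite /gcos /gcos'.
have -> : a ^+ 2 + b ^+ 2 = (a ^+ 2 + b ^+ 2) * (cos x ^+ 2 + sin x ^+ 2).
  by rewrite cos2Dsin2 mulr1.
by ring.
Qed.

Lemma gcos_itv x : -1 < gcos a b x < 1.
Proof.
rewrite -ltr_norml -(@ltr_pXn2r _ 2) ?nnegrE//.
by rewrite expr1n real_normK ?num_real// -[ltLHS]addr0 (le_lt_trans _ ab1)//
  -(gcos_sqr x) lerD2l sqr_ge0.
Qed.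

Lemma gcos_itvW x : -1 <= gcos a b x <= 1.
Proof. by have /andP[? ?] := gcos_itv x; rewrite !ltW. Qed.

Lemma gdist_itv x : 0 < gdist a b x < pi.
Proof.
have /andP[c1 c2] := gcos_itv x.
by apply/andP; split; [apply: acos_gt0|apply: acos_ltpi]; rewrite ?c1 ?c2 ltW.
Qed.

Lemma cos_gdist x : cos (gdist a b x) = gcos a b x.
Proof. by rewrite acosK// in_itv/= gcos_itvW. Qed.

Lemma sin_gdist_gt0 x : 0 < sin (gdist a b x).
Proof. exact/sin_gt0_pi/gdist_itv. Qed.

Lemma sin_gdist_neq0 x : sin (gdist a b x) != 0.
Proof. by rewrite gt_eqF// sin_gdist_gt0. Qed.

(** Since [gcos] and [gcos'] have squares of sum at most 1. This is the source of all cancellations: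
    every factor [gcos'] compensates one inverse power of the distance to the antipode. *)
Lemma gcos'_le_sin x : `|gcos' a b x| <= sin (gdist a b x).
Proof.
rewrite -ler_sqr ?nnegrE ?(ltW (sin_gdist_gt0 _))//.
rewrite real_normK ?num_real// sin2cos2 cos_gdist.
by rewrite lerBrDl gcos_sqr ltW.
Qed.

Lemma is_derive_gcos x : is_derive x 1 (gcos a b) (gcos' a b x).
Proof. by rewrite /gcos; der; rewrite /gcos'; ring. Qed.

Lemma is_derive_gcos' x : is_derive x 1 (gcos' a b) (- gcos a b x).
Proof. by rewrite /gcos'; der; rewrite /gcos; ring. Qed.

Lemma is_derive_gdist x :
  is_derive x 1 (gdist a b) (- gcos' a b x / sin (gdist a b x)).
Proof.
have D := is_derive_gcos x.
apply: der_eq; first exact: (der_acos (gcos_itv x) D).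
by rewrite -/(gdist a b x) mulNr mulrC mulNr.
Qed.

Lemma is_derive_psi_gdist (h h' : R -> R) x :
  (forall t, sin t != 0 -> is_derive t 1 h (- sin t * h' t)) ->
  is_derive x 1 (fun z => h (gdist a b z)) (h' (gdist a b x) * gcos' a b x).
Proof.
move=> dh; have s0 := sin_gdist_neq0 x.
apply: der_eq; first exact: (der_comp (is_derive_gdist x) (dh _ s0)).
by field.
Qed.

Lemma is_derive_geo0 x : is_derive x 1 (geo0 a b) (geo1 a b x).
Proof.
have D := is_derive_gdist x; rewrite /geo0; der.
by rewrite /geo1 /psi1; field; exact: sin_gdist_neq0.
Qed.

Lemma is_derive_geo1 x : is_derive x 1 (geo1 a b) (geo2 a b x).
Proof.
have D1 := is_derive_psi_gdist x (@is_derive_psi1 R).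
have Dc := is_derive_gcos' x.
by rewrite /geo1; der; rewrite /geo2; ring.
Qed.

Lemma is_derive_geo2 x : is_derive x 1 (geo2 a b) (geo3 a b x).
Proof.
have D1 := is_derive_psi_gdist x (@is_derive_psi1 R).
have D2 := is_derive_psi_gdist x (@is_derive_psi2 R).
have Dc := is_derive_gcos x; have Dc' := is_derive_gcos' x.
by rewrite /geo2; der; rewrite /geo3; ring.
Qed.

Lemma is_derive_geo3 x : is_derive x 1 (geo3 a b) (geo4 a b x).
Proof.
have D1 := is_derive_psi_gdist x (@is_derive_psi1 R).
have D2 := is_derive_psi_gdist x (@is_derive_psi2 R).
have D3 := is_derive_psi_gdist x (@is_derive_psi3 R).
have Dc := is_derive_gcos x; have Dc' := is_derive_gcos' x.
by rewrite /geo3; der; rewrite /geo4; ring.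
Qed.

Lemma gdist_lip x : 0 <= x -> `|gdist a b x - gdist a b 0| <= x.
Proof.
rewrite le_eqVlt => /predU1P[<-|x0]; first by rewrite subrr normr0.
have [z _ ->] := mvt_is_derive x0 (fun z _ => is_derive_gdist z).
rewrite subr0 normrM (gtr0_norm x0) -[leRHS]mul1r ler_wpM2r ?(ltW x0)//.
rewrite normrM normrN normfV (gtr0_norm (sin_gdist_gt0 _)).
by rewrite ler_pdivrMr ?sin_gdist_gt0// mul1r gcos'_le_sin.
Qed.

End geodesic_profile.

Section geodesic_remainder.
Context (R : realType).
Implicit Types (a b x z : R).

Lemma sin_le_id x : 0 <= x -> sin x <= x.
Proof.
move=> x0; apply: (le_trans (ler_norm _)).
have := @mvt_power_bound R sin cos x 1 0 _ (sin0 R) _ x; rewrite mul1r expr1; apply.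
- by move=> z _; rewrite mulr1 cos_max.
- by rewrite x0 lexx.
Qed.

Lemma pi_le4 : pi <= 4 :> R.
Proof. by have /andP[_ ?] := @pihalf_02 R; lra. Qed.

(** Here r is pi minus the distance. The k-th derivative contains [psi]_k, of order r^(1 - 2k),
    times [gcos']^k <= r^k, hence is of order r^(1 - k); the other terms have no larger order. The
    first derivative is bounded because |[psi1]| sin t = t. *)
Lemma geo_bound : exists2 C : R, 0 < C & forall a b x, a ^+ 2 + b ^+ 2 < 1 ->
  [/\ `|geo1 a b x| <= pi, `|geo2 a b x| <= C / (pi - gdist a b x),
      `|geo3 a b x| <= C / (pi - gdist a b x) ^+ 2 &
      `|geo4 a b x| <= C / (pi - gdist a b x) ^+ 3].
Proof.
have [C C0 HC] := psi_bound R.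
(* 30 = 1 + 6 + 7 + 16 adds up the four terms of [geo4], the last one using r^2 <= 16; the lower
   derivatives need less. *)
exists (30 * C) => [|a b x ab1]; first by rewrite mulr_gt0.
have tI := gdist_itv ab1 x; have s0 := sin_gdist_gt0 ab1 x.
have cs := gcos'_le_sin ab1 x; have cI := gcos_itvW ab1 x.
have [P1 P2 P3 P4] := HC _ tI; rewrite /geo1 /geo2 /geo3 /geo4.
set t := gdist a b x in tI s0 cs P1 P2 P3 P4 *.
have /andP[t0 tpi] := tI; set r := pi - t in P1 P2 P3 P4 *.
have r0 : 0 < r by rewrite subr_gt0.
have r4 : r <= 4 by rewrite /r; have := pi_le4; lra.
have sr : sin t <= r.
  have -> : sin t = sin r by rewrite /r sinB sinpi cospi; ring.
  by apply: sin_le_id; exact: ltW.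
have B1 : `|psi1 t * gcos' a b x| <= pi.
  rewrite normrM /psi1 normrM normrN normfV (gtr0_norm t0) (gtr0_norm s0).
  rewrite mulrAC ler_pdivrMr//; apply: ler_pM => //; exact: ltW.
move: (gcos a b x) (gcos' a b x) (psi1 t) (psi2 t) (psi3 t) (psi4 t)
  cI cs B1 P1 P2 P3 P4 => c c' h1 h2 h3 h4 cI cs B1 P1 P2 P3 P4.
have c1 : `|c| <= 1 by rewrite ler_norml.
set m := `|c'|; have m0 : 0 <= m by exact: normr_ge0.
have mr : m <= r by exact: le_trans sr.
have m1 : m <= 1 by rewrite (le_trans cs)// sin_le1.
have mX n : m ^+ n <= r ^+ n by rewrite lerXn2r ?nnegrE// ltW.
rewrite ler_pdivlMr ?exprn_gt0// in P1.
rewrite ler_pdivlMr ?exprn_gt0// in P2.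
rewrite ler_pdivlMr ?exprn_gt0// in P3.
rewrite ler_pdivlMr ?exprn_gt0// in P4.
have U n j i u : 0 <= u -> u * r ^+ i <= C -> i = (n + j)%N -> u * m ^+ n * r ^+ j <= C.
  move=> u0 uC E; apply: le_trans uC; rewrite E exprD mulrA.
  by rewrite ler_wpM2r ?exprn_ge0 ?(ltW r0)// ler_wpM2l.
have rr : r ^+ 2 <= 16 by nra.
have hr : 0 <= `|h1| * r by rewrite mulr_ge0// ltW.
split => //; rewrite ler_pdivlMr ?exprn_gt0//.
- have N : `|h2 * c' ^+ 2 - c * h1| <= `|h2| * m ^+ 2 + `|h1|.
    rewrite (le_trans (ler_normB _ _))// (normrM h2) normrX (normrM c) lerD2l.
    by rewrite -[leRHS]mul1r ler_wpM2r.
  apply: (le_trans (ler_wpM2r (ltW r0) N)); rewrite mulrDl.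
  have := @U 2%N 1%N 3%N `|h2| (normr_ge0 _) P2 erefl; rewrite expr1.
  by move: P1; lra.
- have N : `|h3 * c' ^+ 3 - 3 * c * c' * h2 - c' * h1| <=
     `|h3| * m ^+ 3 + 3 * (`|h2| * m ^+ 1) + `|h1|.
    rewrite (le_trans (ler_normB _ _))//; apply: lerD.
      rewrite (le_trans (ler_normB _ _))// (normrM h3) normrX lerD2l !normrM (@ger0_norm _ 3)//.
      rewrite -/m -!mulrA ler_wpM2l// expr1 [leRHS]mulrC -[leRHS]mul1r ler_wpM2r//.
      by rewrite mulr_ge0.
    by rewrite normrM -[leRHS]mul1r ler_wpM2r.
  apply: (le_trans (ler_wpM2r _ N)); first by rewrite exprn_ge0 ?ltW.
  have := @U 3%N 2%N 5%N `|h3| (normr_ge0 _) P3 erefl.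
  have := @U 1%N 2%N 3%N `|h2| (normr_ge0 _) P2 erefl.
  have : `|h1| * r ^+ 2 <= 4 * C.
    have -> : `|h1| * r ^+ 2 = (`|h1| * r) * r by ring.
    by rewrite [4 * _]mulrC; apply: ler_pM => //; exact: ltW.
  by rewrite !mulrDl; lra.
- have N : `|h4 * c' ^+ 4 - 6 * c * c' ^+ 2 * h3 +
       (3 * c ^+ 2 - 4 * c' ^+ 2) * h2 + c * h1| <=
     `|h4| * m ^+ 4 + 6 * (`|h3| * m ^+ 2) + 7 * `|h2| + `|h1|.
    rewrite (le_trans (ler_normD _ _))//; apply: lerD; last first.
      by rewrite normrM -[leRHS]mul1r ler_wpM2r.
    rewrite (le_trans (ler_normD _ _))//; apply: lerD; last first.
      rewrite normrM ler_wpM2r// (le_trans (ler_normB _ _))//.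
      rewrite (normrM 3) (normrM 4) (@ger0_norm _ 3)// (@ger0_norm _ 4)// !normrX -/m.
      have : m ^+ 2 <= 1 by rewrite exprn_ile1.
      have : `|c| ^+ 2 <= 1 by rewrite exprn_ile1.
      by move: (m ^+ 2) (`|c| ^+ 2) => *; lra.
    rewrite (le_trans (ler_normB _ _))// (normrM h4) normrX lerD2l.
    rewrite (normrM _ h3) (normrM (6 * c)) normrX (normrM 6) (@ger0_norm _ 6)//.
    have -> : 6 * `|c| * `|c'| ^+ 2 * `|h3| = `|c| * (6 * (`|h3| * m ^+ 2)) by rewrite /m; ring.
    by rewrite -[leRHS]mul1r ler_wpM2r// !mulr_ge0// exprn_ge0.
  apply: (le_trans (ler_wpM2r _ N)); first by rewrite exprn_ge0 ?ltW.
  have := @U 4%N 3%N 7%N `|h4| (normr_ge0 _) P4 erefl.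
  have := @U 2%N 3%N 5%N `|h3| (normr_ge0 _) P3 erefl.
  have : `|h1| * r ^+ 3 <= 16 * C.
    have -> : `|h1| * r ^+ 3 = (`|h1| * r) * r ^+ 2 by ring.
    by rewrite [16 * _]mulrC; apply: ler_pM => //; exact: sqr_ge0.
  by rewrite !mulrDl; lra.
Qed.

Lemma geo0_lip a b x : a ^+ 2 + b ^+ 2 < 1 -> 0 <= x ->
  `|geo0 a b x - geo0 a b 0| <= pi * x.
Proof.
move=> ab1 x0; rewrite /geo0.
have /andP[t0 t1] := gdist_itv ab1 x; have /andP[s0 s1] := gdist_itv ab1 0.
have := gdist_lip ab1 x0; set t := gdist a b x in t0 t1 *; set s := gdist a b 0 in s0 s1 *.
move=> ts; have -> : 2^-1 * t ^+ 2 - 2^-1 * s ^+ 2 = ((t + s) / 2) * (t - s) by field.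
by rewrite normrM; apply: ler_pM => //; rewrite ger0_norm; lra.
Qed.

Let remainder_step a b x : a ^+ 2 + b ^+ 2 < 1 ->
  0 <= x <= (pi - gdist a b 0) / 2 -> forall z, 0 <= z <= x ->
  (pi - gdist a b 0) / 2 <= pi - gdist a b z.
Proof.
move=> ab1 /andP[x0 xr] z /andP[z0 zx]; have := gdist_lip ab1 z0.
by rewrite ler_norml => /andP[]; lra.
Qed.

(** Let r be pi minus the initial distance. Up to x = r / 2 the distance, being 1-Lipschitz, stays r
    / 2 away from pi and Taylor's formula applies. Beyond, both terms are of order x, and x <= 2 x^2
    / r makes the claimed bound trivial. So the bound holds for all x >= 0. *)
Lemma geo_remainder2 : exists2 C : R, 0 < C & forall a b x, a ^+ 2 + b ^+ 2 < 1 -> 0 <= x ->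
  `|geo0 a b x - (geo0 a b 0 + geo1 a b 0 * x)| <= C * x ^+ 2 / (pi - gdist a b 0).
Proof.
have [C C0 HC] := geo_bound; exists (2 * C + 16) => [|a b x ab1 x0]; first by lra.
have xx : 0 <= x <= x by rewrite x0 lexx.
have := pi_le4 => p4; have := pi_gt0 R => p0.
set r := pi - gdist a b 0.
have /andP[g0 g1] := gdist_itv ab1 0.
have r0 : 0 < r by rewrite subr_gt0.
rewrite ler_pdivlMr//.
have [xr|xr] := leP x (r / 2).
  have H : `|geo0 a b x - (geo0 a b 0 + geo1 a b 0 * x + 0 / 2 * x ^+ 2)| <=
      (C * (2 / r)) * x ^+ 2.
    have d0 z : 0 <= z <= x -> is_derive z 1 (geo0 a b) (geo1 a b z).
      by move=> _; exact: is_derive_geo0.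
    have d1 z : 0 <= z <= x -> is_derive z 1 (geo1 a b) (geo2 a b z).
      by move=> _; exact: is_derive_geo1.
    have d2 z : 0 <= z <= x -> `|geo2 a b z - 0| <= C * (2 / r).
      move=> zx; rewrite subr0; have [_ + _ _] := HC a b z ab1; move/le_trans; apply.
      have := @remainder_step a b x ab1; rewrite x0 -/r xr => /(_ isT z zx) rz.
      have rz0 : 0 < pi - gdist a b z by lra.
      rewrite ler_pM2l// ler_pdivlMr// mulrC ler_pdivrMr//; lra.
    exact: (taylor2_bound d0 d1 d2 xx).
  rewrite mul0r mul0r addr0 in H.
  apply: (le_trans (ler_wpM2r (ltW r0) H)).
  have -> : C * (2 / r) * x ^+ 2 * r = 2 * C * x ^+ 2 by field; rewrite gt_eqF.
  by rewrite ler_wpM2r ?sqr_ge0//; lra.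
have H1 := geo0_lip ab1 x0.
have [H2 _ _ _] := HC a b 0 ab1.
have : `|geo0 a b x - (geo0 a b 0 + geo1 a b 0 * x)| <= 2 * pi * x.
  rewrite opprD addrA (le_trans (ler_normB _ _))// normrM (ger0_norm x0).
  have : `|geo1 a b 0| * x <= pi * x by rewrite ler_wpM2r.
  by lra.
move=> H; apply: (le_trans (ler_wpM2r (ltW r0) H)).
have : 2 * pi * x * r <= 2 * 4 * x * (2 * x).
  apply: ler_pM => //; rewrite ?mulr_ge0 ?(ltW r0)//; try lra.
  by rewrite ler_wpM2r//; lra.
move=> H3; apply: (le_trans H3).
have -> : 2 * 4 * x * (2 * x) = 16 * x ^+ 2 by ring.
by rewrite ler_wpM2r ?sqr_ge0//; lra.
Qed.

Lemma geo_remainder4 : exists2 C : R, 0 < C & forall a b x, a ^+ 2 + b ^+ 2 < 1 -> 0 <= x ->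
  `|geo0 a b x - (geo0 a b 0 + geo1 a b 0 * x + geo2 a b 0 / 2 * x ^+ 2 + geo3 a b 0 / 6 * x ^+ 3)|
  <= C * x ^+ 4 / (pi - gdist a b 0) ^+ 3.
Proof.
have [C C0 HC] := geo_bound; exists (8 * C + 64) => [|a b x ab1 x0]; first by lra.
have xx : 0 <= x <= x by rewrite x0 lexx.
have := pi_le4 => p4; have := pi_gt0 R => p0.
set r := pi - gdist a b 0.
have /andP[g0 g1] := gdist_itv ab1 0.
have r0 : 0 < r by rewrite subr_gt0.
have [xr|xr] := leP x (r / 2).
  have H : `|geo0 a b x - (geo0 a b 0 + geo1 a b 0 * x + geo2 a b 0 / 2 * x ^+ 2 +
       geo3 a b 0 / 6 * x ^+ 3 + 0 / 24 * x ^+ 4)| <= (C * (8 / r ^+ 3)) * x ^+ 4.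
    have d0 z : 0 <= z <= x -> is_derive z 1 (geo0 a b) (geo1 a b z).
      by move=> _; exact: is_derive_geo0.
    have d1 z : 0 <= z <= x -> is_derive z 1 (geo1 a b) (geo2 a b z).
      by move=> _; exact: is_derive_geo1.
    have d2 z : 0 <= z <= x -> is_derive z 1 (geo2 a b) (geo3 a b z).
      by move=> _; exact: is_derive_geo2.
    have d3 z : 0 <= z <= x -> is_derive z 1 (geo3 a b) (geo4 a b z).
      by move=> _; exact: is_derive_geo3.
    have d4 z : 0 <= z <= x -> `|geo4 a b z - 0| <= C * (8 / r ^+ 3).
      move=> zx; rewrite subr0; have [_ _ _] := HC a b z ab1; move/le_trans; apply.
      have := @remainder_step a b x ab1; rewrite x0 -/r xr => /(_ isT z zx) rz.
      have rz0 : 0 < pi - gdist a b z by lra.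
      rewrite ler_pM2l// ler_pdivlMr ?exprn_gt0// mulrC.
      rewrite ler_pdivrMr ?exprn_gt0//.
      have -> : r ^+ 3 = 8 * (r / 2) ^+ 3 by field.
      by rewrite ler_pM2l// lerXn2r ?nnegrE//; lra.
    exact: (taylor4_bound d0 d1 d2 d3 d4 xx).
  rewrite mul0r mul0r addr0 in H; apply: (le_trans H).
  have -> : C * (8 / r ^+ 3) * x ^+ 4 = 8 * C * x ^+ 4 / r ^+ 3 by field; rewrite gt_eqF.
  by rewrite ler_wpM2r ?invr_ge0 ?exprn_ge0 ?(ltW r0)// ler_wpM2r ?exprn_ge0//; lra.
have H1 := geo0_lip ab1 x0.
have [H2 H3 H4 _] := HC a b 0 ab1; rewrite -/r in H3 H4.
(* Beyond r / 2 the ratio y is at least 1/2. The terms of the expansion are of size x, y x and y^2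
   x, each at most a multiple of y^3 x, which is the claimed bound. *)
set y := x / r.
have xE : x = y * r by rewrite /y divfK// gt_eqF.
have y2 : 2^-1 <= y by rewrite /y ler_pdivlMr//; lra.
have -> : (8 * C + 64) * x ^+ 4 / r ^+ 3 = (8 * C + 64) * (y ^+ 3 * x).
  by rewrite /y; field; rewrite gt_eqF.
apply: (@le_trans _ _ (pi * x + pi * x + C / r / 2 * x ^+ 2 + C / r ^+ 2 / 6 * x ^+ 3)).
  rewrite !opprD !addrA; apply: (le_trans (ler_normB _ _)); apply: lerD.
    apply: (le_trans (ler_normB _ _)); apply: lerD.
      apply: (le_trans (ler_normB _ _)); apply: lerD => //.
      by rewrite normrM (ger0_norm x0) ler_wpM2r.
    rewrite (normrM (geo2 a b 0 / 2)) (@ger0_norm _ (x ^+ 2)) ?exprn_ge0// ler_wpM2r ?exprn_ge0//.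
    by rewrite (normrM (geo2 a b 0)) (@ger0_norm _ 2^-1)// ler_wpM2r.
  rewrite (normrM (geo3 a b 0 / 6)) (@ger0_norm _ (x ^+ 3)) ?exprn_ge0// ler_wpM2r ?exprn_ge0//.
  by rewrite (normrM (geo3 a b 0)) (@ger0_norm _ 6^-1)// ler_wpM2r.
have -> : C / r / 2 * x ^+ 2 = C / 2 * y * x by rewrite /y; field; rewrite gt_eqF.
have -> : C / r ^+ 2 / 6 * x ^+ 3 = C / 6 * y ^+ 2 * x by rewrite /y; field; rewrite gt_eqF.
have -> : pi * x + pi * x + C / 2 * y * x + C / 6 * y ^+ 2 * x =
   (2 * pi + C / 2 * y + C / 6 * y ^+ 2) * x by ring.
rewrite mulrA ler_wpM2r//.
have y0 : 0 < y by lra.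
have k1 : y ^+ 2 <= 2 * y ^+ 3.
  by rewrite [y ^+ 3]exprS mulrA -[leLHS]mul1r ler_wpM2r ?sqr_ge0//; lra.
have k2 : y <= 2 * y ^+ 2 by rewrite expr2; nra.
have k3 : 1 <= 2 * y by lra.
have : C * y <= C * (4 * y ^+ 3) by rewrite ler_pM2l//; lra.
have : C * y ^+ 2 <= C * (2 * y ^+ 3) by rewrite ler_pM2l//; lra.
have : 0 <= C * y ^+ 3 by rewrite mulr_ge0 ?exprn_ge0 ?ltW.
by move: (y ^+ 3) (y ^+ 2) k1 k2 => u v; lra.
Qed.

(** Continuity of the fourth derivative at 0. The threshold s depends on (a, b), so this gives only
    the pointwise convergence; [geo_remainder4] supplies the domination. *)
Lemma geo4_limit a b : a ^+ 2 + b ^+ 2 < 1 -> forall e : R, 0 < e ->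
  exists2 s : R, 0 < s & forall x, 0 <= x < s ->
  `|geo0 a b x - (geo0 a b 0 + geo1 a b 0 * x + geo2 a b 0 / 2 * x ^+ 2 + geo3 a b 0 / 6 * x ^+ 3
     + geo4 a b 0 / 24 * x ^+ 4)| <= e * x ^+ 4.
Proof.
move=> ab1 e e0.
have cg : {for 0, continuous (geo4 a b)}.
  have D1 := is_derive_psi_gdist ab1 0 (@is_derive_psi1 R).
  have D2 := is_derive_psi_gdist ab1 0 (@is_derive_psi2 R).
  have D3 := is_derive_psi_gdist ab1 0 (@is_derive_psi3 R).
  have Dg := is_derive_gdist ab1 0.
  have Dc := is_derive_gcos a b 0; have Dc' := is_derive_gcos' a b 0.
  eapply der_continuous; rewrite /geo4 /psi4; repeat der_step.
  by rewrite expf_neq0// sin_gdist_neq0.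
have /cvgrPdist_le /(_ e e0) [s /= s0 sP] := cg.
exists s => // x /andP[x0 xd].
have xx : 0 <= x <= x by rewrite x0 lexx.
have d0 z : 0 <= z <= x -> is_derive z 1 (geo0 a b) (geo1 a b z).
  by move=> _; exact: is_derive_geo0.
have d1 z : 0 <= z <= x -> is_derive z 1 (geo1 a b) (geo2 a b z).
  by move=> _; exact: is_derive_geo1.
have d2 z : 0 <= z <= x -> is_derive z 1 (geo2 a b) (geo3 a b z).
  by move=> _; exact: is_derive_geo2.
have d3 z : 0 <= z <= x -> is_derive z 1 (geo3 a b) (geo4 a b z).
  by move=> _; exact: is_derive_geo3.
have d4 z : 0 <= z <= x -> `|geo4 a b z - geo4 a b 0| <= e.
  move=> /andP[z0 zx]; rewrite distrC; apply: sP.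
  by rewrite /= sub0r normrN ger0_norm// (le_lt_trans zx).
exact: (taylor4_bound d0 d1 d2 d3 d4 xx).
Qed.

End geodesic_remainder.

(** * Moments of the Taylor coefficients *)

Section sine_moments.
Context (R : realType) (k : nat).
Local Notation leb := (@lebesgue_measure R).

Definition sin_moment j : R := \int[leb]_(s in `[0, pi]) (sin s ^+ k * cos s ^+ (2 * j)).

Lemma sin_moment_integrable j :
  leb.-integrable `[0, pi] (EFin \o (fun s => sin s ^+ k * cos s ^+ (2 * j))).
Proof.
apply: continuous_compact_integrable; first exact: segment_compact.
apply: continuous_subspaceT => s.
have D : is_derive s 1 (fun s : R => sin s ^+ k * cos s ^+ (2 * j))
  (k%:R * sin s ^+ k.-1 * cos s * cos s ^+ (2 * j) +
   sin s ^+ k * ((2 * j)%:R * cos s ^+ (2 * j).-1 * - sin s)).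
  by der; ring.
exact: (der_continuous D).
Qed.

Lemma sin_momentE j :
  (\int[leb]_(s in `[0%R, pi]) (sin s ^+ k * cos s ^+ (2 * j))%:E)%E = (sin_moment j)%:E.
Proof.
rewrite /sin_moment /Rintegral fineK//.
exact: (integrable_fin_num _ (sin_moment_integrable j)).
Qed.

Lemma sin_moment0 : sin_moment 0 = sin_int R k.
Proof. by apply: eq_Rintegral => s _; rewrite muln0 expr0 mulr1. Qed.

(** The derivative of sin^(k+1) cos^(2j+1) has integral 0 over [0, pi], since sin vanishes at both
    ends. *)
Lemma sin_moment_rec j :
  (k + 2 * j + 2)%:R * sin_moment j.+1 = (2 * j + 1)%:R * sin_moment j.
Proof.
have I0 := sin_moment_integrable j; have I1 := sin_moment_integrable j.+1.
pose g (s : R) := (k + 2 * j + 2)%:R * (sin s ^+ k * cos s ^+ (2 * j.+1)) -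
  (2 * j + 1)%:R * (sin s ^+ k * cos s ^+ (2 * j)).
have dg (s : R) : 0 <= s <= pi ->
    is_derive s 1 (fun s => sin s ^+ k.+1 * cos s ^+ (2 * j + 1)) (g s).
  move=> _; der; rewrite addn1/= /g mulnS.
  have S2 := sin2cos2 s; set n := (2 * j)%N.
  have -> : (k.+1)%:R = k%:R + 1 :> R by rewrite natr1.
  have -> : (n.+1)%:R = n%:R + 1 :> R by rewrite natr1.
  rewrite !natrD exprD !(exprS _ n) (exprS _ k).
  move: (sin s ^+ k) (cos s ^+ n) => A B.
  by move: (cos s) (sin s) S2 => c z S2; ring: S2.
have cg (s : R) : 0 <= s <= pi -> {for s, continuous g}.
  move=> _; rewrite /g; eapply der_continuous; repeat der_step.
have pi0 := pi_gt0 R.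
have := FTC2_is_derive pi0 dg cg; rewrite sinpi sin0 expr0n/= !mul0r subrr.
have mI : measurable (`[0, pi]%classic : set (measurableTypeR R)) by [].
have J0 := integrableZl mI (2 * j + 1)%:R I0.
have J1 := integrableZl mI (k + 2 * j + 2)%:R I1.
move=> /(congr1 fine)/=; rewrite -/(Rintegral _ _ _) /g RintegralB//.
by rewrite !RintegralZl// => /eqP; rewrite subr_eq0 => /eqP.
Qed.

Lemma sin_moment1 : (k + 2)%:R * sin_moment 1 = sin_int R k.
Proof. by have := sin_moment_rec 0; rewrite sin_moment0 muln0 addn0 mul1r. Qed.

Lemma sin_moment2 : (k + 2)%:R * (k + 4)%:R * sin_moment 2 = 3 * sin_int R k.
Proof.
have := sin_moment_rec 1; rewrite muln1 -addnA -mulrA => ->.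
by rewrite mulrCA sin_moment1.
Qed.

Lemma sin_int_rec : (k + 2)%:R * sin_int R k.+2 = (k + 1)%:R * sin_int R k.
Proof.
have -> : sin_int R k.+2 = sin_moment 0 - sin_moment 1.
  rewrite -RintegralB//; try exact: sin_moment_integrable.
  by apply: eq_Rintegral => s _; rewrite muln0 muln1 cos2sin2 !exprS expr0; ring.
rewrite mulrBr sin_moment1 sin_moment0 -{2}[sin_int R k]mul1r -mulrBl.
by rewrite !natrD; ring.
Qed.

End sine_moments.

Section signed_integrals.
Context d (X : measurableType d) (R : realType) (m : {measure set X -> \bar R}).

(** Used with e = 1 and e = -1, the hypothesis compares the positive and the negative parts of h, to
    which the zonal formula for nonnegative functions applies. *)
Lemma eq_signed_integral (h u v : X -> R) :
  (forall x, 0 <= u x) -> (forall x, 0 <= v x) ->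
  (forall e : R, (\int[m]_x (Num.max (e * h x) 0 * u x)%:E =
                  \int[m]_x (Num.max (e * h x) 0 * v x)%:E)%E) ->
  (\int[m]_x (h x * u x)%:E = \int[m]_x (h x * v x)%:E)%E.
Proof.
move=> u0 v0 E; rewrite integralE [RHS]integralE.
have P w x : 0 <= w x -> (fun x => (h x * w x)%:E)^\+%E x = (Num.max (1 * h x) 0 * w x)%:E.
  by move=> w0; rewrite funeposE mul1r -EFin_max maxr_pMl// mul0r.
have N w x : 0 <= w x -> (fun x => (h x * w x)%:E)^\-%E x = (Num.max (- 1 * h x) 0 * w x)%:E.
  by move=> w0; rewrite funenegE -EFinN -EFin_max maxr_pMl// mul0r mulN1r mulNr.
under eq_integral do rewrite P//.
under [X in (_ - X)%E]eq_integral do rewrite N//.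
by rewrite !E; congr (_ - _)%E; apply: eq_integral => x _; rewrite ?P ?N.
Qed.

End signed_integrals.

Section zonal_moments.
Context (R : realType) (k : nat).
Local Notation leb := (@lebesgue_measure R).
Local Notation d := k.+2.
Variables (mu : probability 'rV[R]_d.+1 R) (p : 'rV[R]_d.+1) (f : R -> R).
Hypothesis p1 : sphere R d p.
Hypothesis f_meas : measurable_fun `[0, pi] f.
Hypothesis f_ge0 : forall t, 0 <= t <= pi -> 0 <= f t.
Hypothesis mu_density : forall A, measurable A ->
  mu A = (\int[svol R d]_(q in A `&` sphere R d) (f (sdist p q))%:E)%E.

Let V := fine (svol R k setT).

Let VE : svol R k setT = V%:E.
Proof. by rewrite fineK// fin_num_measure. Qed.

Let V0 : 0 <= V.
Proof. by rewrite fine_ge0. Qed.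

Variable w : 'rV[R]_d.+1.
Hypotheses (w1 : sphere R d w) (pw : dotp p w = 0).

Lemma ge0_zonal_moment (h : R -> R) j :
  measurable_fun setT h -> (forall c, 0 <= h c) ->
  (\int[mu]_x (h (dotp p x) * dotp w x ^+ (2 * j))%:E =
   \int[leb]_(t in `[0%R, pi]) (sin t ^+ k.+1 *
      (f t * (h (cos t) * sin t ^+ (2 * j)) * V * sin_moment R k j))%:E)%E.
Proof.
move=> mh h0; pose g (z : R * R) := (h z.1 * z.2 ^+ (2 * j))%:E.
have mg : measurable_fun setT g.
  apply/measurable_EFinP; apply: measurable_funM.
    exact: (measurableT_comp mh measurable_fst).
  exact: (measurable_funX _ measurable_snd).
have x2 (x : R) : 0 <= x ^+ (2 * j) by rewrite exprM exprn_ge0// sqr_ge0.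
have g0 z : (0 <= g z)%E by rewrite lee_fin mulr_ge0.
apply: (etrans (ge0_integral_zonal p1 f_meas f_ge0 mu_density w1 pw mg g0)).
apply: eq_integral => t /[!inE]; rewrite /= in_itv/= => tI.
rewrite EFinM; congr (_ * _)%E.
transitivity (\int[leb]_(s in `[0%R, pi])
   ((f t * (h (cos t) * sin t ^+ (2 * j)) * V)%:E * (sin s ^+ k * cos s ^+ (2 * j))%:E))%E.
  apply: eq_integral => s _; rewrite VE /g/= -!EFinM; congr _%:E.
  by rewrite exprMn; ring.
rewrite ge0_integralZl_EFin//.
- by rewrite sin_momentE -EFinM.
- by move=> s /sin_ge0_itv s0; rewrite lee_fin mulr_ge0// exprn_ge0.
- exact: (integrableP _ _ _ (sin_moment_integrable R k j)).1.
- by rewrite !mulr_ge0// f_ge0.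
Qed.

Lemma zonal_integral (h : R -> R) : measurable_fun setT h ->
  (\int[mu]_x (h (dotp p x))%:E = \int[leb]_(t in `[0%R, pi])
    (sin t ^+ k.+1 * f t * (V * sin_int R k) * h (cos t))%:E)%E.
Proof.
move=> mh; rewrite integralE [RHS]integralE.
have E (g : R -> R) : measurable_fun setT g -> (forall c, 0 <= g c) ->
    (\int[mu]_x (g (dotp p x))%:E = \int[leb]_(t in `[0%R, pi])
    (sin t ^+ k.+1 * f t * (V * sin_int R k) * g (cos t))%:E)%E.
  move=> mg g0; have := ge0_zonal_moment 0 mg g0.
  rewrite muln0; under eq_integral do rewrite expr0 mulr1.
  move=> ->; apply: eq_integral => t _; rewrite expr0 sin_moment0; congr _%:E; ring.
have W t : `[0, pi]%classic t -> 0 <= sin t ^+ k.+1 * f t * (V * sin_int R k).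
  move=> tI; rewrite !mulr_ge0// ?exprn_ge0 ?sin_ge0_itv ?f_ge0//.
  apply: Rintegral_ge0 => s sI; exact/exprn_ge0/sin_ge0_itv.
congr (_ - _)%E.
- transitivity (\int[mu]_x (Num.max (h (dotp p x)) 0)%:E)%E.
    by apply: eq_integral => x _; rewrite funeposE -EFin_max.
  rewrite (E (fun c => Num.max (h c) 0))//.
  + apply: eq_integral => t /[!inE] tI.
    by rewrite funeposE -EFin_max maxr_pMr ?mulr0// W.
  + exact: measurable_maxr.
  + by move=> c; rewrite le_max lexx orbT.
- transitivity (\int[mu]_x (Num.max (- h (dotp p x)) 0)%:E)%E.
    by apply: eq_integral => x _; rewrite funenegE -EFinN -EFin_max.
  rewrite (E (fun c => Num.max (- h c) 0))//.
  + apply: eq_integral => t /[!inE] tI.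
    by rewrite funenegE -EFinN -EFin_max maxr_pMr ?mulr0 ?W// mulrN.
  + by apply: measurable_maxr => //; exact: measurableT_comp.
  + by move=> c; rewrite le_max lexx orbT.
Qed.

(* Averaging over the directions w replaces <w, x>^(2 j) by its mean. *)
Lemma zonal_moment_reduce (h : R -> R) j c : measurable_fun setT h -> 0 <= c ->
  sin_moment R k j = c * sin_int R k ->
  (\int[mu]_x (h (dotp p x) * dotp w x ^+ (2 * j))%:E =
   \int[mu]_x (h (dotp p x) * (c * sin (acosr (dotp p x)) ^+ (2 * j)))%:E)%E.
Proof.
move=> mh c0 cS.
have x2 (x : R) : 0 <= x ^+ (2 * j) by rewrite exprM exprn_ge0// sqr_ge0.
apply: (@eq_signed_integral _ _ _ mu (fun x => h (dotp p x)) (fun x => dotp w x ^+ (2 * j))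
  (fun x => c * sin (acosr (dotp p x)) ^+ (2 * j))) => //.
  by move=> x; rewrite mulr_ge0.
move=> e; pose g c := Num.max (e * h c) 0.
have mg : measurable_fun setT g by apply: measurable_maxr => //; exact: measurable_funM.
have g0 x : 0 <= g x by rewrite le_max lexx orbT.
apply: (etrans (ge0_zonal_moment j mg g0)).
have mG : measurable_fun setT (fun x => g x * (c * sin (acosr x) ^+ (2 * j))).
  apply: measurable_funM => //; apply: measurable_funM => //.
  apply: measurable_funX; apply: (measurableT_comp _ (@measurable_acosr R)).
  by apply: continuous_measurable_fun; exact: continuous_sin.
apply: (etrans _ (esym (zonal_integral mG))).
apply: eq_integral => t /[!inE] /=; rewrite in_itv/= => tI.
by rewrite acosr_cos// cS; congr _%:E; ring.
Qed.

(** With a = cos t and b = sin t cos s, the defect 1 - a^2 - b^2 is sin(t)^2 sin(s)^2. It vanishes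
    only where one of the weights sin(t)^(k+1), sin(s)^k vanishes as well, the latter because k >
    0. *)
Lemma zonal_ball : (0 < k)%N -> mu [set x | 1 <= dotp p x ^+ 2 + dotp w x ^+ 2] = 0%E.
Proof.
move=> k0; pose B : set (R * R) := [set z | 1 <= z.1 ^+ 2 + z.2 ^+ 2].
have mB : measurable B.
  rewrite -[B]setTI; apply: measurable_fun_ler => //.
  by apply: measurable_funD; apply: measurable_funX;
    [exact: measurable_fst|exact: measurable_snd].
have mA : measurable [set x | 1 <= dotp p x ^+ 2 + dotp w x ^+ 2].
  rewrite -[X in measurable X]setTI; apply: measurable_fun_ler => //.
  by apply: measurable_funD; apply: measurable_funX; exact: measurable_dotp.
transitivity (\int[mu]_x (\1_B (dotp p x, dotp w x))%:E)%E.
  by rewrite -[X in mu X]setIT -integral_indic//; apply: eq_integral => x _; rewrite !indicE.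
pose g (z : R * R) := (\1_B z : R)%:E.
have mg : measurable_fun setT g by apply/measurable_EFinP; exact: measurable_indic.
have g0 z : (0 <= g z)%E by rewrite lee_fin.
apply: (etrans (ge0_integral_zonal p1 f_meas f_ge0 mu_density w1 pw mg g0)).
apply: integral0_eq => t tI.
have [st0|st0] := eqVneq (sin t) 0; first by rewrite st0 expr0n/= mul0e.
rewrite integral0_eq ?mule0// => s sI.
have [ss0|ss0] := eqVneq (sin s) 0; first by rewrite ss0 expr0n gtn_eqF// mul0e.
rewrite /g indicE memNset ?mule0 ?mul0e ?mule0// /B/= exprMn (cos2sin2 s) (cos2sin2 t) => H.
have : 0 < sin t ^+ 2 * sin s ^+ 2 by rewrite mulr_gt0// exprn_even_gt0.
by move: H; lra.
Qed.

End zonal_moments.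

Section taylor_coefficients.
Context (R : realType).
Implicit Types (a b x : R) (z : R * R).

(* [tay j] is the j-th derivative at 0 of [geo0], as a function of (<p, y>, <w, y>). *)
Definition tay1 z : R := psi1 (acosr z.1) * z.2.
Definition tay2 z : R := psi2 (acosr z.1) * z.2 ^+ 2 - z.1 * psi1 (acosr z.1).
Definition tay3 z : R := psi3 (acosr z.1) * z.2 ^+ 3
  - 3 * z.1 * z.2 * psi2 (acosr z.1) - z.2 * psi1 (acosr z.1).
Definition tay4 z : R := psi4 (acosr z.1) * z.2 ^+ 4
  - 6 * z.1 * z.2 ^+ 2 * psi3 (acosr z.1)
  + (3 * z.1 ^+ 2 - 4 * z.2 ^+ 2) * psi2 (acosr z.1) + z.1 * psi1 (acosr z.1).
Definition half_sqdist x z : R := 2^-1 * acosr (z.1 * cos x + z.2 * sin x) ^+ 2.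

Lemma tay_geo a b : a ^+ 2 + b ^+ 2 < 1 ->
  [/\ gdist a b 0 = acosr a, geo1 a b 0 = tay1 (a, b), geo2 a b 0 = tay2 (a, b),
      geo3 a b 0 = tay3 (a, b) & geo4 a b 0 = tay4 (a, b)].
Proof.
move=> ab1; have := gcos_itvW ab1 0; rewrite /geo1 /geo2 /geo3 /geo4 /gdist.
have -> : gcos a b 0 = a by rewrite /gcos cos0 sin0; ring.
have -> : gcos' a b 0 = b by rewrite /gcos' cos0 sin0; ring.
by move=> aI; rewrite -acosrE.
Qed.

Lemma geo0_half_sqdist a b x : a ^+ 2 + b ^+ 2 < 1 ->
  geo0 a b x = half_sqdist x (a, b).
Proof. by move=> ab1; rewrite /geo0 /gdist -acosrE//; exact: gcos_itvW. Qed.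

Lemma acosr_lt_pi a b : a ^+ 2 + b ^+ 2 < 1 -> 0 < acosr a < pi.
Proof. by move=> ab1; have [<- _ _ _ _] := tay_geo ab1; exact: gdist_itv. Qed.

Lemma cos_acosr a : -1 <= a <= 1 -> cos (acosr a) = a.
Proof. by move=> aI; rewrite acosrE// acosK// in_itv. Qed.

Lemma sin_acosr_sqr a : -1 <= a <= 1 -> sin (acosr a) ^+ 2 = 1 - a ^+ 2.
Proof. by move=> aI; rewrite sin2cos2 cos_acosr. Qed.

(** The lower coefficients are less singular; since pi - t <= 4, all four are put under the single
    majorant whose integrability is to be proved. *)
Lemma tay_bound : exists2 C : R, 0 < C & forall a b, a ^+ 2 + b ^+ 2 < 1 ->
  [/\ `|tay1 (a, b)| <= C * (pi - acosr a)^-1 ^+ 3, `|tay2 (a, b)| <= C * (pi - acosr a)^-1 ^+ 3,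
      `|tay3 (a, b)| <= C * (pi - acosr a)^-1 ^+ 3 & `|tay4 (a, b)| <= C * (pi - acosr a)^-1 ^+ 3].
Proof.
have [C C0 HC] := geo_bound R; exists (16 * C + 256) => [|a b ab1]; first by lra.
have [g t1 t2 t3 t4] := tay_geo ab1.
have [] := HC a b 0 ab1; rewrite t1 t2 t3 t4 g.
have := acosr_lt_pi ab1; set t := acosr a => /andP[tp t0].
have := pi_le4 R => p4; have p0 := pi_gt0 R.
set r := pi - t; have r0 : 0 < r by rewrite subr_gt0.
have r4 : r <= 4 by rewrite /r; lra.
rewrite exprVn => h1 h2 h3 h4; split; rewrite ler_pdivlMr ?exprn_gt0//.
- have : `|tay1 (a, b)| * r ^+ 3 <= 4 * 64; last by lra.
  apply: ler_pM; rewrite ?exprn_ge0 ?(ltW r0)//; first exact: le_trans h1 _.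
  have -> : 64 = 4 ^+ 3 :> R by ring.
  by rewrite lerXn2r ?nnegrE// ltW.
- rewrite ler_pdivlMr// in h2.
  have -> : `|tay2 (a, b)| * r ^+ 3 = (`|tay2 (a, b)| * r) * r ^+ 2 by ring.
  have : (`|tay2 (a, b)| * r) * r ^+ 2 <= C * 16; last by lra.
  apply: ler_pM; rewrite ?mulr_ge0 ?sqr_ge0 ?(ltW r0)//; nra.
- rewrite ler_pdivlMr ?exprn_gt0// in h3.
  have -> : `|tay3 (a, b)| * r ^+ 3 = (`|tay3 (a, b)| * r ^+ 2) * r by ring.
  have : (`|tay3 (a, b)| * r ^+ 2) * r <= C * 4; last by lra.
  apply: ler_pM; rewrite ?mulr_ge0 ?sqr_ge0 ?(ltW r0)//; nra.
- rewrite ler_pdivlMr ?exprn_gt0// in h4; lra.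
Qed.

Lemma measurable_sinr : measurable_fun setT (@sin R).
Proof. by apply: continuous_measurable_fun; exact: continuous_sin. Qed.

Lemma measurable_cosr : measurable_fun setT (@cos R).
Proof. by apply: continuous_measurable_fun; exact: continuous_cos. Qed.

Lemma measurable_psi1 : measurable_fun setT (@psi1 R).
Proof.
apply: (@measurable_funM _ _ _ _ (fun t : R => - t) (fun t : R => (sin t)^-1)).
  exact: (measurableT_comp (@oppr_measurable R setT) (@measurable_id _ R setT)).
exact: (measurableT_comp (@measurable_invr R) measurable_sinr).
Qed.

Let measurable_sin2V : measurable_fun setT (fun t : R => (sin t ^+ 2)^-1).
Proof.
apply: (measurableT_comp (@measurable_invr R)); exact: (measurable_funX _ measurable_sinr).
Qed.

Lemma measurable_psi2 : measurable_fun setT (@psi2 R).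
Proof.
apply: measurable_funM => //; apply: measurable_funD => //.
apply: measurable_funM; [exact: measurable_cosr|exact: measurable_psi1].
Qed.

Lemma measurable_psi3 : measurable_fun setT (@psi3 R).
Proof.
apply: measurable_funM => //; apply: measurable_funD; last exact: measurable_psi1.
apply: measurable_funM; last exact: measurable_psi2.
by apply: measurable_funM => //; exact: measurable_cosr.
Qed.

Lemma measurable_psi4 : measurable_fun setT (@psi4 R).
Proof.
apply: measurable_funM => //; apply: measurable_funD.
  apply: measurable_funM; last exact: measurable_psi3.
  by apply: measurable_funM => //; exact: measurable_cosr.
by apply: measurable_funM => //; exact: measurable_psi2.
Qed.

Let comp1 (h : R -> R) : measurable_fun setT h -> measurable_fun setT (fun z => h (acosr z.1)).
Proof.
move=> mh; apply: (measurableT_comp mh).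
exact: (measurableT_comp (@measurable_acosr R) measurable_fst).
Qed.
Let m1 := comp1 measurable_psi1.
Let m2 := comp1 measurable_psi2.
Let m3 := comp1 measurable_psi3.
Let m4 := comp1 measurable_psi4.
Let ma : measurable_fun setT (fun z => z.1). Proof. exact: measurable_fst. Qed.
Let mb : measurable_fun setT (fun z => z.2). Proof. exact: measurable_snd. Qed.
Let mbX n : measurable_fun setT (fun z => z.2 ^+ n).
Proof. exact: measurable_funX. Qed.
Let mc (c : R) : measurable_fun setT (fun _ : R * R => c).
Proof. exact: measurable_cst. Qed.

Lemma measurable_tay1 : measurable_fun setT tay1.
Proof. exact: measurable_funM. Qed.

Lemma measurable_tay2 : measurable_fun setT tay2.
Proof. by apply: measurable_funB; apply: measurable_funM. Qed.

Lemma measurable_tay3 : measurable_fun setT tay3.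
Proof.
apply: measurable_funB; last exact: measurable_funM.
apply: measurable_funB; first exact: measurable_funM.
by apply: measurable_funM => //; apply: measurable_funM => //; exact: measurable_funM.
Qed.

Lemma measurable_tay4 : measurable_fun setT tay4.
Proof.
apply: measurable_funD; last exact: measurable_funM.
apply: measurable_funD.
  apply: measurable_funB; first exact: measurable_funM.
  by apply: measurable_funM => //; apply: measurable_funM => //; exact: measurable_funM.
apply: measurable_funM => //; apply: measurable_funB; apply: measurable_funM => //.
exact: measurable_funX.
Qed.

Lemma measurable_half_sqdist x : measurable_fun setT (half_sqdist x).
Proof.
apply: measurable_funM => //; apply: measurable_funX.
apply: (measurableT_comp (@measurable_acosr R)).
by apply: measurable_funD; apply: measurable_funM.
Qed.

End taylor_coefficients.

(** * Integrability near the antipode *)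

Section density_near_antipode.
Context (R : realType) (k : nat).

Lemma polar_sphere (p w : 'rV[R]_k.+1) t : sphere R k p -> sphere R k w -> dotp p w = 0 ->
  sphere R k (cos t *: p + sin t *: w).
Proof.
move=> /sphereE p1 /sphereE w1 pw; apply/sphereE.
rewrite !(dotpDl, dotpDr) !(dotpZl, dotpZr) p1 w1 [dotp w p]dotpC pw.
by rewrite -[RHS](cos2Dsin2 t); ring.
Qed.

Lemma dotp_polar (p w y : 'rV[R]_k.+1) t :
  dotp (cos t *: p + sin t *: w) y = dotp p y * cos t + dotp w y * sin t.
Proof. by rewrite dotpDl !dotpZl ![_ * cos t]mulrC ![_ * sin t]mulrC. Qed.

Lemma sdist_polar (p w : 'rV[R]_k.+1) t : sphere R k p -> dotp p w = 0 ->
  0 <= t <= pi -> sdist p (cos t *: p + sin t *: w) = t.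
Proof.
move=> /sphereE p1 pw tI; rewrite /sdist dotpC dotp_polar p1 [dotp w p]dotpC pw.
by rewrite mul1r mul0r addr0 cosK.
Qed.

(** Follow one great circle from p: it is continuous at t = pi, where it reaches the antipode, and
    the value of the density at its point of parameter t is f(t). *)
Lemma bounded_near_antipode (p w : 'rV[R]_k.+1) (f : R -> R) :
  sphere R k p -> sphere R k w -> dotp p w = 0 ->
  (exists (U : set 'rV[R]_k.+1) (M : R), [/\ open U, cut_locus p `<=` U &
     forall q, sphere R k q -> U q -> f (sdist p q) <= M]) ->
  exists s M : R, [/\ 0 < s, 0 <= M & forall t, pi - s < t <= pi -> f t <= M].
Proof.
move=> p1 w1 pw [U [M [oU pU fM]]].
pose g (t : R) : 'rV[R]_k.+1 := cos t *: p + sin t *: w.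
have cg : {for pi, continuous g}.
  apply: (@continuousD _ _ _ (fun t : R => cos t *: p) (fun t : R => sin t *: w)).
    exact: (@cvgZr_tmp R 'rV[R]_k.+1 _ _ _ (@cos R) _ p (@continuous_cos R pi)).
  exact: (@cvgZr_tmp R 'rV[R]_k.+1 _ _ _ (@sin R) _ w (@continuous_sin R pi)).
have : nbhs (g pi) U.
  by apply: open_nbhs_nbhs; split => //; apply: pU; rewrite /g cospi sinpi scale0r addr0 scaleN1r.
move=> /cg [s /= s0 sU]; have pi0 := pi_gt0 R.
exists (Num.min s pi), (Num.max M 0); split; first by rewrite lt_min s0.
  by rewrite le_max lexx orbT.
move=> t /andP[t1 t2].
have tI : 0 <= t <= pi.
  rewrite t2 andbT; apply: ltW; apply: le_lt_trans t1.
  by rewrite subr_ge0 ge_min lexx orbT.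
rewrite -{1}(@sdist_polar p w t p1 pw tI) le_max fM//; first exact: polar_sphere.
apply: sU; rewrite /= ger0_norm ?subr_ge0//.
move: t1; rewrite ltrBlDr -ltrBlDl => /lt_le_trans; apply.
by rewrite ge_min lexx.
Qed.

End density_near_antipode.

Section fourth_order_expansion.
Context (R : realType) (k : nat).
Local Notation leb := (@lebesgue_measure R).
Local Notation d := k.+2.
Variables (mu : probability 'rV[R]_d.+1 R) (p : 'rV[R]_d.+1) (f : R -> R).
Hypothesis k2 : (2 <= k)%N.
Hypothesis p1 : sphere R d p.
Hypothesis f_meas : measurable_fun `[0, pi] f.
Hypothesis f_ge0 : forall t, 0 <= t <= pi -> 0 <= f t.
Hypothesis mu_density : forall A, measurable A ->
  mu A = (\int[svol R d]_(q in A `&` sphere R d) (f (sdist p q))%:E)%E.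
Hypothesis f_bnd :
  exists s M : R, [/\ 0 < s, 0 <= M & forall t, pi - s < t <= pi -> f t <= M].
Variable w : 'rV[R]_d.+1.
Hypotheses (w1 : sphere R d w) (pw : dotp p w = 0).

Let V := fine (svol R k setT) * sin_int R k.

Let V0 : 0 <= V.
Proof.
apply: mulr_ge0; first by rewrite fine_ge0.
apply: Rintegral_ge0 => s sI; exact/exprn_ge0/sin_ge0_itv.
Qed.

Let weight t := sin t ^+ k.+1 * f t * V.

Let weight0 t : 0 <= t <= pi -> 0 <= weight t.
Proof. move=> tI; apply: mulr_ge0 => //; apply: mulr_ge0; last exact: f_ge0.
exact/exprn_ge0/sin_ge0_pi. Qed.

Let weight_meas : measurable_fun `[0, pi] weight.
Proof.
apply: measurable_funM => //; apply: measurable_funM => //.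
by apply: measurable_funTS; exact: measurable_sinX.
Qed.

Let zonal_integralE (h : R -> R) : measurable_fun setT h ->
  (\int[mu]_x (h (dotp p x))%:E =
   \int[leb]_(t in `[0%R, pi]) (weight t * h (cos t))%:E)%E.
Proof. exact: (zonal_integral p1 f_meas f_ge0 mu_density w1 pw). Qed.

Definition antipodal (x : 'rV[R]_d.+1) : R := (pi - acosr (dotp p x))^-1 ^+ 3.

Let h3 (c : R) : R := (pi - acosr c)^-1 ^+ 3.

Let h3_meas : measurable_fun setT h3.
Proof.
apply: measurable_funX; apply: (measurableT_comp (@measurable_invr R)).
by apply: measurable_funB => //; exact: measurable_acosr.
Qed.

Let h3_ge0 c : 0 <= h3 c.
Proof. by rewrite exprn_ge0// invr_ge0 subr_ge0; have /andP[] := acosr_itv c. Qed.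

Lemma antipodal_ge0 x : 0 <= antipodal x.
Proof. exact: h3_ge0. Qed.

Lemma measurable_antipodal : measurable_fun setT antipodal.
Proof. by apply: (measurableT_comp h3_meas); exact: measurable_dotp. Qed.

(* The Jacobian sin^(d-1) absorbs the singularity at the antipode as d >= 4. *)
Lemma integrable_antipodal : mu.-integrable setT (EFin \o antipodal).
Proof.
apply/integrableP; split; first by apply/measurable_EFinP; exact: measurable_antipodal.
under eq_integral do rewrite /= ger0_norm ?antipodal_ge0//.
rewrite (zonal_integralE h3_meas).
have [s [M [s0 M0 fM]]] := f_bnd.
have s3 : 0 <= s^-1 ^+ 3 by rewrite exprn_ge0// invr_ge0 ltW.
(* The first term dominates at distance at least s from the antipode. The second does so nearer,
   where f <= M and sin(t)^(k+1) <= (pi - t)^3, as k + 1 >= 3. *)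
pose B t := s^-1 ^+ 3 * weight t + M * V.
have B0 t : 0 <= t <= pi -> 0 <= B t.
  by move=> tI; apply: addr_ge0; apply: mulr_ge0 => //; exact: weight0.
apply: (@le_lt_trans _ _ (\int[leb]_(t in `[0%R, pi]) (B t)%:E)%E).
  apply: ge0_le_integral => //.
  - by move=> t /=; rewrite in_itv/= => tI; rewrite lee_fin; apply: mulr_ge0 => //; exact: weight0.
  - apply/measurable_EFinP; apply: measurable_funM => //; apply: measurable_funTS.
    exact: (measurableT_comp h3_meas (@measurable_cosr R)).
  - apply/measurable_EFinP.
    by apply: (@measurable_funD _ _ _ _ (fun t => s^-1 ^+ 3 * weight t) (cst (M * V))) => //;
      exact: measurable_funM.
  move=> t /=; rewrite in_itv/= => tI; rewrite lee_fin /h3 acosr_cos//.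
  have /andP[t0 tpi] := tI.
  have st := sin_ge0_pi tI; have sl := sin_le1 t.
  have [ts|ts] := ltP (pi - s) t; last first.
    rewrite -[leLHS]addr0; apply: lerD; last exact: mulr_ge0.
    rewrite mulrC; apply: ler_wpM2r; first exact: weight0.
    rewrite lerXn2r ?nnegrE ?invr_ge0 ?subr_ge0 ?(ltW s0)//.
    by rewrite lef_pV2 ?posrE//; lra.
  rewrite -[leLHS]add0r; apply: lerD; first by apply: mulr_ge0 => //; exact: weight0.
  have -> : weight t * (pi - t)^-1 ^+ 3 = (sin t ^+ k.+1 * (pi - t)^-1 ^+ 3) * f t * V.
    by rewrite /weight; ring.
  rewrite ler_wpM2r// -[leRHS]mul1r; apply: ler_pM.
  - by rewrite mulr_ge0 ?exprn_ge0// invr_ge0 subr_ge0.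
  - exact: f_ge0.
  (* At t = pi the inverse of 0 is 0, so the product vanishes there. *)
  - have [->|tp] := eqVneq t pi; first by rewrite subrr invr0 expr0n mulr0.
    have r0 : 0 < pi - t by rewrite subr_gt0 lt_neqAle tp.
    rewrite exprVn ler_pdivrMr ?exprn_gt0// mul1r (@le_trans _ _ (sin t ^+ 3))//.
      by rewrite ler_wiXn2l// ltnS.
    rewrite lerXn2r ?nnegrE ?(ltW r0)//.
    have -> : sin t = sin (pi - t) by rewrite sinB sinpi cospi; ring.
    exact/sin_le_id/ltW.
  - by apply: fM; rewrite ts.
have W1 : (\int[leb]_(t in `[0%R, pi]) (weight t)%:E = 1)%E.
  have := zonal_integralE (@measurable_cst _ _ _ _ setT (1 : R)).
  have -> : (\int[mu]_x (cst (1 : R) (dotp p x))%:E = 1)%E.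
    rewrite (eq_integral (cst 1%E))// integral_cst// mul1e.
    exact: probability_setT.
  by move=> ->; apply: eq_integral => t _; rewrite /= mulr1.
have mI : measurable (`[0, pi]%classic : set (measurableTypeR R)) by [].
have w0 t : `[0, pi]%classic t -> (0 <= (weight t)%:E)%E.
  by move=> /=; rewrite in_itv/= lee_fin; exact: weight0.
have mw : measurable_fun `[0, pi] (fun t => (weight t)%:E) by exact/measurable_EFinP.
have -> : (\int[leb]_(t in `[0%R, pi]) (B t)%:E =
    \int[leb]_(t in `[0%R, pi]) ((s^-1 ^+ 3)%:E * (weight t)%:E) +
    \int[leb]_(t in `[0%R, pi]) (cst (M * V)%:E t))%E.
  under [LHS]eq_integral do rewrite EFinD EFinM.
  apply: ge0_integralD => //.
  - by move=> t /w0 wt; rewrite mule_ge0.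
  - exact: emeasurable_funM.
  - by move=> t _; rewrite lee_fin mulr_ge0.
have -> : (\int[leb]_(t in `[0%R, pi]) ((s^-1 ^+ 3)%:E * (weight t)%:E) = (s^-1 ^+ 3)%:E)%E.
  by apply: (etrans (ge0_integralZl_EFin _ _ _ _ s3)) => //; rewrite W1 mule1.
rewrite integral_cst//=.
by rewrite lebesgue_measure_itv/= lte_fin pi_gt0 -EFinD ltry.
Qed.

(** The bound is asked only off the great circle through p and w: that is where the Taylor
    coefficients are controlled, and the rest is null by [zonal_ball]. *)
Lemma zonal_integrable (g : R * R -> R) C : measurable_fun setT g ->
  (forall a b, a ^+ 2 + b ^+ 2 < 1 -> `|g (a, b)| <= C * (pi - acosr a)^-1 ^+ 3) ->
  mu.-integrable setT (fun x => (g (dotp p x, dotp w x))%:E).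
Proof.
move=> mg gC; set N := [set x | 1 <= dotp p x ^+ 2 + dotp w x ^+ 2].
have mpw : measurable_fun setT (fun x : 'rV[R]_d.+1 => (dotp p x, dotp w x)).
  by apply/measurable_fun_pairP; split; exact: measurable_dotp.
have mN : measurable N.
  rewrite -[X in measurable X]setTI; apply: measurable_fun_ler => //.
  by apply: measurable_funD; apply: measurable_funX; exact: measurable_dotp.
have N0 : mu N = 0%E.
  exact: (zonal_ball p1 f_meas f_ge0 mu_density w1 pw (ltnW k2)).
have mG : measurable_fun setT (fun x => (g (dotp p x, dotp w x))%:E).
  apply/measurable_EFinP; exact: (measurableT_comp mg mpw).
apply/(negligible_integrable mN measurableT mG N0).
have mNC : measurable (setT `\` N) by exact: measurableD.
apply: (le_integrable mNC (g := fun x => (C * antipodal x)%:E)).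
- exact: measurable_funTS.
- move=> x [_ /= /negP]; rewrite -ltNge => xN; rewrite lee_fin.
  exact: (le_trans (gC _ _ xN) (ler_norm _)).
- apply: (@integrableS _ _ _ _ setT) => //.
  exact: (integrableZl measurableT C integrable_antipodal).
Qed.

End fourth_order_expansion.

Section sphere_total_volume.
Context (R : realType).

Lemma svol_sphereT k : svol R k (sphere R k) = svol R k setT.
Proof.
have mS := @measurable_sphere R k.
have := @measureU _ _ _ (svol R k) (sphere R k) (~` sphere R k) mS (measurableC mS) (setICr _).
rewrite setUCr => E; apply/esym/(etrans E).
by rewrite -[RHS]adde0; congr (_ + _)%E; exact: svol_sphereC.
Qed.

End sphere_total_volume.

Section moments_of_taylor_coefficients.
Context (R : realType) (k : nat).
Local Notation leb := (@lebesgue_measure R).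
Local Notation d := k.+2.
Variables (mu : probability 'rV[R]_d.+1 R) (p : 'rV[R]_d.+1) (f : R -> R).
Hypothesis k2 : (2 <= k)%N.
Hypothesis p1 : sphere R d p.
Hypothesis f_meas : measurable_fun `[0, pi] f.
Hypothesis f_ge0 : forall t, 0 <= t <= pi -> 0 <= f t.
Hypothesis mu_density : forall A, measurable A ->
  mu A = (\int[svol R d]_(q in A `&` sphere R d) (f (sdist p q))%:E)%E.
Hypothesis f_bnd :
  exists s M : R, [/\ 0 < s, 0 <= M & forall t, pi - s < t <= pi -> f t <= M].
Variable w : 'rV[R]_d.+1.
Hypotheses (w1 : sphere R d w) (pw : dotp p w = 0).

Let V := fine (svol R k setT) * sin_int R k.

Let weight t := sin t ^+ k.+1 * f t * V.

Let zonal_integralE (h : R -> R) : measurable_fun setT h ->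
  (\int[mu]_x (h (dotp p x))%:E =
   \int[leb]_(t in `[0%R, pi]) (weight t * h (cos t))%:E)%E.
Proof. exact: (zonal_integral p1 f_meas f_ge0 mu_density w1 pw). Qed.

Let integrableE (g : R * R -> R) C : measurable_fun setT g ->
  (forall a b, a ^+ 2 + b ^+ 2 < 1 -> `|g (a, b)| <= C * (pi - acosr a)^-1 ^+ 3) ->
  mu.-integrable setT (fun x => (g (dotp p x, dotp w x))%:E).
Proof. exact: (zonal_integrable k2 p1 f_meas f_ge0 mu_density f_bnd w1 pw). Qed.

(** If this constant vanished, the zonal formula would give the probability [mu] total mass 0. *)
Lemma zonal_volume_neq0 : fine (svol R k setT) * sin_int R k != 0.
Proof.
apply/negP => /eqP V0; have := zonal_integralE (@measurable_cst _ _ _ _ setT (1 : R)).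
have -> : (\int[mu]_x (cst (1 : R) (dotp p x))%:E = 1)%E.
  rewrite (eq_integral (cst 1%E))// integral_cst// mul1e.
  exact: probability_setT.
rewrite integral0_eq; last by move=> t _; rewrite /weight /V V0 mulr0 mul0r.
by move=> [] /eqP; rewrite oner_eq0.
Qed.

(** alpha_d contains the constant [V] as V(S^(d-1)). For beta_d it is factored as V(S^(d-2))
    a_(d-2), in [sphere_volumeE], because a_d is a multiple of a_(d-2). *)
Lemma sphere_volumeS : sphere_volume R k.+1 = V.
Proof.
have S0 : 0 <= sin_int R k.
  by apply: Rintegral_ge0 => s sI; exact/exprn_ge0/sin_ge0_itv.
rewrite /sphere_volume svol_sphereT svolS/=.
rewrite /V -[X in _ = fine _ * X]/(fine (sin_int R k)%:E) -fineM ?fin_num_measure//.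
congr fine; rewrite -(sin_moment0 R k) -sin_momentE -ge0_integralZl//.
- by apply: eq_integral => s _; rewrite preimage_setT muln0 mulr1 muleC.
- exact: (integrableP _ _ _ (sin_moment_integrable R k 0)).1.
- by move=> s /sin_ge0_itv s0; rewrite lee_fin mulr_ge0// exprn_ge0.
Qed.

Lemma sphere_volumeE : sphere_volume R k * sin_int R k = V.
Proof. by rewrite /V /sphere_volume svol_sphereT. Qed.

(** F stands for a derivative known only through the pointwise identity with H. Dividing this
    identity by c transfers measurability and integrability from H to f F. The identity is asked on
    the open interval, since it involves division by sin t. *)
Lemma zonal_density_integral (H F : R -> R) c : measurable_fun setT H -> c != 0 ->
  mu.-integrable setT (fun x => (H (dotp p x))%:E) ->
  (forall t, 0 < t < pi -> weight t * H (cos t) = c * (f t * F t)) ->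
  \int[mu]_x H (dotp p x) = c * \int[leb]_(t in `[0, pi]) (f t * F t).
Proof.
move=> mH c0 iH HF.
have mHc : measurable_fun setT (fun t : R => H (cos t)).
  exact: (measurableT_comp mH (@measurable_cosr R)).
have mW : measurable_fun `]0, pi[ weight.
  apply: measurable_funM => //; apply: measurable_funM.
    by apply: measurable_funTS; exact: measurable_sinX.
  apply: measurable_funS f_meas => //; exact: subset_itv_oo_cc.
have mWH : measurable_fun `]0, pi[ (fun t => weight t * H (cos t)).
  by apply: measurable_funM => //; exact: measurable_funTS.
have HF' t : t \in `]0, pi[ -> f t * F t = c^-1 * (weight t * H (cos t)).
  by rewrite in_itv/= => tI; rewrite HF// mulKf.
have mF : measurable_fun `]0, pi[ (fun t => f t * F t).
  apply: (eq_measurable_fun (fun t => c^-1 * (weight t * H (cos t)))).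
    by move=> t; rewrite inE/= => /HF' ->.
  by apply: measurable_funM.
have iW : leb.-integrable `]0, pi[ (EFin \o (fun t => weight t * H (cos t))).
  apply/integrableP; split; first exact/measurable_EFinP.
  move/integrableP: iH => [_]; apply: le_lt_trans.
  have mA : measurable_fun setT (fun c => `|H c|) by exact: measurableT_comp.
  rewrite [leRHS](zonal_integralE mA).
  have -> : (\int[leb]_(t in `[0%R, pi]) (weight t * `|H (cos t)|)%:E =
             \int[leb]_(t in `]0%R, pi[) (weight t * `|H (cos t)|)%:E)%E.
    apply: integral_itv_bndoo; apply/measurable_EFinP; apply: measurable_funM => //.
    by apply: measurable_funTS; exact: measurableT_comp.
  rewrite le_eqVlt; apply/orP; left; apply/eqP; apply: eq_integral => t /[!inE]/=.
  rewrite in_itv/= => /andP[t0 t1]; rewrite normrM ger0_norm// /weight.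
  have tI : 0 <= t <= pi by rewrite !ltW.
  apply: mulr_ge0; first by apply: mulr_ge0; [exact/exprn_ge0/sin_ge0_pi|exact: f_ge0].
  apply: mulr_ge0; first by rewrite fine_ge0.
  by apply: Rintegral_ge0 => s sI; exact/exprn_ge0/sin_ge0_itv.
have pE : \int[mu]_x H (dotp p x) = \int[leb]_(t in `]0, pi[) (weight t * H (cos t)).
  rewrite /Rintegral zonal_integralE//; congr fine.
  by apply: integral_itv_bndoo; exact/measurable_EFinP.
have fE : \int[leb]_(t in `[0, pi]) (f t * F t) = \int[leb]_(t in `]0, pi[) (f t * F t).
  by rewrite /Rintegral; congr fine; apply: integral_itv_bndoo; exact/measurable_EFinP.
rewrite pE fE.
have -> : \int[leb]_(t in `]0, pi[) (f t * F t) =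
    \int[leb]_(t in `]0, pi[) (c^-1 * (weight t * H (cos t))).
  by apply: eq_Rintegral => t; rewrite inE/= => /HF'.
by rewrite RintegralZl// mulVKf.
Qed.

(** 1/d and 3/(d (d+2)) are the second and fourth moments of one coordinate of a uniform unit vector
    in R^d: given <p, x> = cos t, the rest of x is uniform on a sphere of radius sin t. *)
Lemma zonal_even_moment (h0 h1 h2 : R -> R) (C0 C1 C2 : R) :
  measurable_fun setT h0 -> measurable_fun setT h1 -> measurable_fun setT h2 ->
  (forall c, -1 < c < 1 -> `|h0 c| <= C0 * (pi - acosr c)^-1 ^+ 3) ->
  (forall c, -1 < c < 1 -> `|h1 c| * sin (acosr c) ^+ 2 <= C1 * (pi - acosr c)^-1 ^+ 3) ->
  (forall c, -1 < c < 1 -> `|h2 c| * sin (acosr c) ^+ 4 <= C2 * (pi - acosr c)^-1 ^+ 3) ->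
  let H c := h0 c + h1 c * (d%:R^-1 * sin (acosr c) ^+ 2) +
             h2 c * (3 / (d%:R * (d + 2)%:R) * sin (acosr c) ^+ 4) in
  mu.-integrable setT (fun x => (H (dotp p x))%:E) /\
  \int[mu]_x (h0 (dotp p x) + h1 (dotp p x) * dotp w x ^+ 2 + h2 (dotp p x) * dotp w x ^+ 4) =
  \int[mu]_x H (dotp p x).
Proof.
move=> m0 m1 m2 B0 B1 B2 H.
have aI (a b : R) : a ^+ 2 + b ^+ 2 < 1 -> -1 < a < 1.
  move=> ab1; rewrite -ltr_norml -(@ltr_pXn2r _ 2) ?nnegrE// expr1n real_normK ?num_real//.
  by have := sqr_ge0 b; lra.
have X2 n (x : R) : 0 <= x ^+ (2 * n) by rewrite exprM exprn_ge0// sqr_ge0.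
have K (h : R -> R) n c C : measurable_fun setT h -> 0 <= c <= 1 ->
    (forall c, -1 < c < 1 -> `|h c| * sin (acosr c) ^+ (2 * n) <= C * (pi - acosr c)^-1 ^+ 3) ->
    mu.-integrable setT (fun x => (h (dotp p x) * dotp w x ^+ (2 * n))%:E) /\
    mu.-integrable setT (fun x => (h (dotp p x) * (c * sin (acosr (dotp p x)) ^+ (2 * n)))%:E).
  move=> mh /andP[c0 c1] hC.
  have mh1 : measurable_fun setT (fun z : R * R => h z.1).
    exact: (measurableT_comp mh measurable_fst).
  split.
  - apply: (@integrableE (fun z => h z.1 * z.2 ^+ (2 * n)) C).
      by apply: measurable_funM => //; exact: (measurable_funX _ measurable_snd).
    move=> a b ab1; apply: le_trans (hC _ (aI _ _ ab1)).
    rewrite normrM (ger0_norm (X2 _ _)) ler_wpM2l// !exprM.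
    rewrite lerXn2r ?nnegrE ?sqr_ge0//.
    have /andP[a1 a2] := aI _ _ ab1.
    by rewrite sin_acosr_sqr ?(ltW a1) ?(ltW a2)//=; move: ab1; lra.
  - apply: (@integrableE (fun z => h z.1 * (c * sin (acosr z.1) ^+ (2 * n))) C).
      apply: measurable_funM => //; apply: measurable_funM => //; apply: measurable_funX.
      apply: (measurableT_comp (@measurable_sinr R)).
      exact: (measurableT_comp (@measurable_acosr R) measurable_fst).
    move=> a b ab1; apply: le_trans (hC _ (aI _ _ ab1)).
    rewrite normrM ler_wpM2l// normrM (ger0_norm c0) (ger0_norm (X2 _ _)).
    by rewrite -[leRHS]mul1r ler_wpM2r.
have d0 : d%:R != 0 :> R by [].
have dr : 0 <= (d%:R^-1 : R) <= 1 by rewrite invr_ge0 ler0n invf_le1// ler1n.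
have er : 0 <= (3 / (d%:R * (d + 2)%:R) : R) <= 1.
  rewrite divr_ge0//= ler_pdivrMr ?mul1r -?natrM ?ltr0n ?muln_gt0//.
  by rewrite (ler_nat R 3) (@leq_trans (d + 2)) ?leq_pmull// addn2.
have B0' c : -1 < c < 1 -> `|h0 c| * sin (acosr c) ^+ (2 * 0) <= C0 * (pi - acosr c)^-1 ^+ 3.
  by rewrite muln0 mulr1; exact: B0.
have [I0 _] := K h0 0%N 0 C0 m0 (ltac:(by rewrite lexx ler01)) B0'.
have {}I0 : mu.-integrable setT (fun x => (h0 (dotp p x))%:E).
  by apply: eq_integrable I0 => // x _; rewrite muln0 mulr1.
have [I1 J1] := K h1 1%N d%:R^-1 C1 m1 dr B1.
have [I2 J2] := K h2 2%N (3 / (d%:R * (d + 2)%:R)) C2 m2 er B2.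
have J01 := integrableD measurableT I0 J1.
have I01 := integrableD measurableT I0 I1.
have E1 := zonal_moment_reduce p1 f_meas f_ge0 mu_density w1 pw (j := 1) m1.
have E2 := zonal_moment_reduce p1 f_meas f_ge0 mu_density w1 pw (j := 2) m2.
split; first exact: (integrableD measurableT J01 J2).
apply: (etrans (RintegralD measurableT I01 I2)).
apply: (etrans _ (esym (RintegralD measurableT J01 J2))).
congr (_ + _).
  apply: (etrans (RintegralD measurableT I0 I1)).
  apply: (etrans _ (esym (RintegralD measurableT I0 J1))).
  congr (_ + _); congr fine; apply: E1; first by case/andP: dr.
  by apply: (mulfI d0); rewrite mulVKf// -sin_moment1 addn2.
congr fine; apply: E2; first by case/andP: er.
have e0 : d%:R * (d + 2)%:R != 0 :> R by rewrite mulf_neq0// pnatr_eq0 addn2.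
apply: (mulfI e0); rewrite [RHS]mulrA [_ * (3 / _)]mulrC divfK//.
by rewrite -sin_moment2 (addn2 k) addn4 addn2.
Qed.

End moments_of_taylor_coefficients.

Section psi_weighted.
Context (R : realType).

Lemma psi_weighted_bound : exists2 C : R, 0 < C & forall c, -1 < c < 1 ->
  [/\ `|psi1 (acosr c)| <= C * (pi - acosr c)^-1 ^+ 3,
      `|psi2 (acosr c)| <= C * (pi - acosr c)^-1 ^+ 3,
      `|psi3 (acosr c)| * sin (acosr c) ^+ 2 <= C * (pi - acosr c)^-1 ^+ 3 &
      `|psi4 (acosr c)| * sin (acosr c) ^+ 4 <= C * (pi - acosr c)^-1 ^+ 3].
Proof.
have [C C0 HC] := psi_bound R; exists (16 * C) => [|c /andP[c1 c2]]; first by rewrite mulr_gt0.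
have tI : 0 < acosr c < pi.
  apply: (@acosr_lt_pi _ c 0); rewrite expr0n addr0 -[ltRHS](expr1n _ 2).
  by rewrite expr1n expr2; nra.
have [P1 P2 P3 P4] := HC _ tI; move: P1 P2 P3 P4 tI; set t := acosr c => P1 P2 P3 P4 /andP[t0 tpi].
have := pi_le4 R => p4; set r := pi - t in P1 P2 P3 P4 *.
have r0 : 0 < r by rewrite subr_gt0.
have r4 : r <= 4 by rewrite /r; lra.
have rr : r ^+ 2 <= 16 by nra.
have s0 : 0 <= sin t by apply: sin_ge0_pi; rewrite !ltW.
have sr : sin t <= r.
  have -> : sin t = sin r by rewrite /r sinB sinpi cospi; ring.
  by apply: sin_le_id; exact: ltW.
have sX n : sin t ^+ n <= r ^+ n by rewrite lerXn2r ?nnegrE// ltW.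
rewrite ler_pdivlMr// in P1; rewrite ler_pdivlMr ?exprn_gt0// in P2.
rewrite ler_pdivlMr ?exprn_gt0// in P3; rewrite ler_pdivlMr ?exprn_gt0// in P4.
rewrite exprVn; split; rewrite ler_pdivlMr ?exprn_gt0//.
- have -> : `|psi1 t| * r ^+ 3 = r ^+ 2 * (`|psi1 t| * r) by ring.
  by apply: ler_pM; rewrite ?sqr_ge0 ?mulr_ge0// ltW.
- by apply: (le_trans P2); lra.
- rewrite -mulrA; apply: (@le_trans _ _ C); last by lra.
  apply: le_trans P3; rewrite ler_wpM2l//.
  by rewrite (exprD r 2 3) ler_wpM2r ?exprn_ge0// ltW.
- rewrite -mulrA; apply: (@le_trans _ _ C); last by lra.
  apply: le_trans P4; rewrite ler_wpM2l//.
  by rewrite (exprD r 4 3) ler_wpM2r ?exprn_ge0// ltW.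
Qed.

(* The two identities below are the pointwise content of the formulas for
   alpha_d and beta_d: their left sides are the means over directions. *)
Lemma alpha_identity (k : nat) (t K : R) : K = k%:R -> K + 2 != 0 -> sin t != 0 ->
  sin t ^+ k.+1 * (- (cos t * psi1 t) + psi2 t * ((K + 2)^-1 * sin t ^+ 2)) =
  (K + 2)^-1 * (sin t ^+ k.+1 + t * ((K + 1) * sin t ^+ k * cos t)).
Proof.
move=> -> K0 s0; rewrite /psi2 /psi1 exprS; move: (sin t ^+ k) k%:R K0 => A K' K0.
by field; rewrite K0 s0.
Qed.

Lemma beta_identity (m : nat) (t K : R) : K = m%:R -> K + 4 != 0 -> K + 6 != 0 -> sin t != 0 ->
  sin t ^+ m.+3 * (3 * cos t ^+ 2 * psi2 t + cos t * psi1 t +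
     (- 6 * cos t * psi3 t - 4 * psi2 t) * ((K + 4)^-1 * sin t ^+ 2) +
     psi4 t * (3 / ((K + 4) * (K + 6)) * sin t ^+ 4)) =
  (K + 3) / ((K + 4) * (K + 6)) *
  ((K + 1) * sin t ^+ m * cos t * (2 * t * sin t ^+ 2 + 3 * cos t * sin t - 3 * t) +
   sin t ^+ m.+1 * (2 * sin t ^+ 2 + 4 * t * sin t * cos t +
      3 * cos t ^+ 2 - 3 * sin t ^+ 2 - 3)).
Proof.
move=> -> K4 K6 s0; rewrite /psi4 /psi3 /psi2 /psi1 !(exprS _ m.+2) !(exprS _ m.+1) !(exprS _ m).
have c2 := cos2sin2 t; move: (sin t ^+ m) m%:R K4 K6 s0 c2 => A K'.
move: (sin t) (cos t) => s c K4 K6 s0 c2.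
have {}c2 : c ^+ 2 = 1 - s ^+ 2 by rewrite c2.
field: c2.
by rewrite K4 K6 s0.
Qed.

End psi_weighted.

(** * Means of the four Taylor coefficients *)

Section fourth_order_expansion.
Context (R : realType) (k : nat).
Local Notation leb := (@lebesgue_measure R).
Local Notation d := k.+2.
Variables (mu : probability 'rV[R]_d.+1 R) (p : 'rV[R]_d.+1) (f : R -> R).
Hypothesis k2 : (2 <= k)%N.
Hypothesis p1 : sphere R d p.
Hypothesis f_meas : measurable_fun `[0, pi] f.
Hypothesis f_ge0 : forall t, 0 <= t <= pi -> 0 <= f t.
Hypothesis mu_density : forall A, measurable A ->
  mu A = (\int[svol R d]_(q in A `&` sphere R d) (f (sdist p q))%:E)%E.
Hypothesis f_bnd :
  exists s M : R, [/\ 0 < s, 0 <= M & forall t, pi - s < t <= pi -> f t <= M].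
Variable w : 'rV[R]_d.+1.
Hypotheses (w1 : sphere R d w) (pw : dotp p w = 0).

Let zmean (g : R * R -> R) : R := \int[mu]_x g (dotp p x, dotp w x).

Let zint (g : R * R -> R) : Prop :=
  mu.-integrable setT (fun x => (g (dotp p x, dotp w x))%:E).

Let zintP (g : R * R -> R) C : measurable_fun setT g ->
  (forall a b, a ^+ 2 + b ^+ 2 < 1 -> `|g (a, b)| <= C * (pi - acosr a)^-1 ^+ 3) -> zint g.
Proof. exact: (zonal_integrable k2 p1 f_meas f_ge0 mu_density f_bnd w1 pw). Qed.

Let V := fine (svol R k setT) * sin_int R k.

Let V_neq0 : V != 0.
Proof. exact: (zonal_volume_neq0 p1 f_meas f_ge0 mu_density w1 pw). Qed.

Let even_moment := zonal_even_moment k2 p1 f_meas f_ge0 mu_density f_bnd w1 pw.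

Let density_integral := zonal_density_integral p1 f_meas f_ge0 mu_density w1 pw.

Let mcomp (h : R -> R) : measurable_fun setT h -> measurable_fun setT (fun c => h (acosr c)).
Proof. by move=> mh; exact: (measurableT_comp mh (@measurable_acosr R)). Qed.

Let mp1 := mcomp (@measurable_psi1 R).
Let mp2 := mcomp (@measurable_psi2 R).
Let mp3 := mcomp (@measurable_psi3 R).
Let mp4 := mcomp (@measurable_psi4 R).
Let mid : measurable_fun setT (fun c : R => c). Proof. exact: measurable_id. Qed.

Let mH3 (h0 h1 h2 : R -> R) c1 c2 : measurable_fun setT h0 -> measurable_fun setT h1 ->
  measurable_fun setT h2 -> measurable_fun setT (fun c => h0 c +
    h1 c * (c1 * sin (acosr c) ^+ 2) + h2 c * (c2 * sin (acosr c) ^+ 4)).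
Proof.
move=> m0 m1 m2; have ms := mcomp (@measurable_sinr R).
have mc (c : R) n : measurable_fun setT (fun x : R => c * sin (acosr x) ^+ n).
  by apply: measurable_funM => //; exact: measurable_funX.
by apply: measurable_funD; [apply: measurable_funD => //|]; exact: measurable_funM.
Qed.

Lemma mean_tay2 : zmean (@tay2 R) = alpha d f.
Proof.
have [C C0 HC] := psi_weighted_bound R.
have m0 : measurable_fun setT (fun c : R => - (c * psi1 (acosr c))).
  by apply: measurable_funN; exact: measurable_funM.
have B0 c : -1 < c < 1 -> `|- (c * psi1 (acosr c))| <= C * (pi - acosr c)^-1 ^+ 3.
  move=> cI; have [H _ _ _] := HC c cI; apply: le_trans H.
  rewrite normrN normrM -[leRHS]mul1r ler_wpM2r//.
  by have /andP[? ?] := cI; rewrite ler_norml !ltW.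
have B1 c : -1 < c < 1 -> `|psi2 (acosr c)| * sin (acosr c) ^+ 2 <= C * (pi - acosr c)^-1 ^+ 3.
  move=> cI; have [_ H _ _] := HC c cI; apply: le_trans H.
  by rewrite -[leRHS]mulr1 ler_wpM2l// sin2cos2 lerBlDr lerDl sqr_ge0.
have B2 c : -1 < c < 1 -> `|cst (0 : R) c| * sin (acosr c) ^+ 4 <= 0 * (pi - acosr c)^-1 ^+ 3.
  by move=> _; rewrite /= normr0 !mul0r.
have [iH E] := even_moment m0 mp2 (@measurable_cst _ _ _ _ setT (0 : R)) B0 B1 B2.
transitivity (\int[mu]_x (- (dotp p x * psi1 (acosr (dotp p x))) +
   psi2 (acosr (dotp p x)) * dotp w x ^+ 2 + cst (0:R) (dotp p x) * dotp w x ^+ 4)).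
  by apply: eq_Rintegral => x _; rewrite /tay2/=; ring.
have kD : d%:R = k%:R + 2 :> R by rewrite -natrD addn2.
have d0 : d%:R != 0 :> R by [].
pose H (c : R) : R := - (c * psi1 (acosr c)) + psi2 (acosr c) * (d%:R^-1 * sin (acosr c) ^+ 2) +
  cst (0 : R) c * (3 / (d%:R * (d + 2)%:R) * sin (acosr c) ^+ 4).
have mH : measurable_fun setT H.
  exact: mH3.
have c0 : V / d%:R != 0 by rewrite mulf_neq0// invr_eq0.
have HF t : 0 < t < pi -> sin t ^+ k.+1 * f t * V * H (cos t) =
    V / d%:R * (f t * (fun x => x * sin x ^+ k.+1)^`()%classic t).
  move=> /andP[t0 t1]; have s0 : sin t != 0 by rewrite gt_eqF// sin_gt0_pi// t0.
  have D : is_derive t 1 (fun x => x * sin x ^+ k.+1)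
      (sin t ^+ k.+1 + t * ((k%:R + 1) * sin t ^+ k * cos t)).
    by der; rewrite /= -natr1; ring.
  have [_ DE] := D; rewrite derive1E DE /H/= acosr_cos ?ltW ?t0// mul0r addr0 kD.
  have kD0 : k%:R + 2 != 0 :> R by rewrite -kD.
  have A := alpha_identity erefl kD0 s0.
  have -> x : sin t ^+ k.+1 * f t * V * x = (sin t ^+ k.+1 * x) * (f t * V) by ring.
  by rewrite A; ring.
apply: (etrans E (etrans (density_integral mH c0 iH HF) _)).
by rewrite /alpha/= sphere_volumeS.
Qed.

Lemma mean_tay4 : zmean (@tay4 R) = beta d f.
Proof.
(* Then d = m + 4, and the exponent d - 3 of the definition of beta_d becomes m + 1, free of
   truncated subtraction. *)
have [m km] : exists m, k = m.+2 by exists k.-2; case: k k2 => [|[]].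
have [C C0 HC] := psi_weighted_bound R.
have m0 : measurable_fun setT (fun c : R => 3 * c ^+ 2 * psi2 (acosr c) + c * psi1 (acosr c)).
  by apply: measurable_funD; apply: measurable_funM => //; apply: measurable_funM => //;
    exact: measurable_funX.
have m1 : measurable_fun setT (fun c : R => - 6 * c * psi3 (acosr c) - 4 * psi2 (acosr c)).
  by apply: measurable_funB; apply: measurable_funM => //; exact: measurable_funM.
have B0 c : -1 < c < 1 -> `|3 * c ^+ 2 * psi2 (acosr c) + c * psi1 (acosr c)| <=
    (4 * C) * (pi - acosr c)^-1 ^+ 3.
  move=> cI; have [H1 H2 _ _] := HC c cI; have {}cI : `|c| <= 1.
    by have /andP[? ?] := cI; rewrite ler_norml !ltW.
  have c2 : `|c| ^+ 2 <= 1 by rewrite exprn_ile1.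
  rewrite (le_trans (ler_normD _ _))// (normrM (3 * c ^+ 2)) (normrM 3) normrX (normrM c) (@ger0_norm _ 3)//.
  move: (`|c| ^+ 2) (normr_ge0 c) (exprn_ge0 2 (normr_ge0 c)) c2 cI H1 H2.
  move: `|c| `|psi1 _| `|psi2 _| (normr_ge0 (psi1 (acosr c))) (normr_ge0 (psi2 (acosr c))).
  move: (_^-1 ^+ 3) => *; nra.
have B1 c : -1 < c < 1 -> `|- 6 * c * psi3 (acosr c) - 4 * psi2 (acosr c)| * sin (acosr c) ^+ 2
    <= (10 * C) * (pi - acosr c)^-1 ^+ 3.
  move=> cI; have [_ H2 H3 _] := HC c cI; have {}cI : `|c| <= 1.
    by have /andP[? ?] := cI; rewrite ler_norml !ltW.
  have s1 : sin (acosr c) ^+ 2 <= 1 by rewrite sin2cos2 lerBlDr lerDl sqr_ge0.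
  have s0 := sqr_ge0 (sin (acosr c)).
  have N : `|- 6 * c * psi3 (acosr c) - 4 * psi2 (acosr c)| <=
      6 * `|psi3 (acosr c)| + 4 * `|psi2 (acosr c)|.
    rewrite (le_trans (ler_normB _ _))// !normrM normrN (@ger0_norm _ 6)// (@ger0_norm _ 4)//.
    by rewrite lerD2r ler_wpM2r// -[leRHS]mulr1 ler_wpM2l.
  apply: (le_trans (ler_wpM2r s0 N)); rewrite mulrDl.
  have : `|psi2 (acosr c)| * sin (acosr c) ^+ 2 <= `|psi2 (acosr c)|.
    by rewrite -[leRHS]mulr1 ler_wpM2l.
  by move: H2 H3; lra.
have B2 c : -1 < c < 1 -> `|psi4 (acosr c)| * sin (acosr c) ^+ 4 <= C * (pi - acosr c)^-1 ^+ 3.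
  by move=> cI; have [] := HC c cI.
have [iH E] := even_moment m0 m1 mp4 B0 B1 B2.
transitivity (\int[mu]_x ((3 * dotp p x ^+ 2 * psi2 (acosr (dotp p x)) + dotp p x * psi1 (acosr (dotp p x))) +
   (- 6 * dotp p x * psi3 (acosr (dotp p x)) - 4 * psi2 (acosr (dotp p x))) * dotp w x ^+ 2 +
   psi4 (acosr (dotp p x)) * dotp w x ^+ 4)).
  by apply: eq_Rintegral => x _; rewrite /tay4/=; ring.
have kD : k%:R = m%:R + 2 :> R by rewrite km -[m.+2]addn2 natrD.
have d4 : d%:R = m%:R + 4 :> R by rewrite -natrD addn4 km.
have d6 : (d + 2)%:R = m%:R + 6 :> R by rewrite natrD d4; ring.
have d40 : m%:R + 4 != 0 :> R by rewrite -d4.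
have d60 : m%:R + 6 != 0 :> R by rewrite -natrD pnatr_eq0 addnC.
have k10 : m%:R + 3 != 0 :> R by rewrite -natrD pnatr_eq0 addnC.
pose H (c : R) : R := 3 * c ^+ 2 * psi2 (acosr c) + c * psi1 (acosr c) +
  (- 6 * c * psi3 (acosr c) - 4 * psi2 (acosr c)) * (d%:R^-1 * sin (acosr c) ^+ 2) +
  psi4 (acosr c) * (3 / (d%:R * (d + 2)%:R) * sin (acosr c) ^+ 4).
have mH : measurable_fun setT H by exact: (mH3 _ _ m0 m1 mp4).
have c0 : V * ((m%:R + 3) / ((m%:R + 4) * (m%:R + 6))) != 0.
  by rewrite mulf_neq0// mulf_neq0// invr_eq0 mulf_neq0.
pose G (x : R) := sin x ^+ (d - 3) * (2 * x * sin x ^+ 2 + 3 * cos x * sin x - 3 * x).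
have HF t : 0 < t < pi -> sin t ^+ k.+1 * f t * V * H (cos t) =
    V * ((m%:R + 3) / ((m%:R + 4) * (m%:R + 6))) * (f t * G^`()%classic t).
  move=> /andP[t0 t1]; have s0 : sin t != 0 by rewrite gt_eqF// sin_gt0_pi// t0.
  have D : is_derive t 1 G
      ((m%:R + 1) * sin t ^+ m * cos t * (2 * t * sin t ^+ 2 + 3 * cos t * sin t - 3 * t) +
       sin t ^+ m.+1 * (2 * sin t ^+ 2 + 4 * t * sin t * cos t +
       3 * cos t ^+ 2 - 3 * sin t ^+ 2 - 3)).
    have -> : G = fun x => sin x ^+ m.+1 * (2 * x * sin x ^+ 2 + 3 * cos x * sin x - 3 * x).
      by rewrite /G km.
    by der; rewrite /= -natr1 !expr1; ring.
  have [_ DE] := D; rewrite derive1E DE /H/= acosr_cos ?ltW ?t0// d4 d6.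
  have := beta_identity erefl d40 d60 s0; rewrite km => B.
  have -> x : sin t ^+ m.+3 * f t * V * x = (sin t ^+ m.+3 * x) * (f t * V) by ring.
  by rewrite B; ring.
apply: (etrans E (etrans (density_integral mH c0 iH HF) _)).
rewrite /beta -/G/=; congr (_ * _).
have K0 : (k + 2)%:R != 0 :> R by rewrite addn2.
(* a_d = (d-1)/d a_(d-2) turns the factor a_d / (d+2) of beta_d into the constant (m+3)/((m+4)(m+6))
   produced by the moments. *)
have -> : sin_int R d = (m%:R + 3) / (m%:R + 4) * sin_int R k.
  apply: (mulfI K0); rewrite sin_int_rec addn2 d4 natrD kD.
  by field.
rewrite d6 -[V](sphere_volumeE R k) -/V; field.
by rewrite d40 d60.
Qed.

(** The directions w and -w give the same mean by rotational symmetry, while g changes sign. *)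
Let odd_mean (g : R * R -> R) : measurable_fun setT g -> zint g ->
  (forall a b, g (a, - b) = - g (a, b)) -> zmean g = 0.
Proof.
move=> mg ig odd.
have Nw1 : sphere R d (- w).
  by apply/sphereE; rewrite dotpNl dotpNr opprK; exact/sphereE.
have Npw : dotp p (- w) = 0 by rewrite dotpNr pw oppr0.
have mG : measurable_fun setT (fun z => (g z)%:E) by exact/measurable_EFinP.
have := integral_zonal_eq p1 f_meas f_ge0 mu_density w1 pw Nw1 Npw mG.
move=> /(congr1 fine) E; have : zmean g = - zmean g.
  rewrite {1}/zmean /Rintegral E -mulN1r -RintegralZl//; congr fine.
  by apply: eq_integral => x _; rewrite dotpNl odd mulN1r.
lra.
Qed.

Lemma mean_tay1 : zmean (@tay1 R) = 0.
Proof.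
have [C C0 HC] := tay_bound R; apply: odd_mean.
- exact: measurable_tay1.
- by apply: (@zintP _ C); [exact: measurable_tay1|move=> a b /HC[]].
- by move=> a b; rewrite /tay1/= mulrN.
Qed.

Lemma mean_tay3 : zmean (@tay3 R) = 0.
Proof.
have [C C0 HC] := tay_bound R; apply: odd_mean.
- exact: measurable_tay3.
- by apply: (@zintP _ C); [exact: measurable_tay3|move=> a b /HC[]].
- by move=> a b; rewrite /tay3/=; ring.
Qed.

End fourth_order_expansion.

(** * Fourth-order expansion of the Frechet function *)

Section increments.
Context (R : realType).

(** What remains of the increment of half the squared distance once its linear part is removed. That
    part, x [tay1], equals - x <w, log_p y>; its empirical mean carries the Gaussian fluctuation. *)
Definition incr (x : R) (z : R * R) : R := half_sqdist x z - half_sqdist 0 z - x * tay1 z.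

Lemma measurable_incr x : measurable_fun setT (incr x).
Proof.
apply: measurable_funB; last by apply: measurable_funM => //; exact: measurable_tay1.
by apply: measurable_funB; exact: measurable_half_sqdist.
Qed.

Lemma half_sqdist_itv (x : R) z : 0 <= half_sqdist x z <= 8.
Proof.
have /andP[t0 tpi] := acosr_itv (z.1 * cos x + z.2 * sin x); have p4 := pi_le4 R.
rewrite /half_sqdist mulr_ge0 ?sqr_ge0//=; move: t0 tpi; set t := acosr _ => t0 tpi.
have : t ^+ 2 <= 4 ^+ 2 by rewrite lerXn2r ?nnegrE//; lra.
lra.
Qed.

Lemma antipodal_ge1 (a b : R) : a ^+ 2 + b ^+ 2 < 1 -> 1 <= 64 * (pi - acosr a)^-1 ^+ 3.
Proof.
move=> /acosr_lt_pi /andP[t0 tpi]; have p4 := pi_le4 R.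
rewrite exprVn ler_pdivlMr ?exprn_gt0 ?subr_gt0// mul1r.
have -> : 64 = 4 ^+ 3 :> R by ring.
by rewrite lerXn2r ?nnegrE//; lra.
Qed.

Lemma gdist_lip2 (a b x y : R) : a ^+ 2 + b ^+ 2 < 1 -> x <= y ->
  `|gdist a b y - gdist a b x| <= y - x.
Proof.
move=> ab1; rewrite le_eqVlt => /predU1P[<-|xy]; first by rewrite !subrr normr0.
have [z _ ->] := mvt_is_derive xy (fun z _ => is_derive_gdist ab1 z).
have yx : 0 < y - x by rewrite subr_gt0.
rewrite normrM (gtr0_norm yx) -[leRHS]mul1r ler_wpM2r ?(ltW yx)//.
rewrite normrM normrN normfV (gtr0_norm (sin_gdist_gt0 ab1 _)).
by rewrite ler_pdivrMr ?sin_gdist_gt0// mul1r gcos'_le_sin.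
Qed.

Lemma half_sqdist_lip (a b x y : R) : a ^+ 2 + b ^+ 2 < 1 -> x <= y ->
  `|half_sqdist y (a, b) - half_sqdist x (a, b)| <= 4 * (y - x).
Proof.
move=> ab1 xy; rewrite -!geo0_half_sqdist// /geo0.
have /andP[t0 t1] := gdist_itv ab1 x; have /andP[s0 s1] := gdist_itv ab1 y.
have := gdist_lip2 ab1 xy; set t := gdist a b x in t0 t1 *; set s := gdist a b y in s0 s1 *.
move=> ts; have -> : 2^-1 * s ^+ 2 - 2^-1 * t ^+ 2 = ((s + t) / 2) * (s - t) by field.
have p4 := pi_le4 R.
by rewrite normrM; apply: ler_pM => //; rewrite ger0_norm; lra.
Qed.

(** The quadratic bound, singular at the antipode, serves the second moment; the uniform one serves
    the exponential moments, where the tilt must be small against the range. *)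
Lemma incr_bound : exists2 C : R, 0 < C & forall a b x, a ^+ 2 + b ^+ 2 < 1 -> 0 <= x ->
  `|incr x (a, b)| <= C * x ^+ 2 * (pi - acosr a)^-1 /\ `|incr x (a, b)| <= 16 + 4 * x.
Proof.
have [C C0 HC] := geo_remainder2 R; exists C => // a b x ab1 x0; split.
  have := HC a b x ab1 x0; have [g t1 _ _ _] := tay_geo ab1.
  rewrite !geo0_half_sqdist// g t1; apply: le_trans.
  by rewrite /incr le_eqVlt; apply/orP; left; apply/eqP; congr `|_|; ring.
have /andP[h1 h2] := half_sqdist_itv x (a, b); have /andP[h3 h4] := half_sqdist_itv 0 (a, b).
have [_ t1 _ _ _] := tay_geo ab1.
have [D D0 HD] := geo_bound R; have [T _ _ _] := HD a b 0 ab1; rewrite t1 in T.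
rewrite /incr (le_trans (ler_normB _ _))//; apply: lerD.
  by rewrite ler_norml; apply/andP; split; lra.
rewrite normrM (ger0_norm x0) mulrC ler_wpM2r//; apply: (le_trans T); exact: pi_le4.
Qed.

End increments.

Section zonal_means.
Context (R : realType) (k : nat).
Local Notation leb := (@lebesgue_measure R).
Local Notation d := k.+2.
Variables (mu : probability 'rV[R]_d.+1 R) (p : 'rV[R]_d.+1) (f : R -> R).
Hypothesis k2 : (2 <= k)%N.
Hypothesis p1 : sphere R d p.
Hypothesis f_meas : measurable_fun `[0, pi] f.
Hypothesis f_ge0 : forall t, 0 <= t <= pi -> 0 <= f t.
Hypothesis mu_density : forall A, measurable A ->
  mu A = (\int[svol R d]_(q in A `&` sphere R d) (f (sdist p q))%:E)%E.
Hypothesis f_bnd :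
  exists s M : R, [/\ 0 < s, 0 <= M & forall t, pi - s < t <= pi -> f t <= M].

Definition zonal_mean (w : 'rV[R]_d.+1) (g : R * R -> R) : R :=
  \int[mu]_x g (dotp p x, dotp w x).

Lemma zonal_mean_eq w w' g : sphere R d w -> dotp p w = 0 -> sphere R d w' -> dotp p w' = 0 ->
  measurable_fun setT g -> zonal_mean w g = zonal_mean w' g.
Proof.
move=> w1 pw w'1 pw' mg; congr fine.
have mG : measurable_fun setT (fun z => (g z)%:E) by exact/measurable_EFinP.
exact: (integral_zonal_eq p1 f_meas f_ge0 mu_density w1 pw w'1 pw' mG).
Qed.

Variable w : 'rV[R]_d.+1.
Hypotheses (w1 : sphere R d w) (pw : dotp p w = 0).

Local Notation zmean := (zonal_mean w).

Let zint (g : R * R -> R) : Prop :=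
  mu.-integrable setT (fun x => (g (dotp p x, dotp w x))%:E).

Let zintP (g : R * R -> R) C : measurable_fun setT g ->
  (forall a b, a ^+ 2 + b ^+ 2 < 1 -> `|g (a, b)| <= C * (pi - acosr a)^-1 ^+ 3) -> zint g.
Proof. exact: (zonal_integrable k2 p1 f_meas f_ge0 mu_density f_bnd w1 pw). Qed.

Lemma ae_zonal_ball : {ae mu, forall x, dotp p x ^+ 2 + dotp w x ^+ 2 < 1}.
Proof.
exists [set x | 1 <= dotp p x ^+ 2 + dotp w x ^+ 2]; split.
- rewrite -[X in measurable X]setTI; apply: measurable_fun_ler => //.
  by apply: measurable_funD; apply: measurable_funX; exact: measurable_dotp.
- exact: (zonal_ball p1 f_meas f_ge0 mu_density w1 pw (ltnW k2)).
- by move=> x /= /negP; rewrite -leNgt.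
Qed.

Lemma measurable_zonal (g : R * R -> R) : measurable_fun setT g ->
  measurable_fun setT (fun x : 'rV[R]_d.+1 => g (dotp p x, dotp w x)).
Proof.
move=> mg; apply: (measurableT_comp mg).
by apply/measurable_fun_pairP; split; exact: measurable_dotp.
Qed.

Let zmeanB g h : zint g -> zint h -> zmean (fun z => g z - h z) = zmean g - zmean h.
Proof. by move=> ig ih; exact: (RintegralB measurableT ig ih). Qed.

Let zmeanZ g c : zint g -> zmean (fun z => c * g z) = c * zmean g.
Proof. by move=> ig; exact: (RintegralZl c measurableT ig). Qed.

Let zintB g h : zint g -> zint h -> zint (fun z => g z - h z).
Proof. by move=> ig ih; exact: (integrableB measurableT ig ih). Qed.

Let zintZ g c : zint g -> zint (fun z => c * g z).
Proof. by move=> ig; exact: (integrableZl measurableT c ig). Qed.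

Let zint_hs x : zint (half_sqdist x).
Proof.
apply: (@zintP _ (8 * 64)); first exact: measurable_half_sqdist.
move=> a b ab1; have /andP[h0 h8] := half_sqdist_itv x (a, b).
by rewrite ger0_norm// (le_trans h8)// -mulrA -[leLHS]mulr1 ler_pM2l// (antipodal_ge1 ab1).
Qed.

Let tay_int : [/\ zint (@tay1 R), zint (@tay2 R), zint (@tay3 R) & zint (@tay4 R)].
Proof.
have [C C0 HC] := tay_bound R; split; apply: (@zintP _ C).
- exact: measurable_tay1.
- by move=> a b /HC[].
- exact: measurable_tay2.
- by move=> a b /HC[].
- exact: measurable_tay3.
- by move=> a b /HC[].
- exact: measurable_tay4.
- by move=> a b /HC[].
Qed.

Lemma mean_incr x : zmean (incr x) = zmean (half_sqdist x) - zmean (half_sqdist 0).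
Proof.
have [i1 _ _ _] := tay_int.
have t1 : zmean (@tay1 R) = 0 := mean_tay1 k2 p1 f_meas f_ge0 mu_density f_bnd w1 pw.
rewrite (zmeanB (zintB (zint_hs x) (zint_hs 0)) (zintZ x i1)).
by rewrite (zmeanB (zint_hs x) (zint_hs 0)) (zmeanZ x i1) t1 mulr0 subr0.
Qed.

Lemma zmean_le (g : R * R -> R) C : measurable_fun setT g -> zint g -> 0 <= C ->
  (forall a b, a ^+ 2 + b ^+ 2 < 1 -> `|g (a, b)| <= C) -> `|zmean g| <= C.
Proof.
move=> mg ig C0 gC; have mG := measurable_zonal mg.
apply: (le_trans (le_normr_Rintegral measurableT ig)).
rewrite /Rintegral -[leRHS]/(fine C%:E); apply: fine_le => //.
  by apply: integrable_fin_num => //; exact: (integrable_abse ig).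
have -> : C%:E = (\int[mu]_x C%:E)%E.
  by rewrite integral_cst// [X in (_ * X)%E](probability_setT mu) mule1.
apply: ae_ge0_le_integral => //.
- by apply/measurable_EFinP; exact: measurableT_comp.
- by apply: filterS ae_zonal_ball => z zb _; rewrite lee_fin gC.
Qed.

Lemma zmean_lip x y : x <= y ->
  `|zmean (half_sqdist y) - zmean (half_sqdist x)| <= 4 * (y - x).
Proof.
move=> xy; rewrite -(zmeanB (zint_hs y) (zint_hs x)); apply: zmean_le.
- by apply: measurable_funB; exact: measurable_half_sqdist.
- exact: (zintB (zint_hs y) (zint_hs x)).
- by rewrite mulr_ge0// subr_ge0.
- by move=> a b ab1; exact: half_sqdist_lip.
Qed.


(** By contradiction, so as to use dominated convergence along a sequence: if the expansion failed,
    there would be x_n tending to 0 violating it. The remainder divided by x_n^4 tends to 0 off a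
    null set by [geo4_limit], and is dominated by a multiple of [antipodal] by [geo_remainder4] and
    [tay_bound], so its mean tends to 0. *)
Lemma quartic_expansion : alpha d f = 0 -> forall e, 0 < e ->
  exists2 s : R, 0 < s & forall x, 0 <= x < s ->
  `|zmean (half_sqdist x) - zmean (half_sqdist 0) - beta d f / 24 * x ^+ 4| <= e * x ^+ 4.
Proof.
move=> alpha0 e e0; apply: contrapT => nex.
have /choice[x xP] : forall n : nat, exists x : R, 0 <= x < n.+1%:R^-1 /\ e * x ^+ 4 <
    `|zmean (half_sqdist x) - zmean (half_sqdist 0) - beta d f / 24 * x ^+ 4|.
  move=> n; apply: contrapT => H; apply: nex; exists n.+1%:R^-1; first by rewrite invr_gt0.
  by move=> y yI; rewrite leNgt; apply/negP => L; apply: H; exists y.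
(* A violating x is not 0, for both sides vanish there; this makes the division by x^4
   legitimate. *)
have x0 n : 0 < x n.
  have [/andP[+ _]] := xP n; rewrite le_eqVlt => /predU1P[<-|//].
  by rewrite subrr !expr0n/= !mulr0 subr0 normr0 ltxx.
pose r n z := (half_sqdist (x n) z - half_sqdist 0 z - x n * tay1 z -
  x n ^+ 2 / 2 * tay2 z - x n ^+ 3 / 6 * tay3 z - x n ^+ 4 / 24 * tay4 z).
have [i1 i2 i3 i4] := tay_int.
have [C1 C10 HC1] := tay_bound R; have [C2 C20 HC2] := geo_remainder4 R.
have rE n : zmean (r n) = zmean (half_sqdist (x n)) - zmean (half_sqdist 0) -
    beta d f / 24 * x n ^+ 4.
  have J0 := zintB (zint_hs (x n)) (zint_hs 0).
  have J1 := zintB J0 (zintZ (x n) i1).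
  have J2 := zintB J1 (zintZ (x n ^+ 2 / 2) i2).
  have J3 := zintB J2 (zintZ (x n ^+ 3 / 6) i3).
  rewrite (zmeanB J3 (zintZ (x n ^+ 4 / 24) i4)) (zmeanB J2 (zintZ (x n ^+ 3 / 6) i3)).
  rewrite (zmeanB J1 (zintZ (x n ^+ 2 / 2) i2)) (zmeanB J0 (zintZ (x n) i1)).
  rewrite (zmeanB (zint_hs (x n)) (zint_hs 0)) (zmeanZ _ i1) (zmeanZ _ i2) (zmeanZ _ i3) (zmeanZ _ i4).
  have -> : zmean (@tay1 R) = 0 := mean_tay1 k2 p1 f_meas f_ge0 mu_density f_bnd w1 pw.
  have -> : zmean (@tay2 R) = alpha d f := mean_tay2 k2 p1 f_meas f_ge0 mu_density f_bnd w1 pw.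
  have -> : zmean (@tay3 R) = 0 := mean_tay3 k2 p1 f_meas f_ge0 mu_density f_bnd w1 pw.
  have -> : zmean (@tay4 R) = beta d f := mean_tay4 k2 p1 f_meas f_ge0 mu_density f_bnd w1 pw.
  by rewrite alpha0; ring.
have mr n : measurable_fun setT (r n).
  have mh := @measurable_half_sqdist R.
  have m1 := @measurable_tay1 R; have m2 := @measurable_tay2 R.
  have m3 := @measurable_tay3 R; have m4 := @measurable_tay4 R.
  do 5 (apply: measurable_funB; last by [|apply: measurable_funM]); exact: mh.
have rgeo n a b : a ^+ 2 + b ^+ 2 < 1 -> r n (a, b) =
    geo0 a b (x n) - (geo0 a b 0 + geo1 a b 0 * x n + geo2 a b 0 / 2 * x n ^+ 2 +
    geo3 a b 0 / 6 * x n ^+ 3 + geo4 a b 0 / 24 * x n ^+ 4).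
  move=> ab1; have [_ -> -> -> ->] := tay_geo ab1.
  by rewrite !geo0_half_sqdist// /r; ring.
pose q n z := (x n ^+ 4)^-1 * r n z.
have mq n : measurable_fun setT (q n) by exact: measurable_funM.
have qle n a b : a ^+ 2 + b ^+ 2 < 1 ->
    `|q n (a, b)| <= (C2 + C1) * (pi - acosr a)^-1 ^+ 3.
  move=> ab1; rewrite normrM ger0_norm ?invr_ge0 ?exprn_ge0 ?(ltW (x0 n))//.
  rewrite mulrC ler_pdivrMr ?exprn_gt0// rgeo//.
  have := HC2 a b (x n) ab1 (ltW (x0 n)); have [g _ _ _ t4] := tay_geo ab1.
  have [_ _ _] := HC1 a b ab1; rewrite t4 g exprVn => T1 T2.
  have y4 : 0 <= x n ^+ 4 by rewrite exprn_ge0// ltW.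
  move: T2; set T3 := (_ + geo3 a b 0 / 6 * x n ^+ 3) => T2.
  have T4 : `|tay4 (a, b) / 24 * x n ^+ 4| <= C1 / (pi - acosr a) ^+ 3 * x n ^+ 4.
    rewrite (normrM (tay4 (a, b) / 24)) (ger0_norm y4) ler_wpM2r//.
    rewrite (normrM (tay4 (a, b))) (@ger0_norm _ 24^-1)//.
    by move: T1 (normr_ge0 (tay4 (a, b))); lra.
  have -> : (C2 + C1) / (pi - acosr a) ^+ 3 * x n ^+ 4 =
    C2 * x n ^+ 4 / (pi - acosr a) ^+ 3 + C1 / (pi - acosr a) ^+ 3 * x n ^+ 4 by ring.
  rewrite opprD addrA (le_trans (ler_normB _ _))//; exact: lerD.
have qto0 a b : a ^+ 2 + b ^+ 2 < 1 -> (q n (a, b))%:E @[n --> \oo] --> 0%E.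
  move=> ab1; apply: cvg_EFin; first by near=> n.
  apply/cvgrPdist_le => /= s s0; have [y y0 yP] := geo4_limit ab1 s0.
  near=> n; rewrite sub0r normrN normrM ger0_norm ?invr_ge0 ?exprn_ge0 ?(ltW (x0 n))//.
  rewrite mulrC ler_pdivrMr ?exprn_gt0// rgeo//; apply: yP; rewrite (ltW (x0 n))/=.
  have [/andP[_ xn] _] := xP n; apply: (lt_trans xn).
  by near: n; exact: (near_infty_natSinv_lt (PosNum y0)).
have mQ n : measurable_fun setT (fun z => (q n (dotp p z, dotp w z))%:E).
  by apply/measurable_EFinP; exact: measurable_zonal.
have cvQ : {ae mu, forall z, setT z -> (q n (dotp p z, dotp w z))%:E @[n --> \oo] --> cst 0%E z}.
  by apply: filterS ae_zonal_ball => z zb _; exact: qto0.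
have leQ : {ae mu, forall z n, setT z -> (`|(q n (dotp p z, dotp w z))%:E| <=
    ((C2 + C1) * antipodal p z)%:E)%E}.
  by apply: filterS ae_zonal_ball => z zb n _; rewrite lee_fin; exact: qle.
have iA := integrable_antipodal k2 p1 f_meas f_ge0 mu_density f_bnd w1 pw.
have [_ _] := dominated_convergence measurableT mQ (@measurable_cst _ _ _ _ _ 0%E) cvQ
  (integrableZl measurableT (C2 + C1) iA) leQ.
rewrite integral0 => /fine_cvg /cvgrPdist_lt /(_ e e0) [n _ /(_ n (leqnn n))] /=.
rewrite sub0r normrN -/(zmean (q n)) => L.
have [_] := xP n; rewrite -rE => {}xP.
have x4 : 0 < x n ^+ 4 by rewrite exprn_gt0.
have ir : zint (r n).
  have J0 := zintB (zint_hs (x n)) (zint_hs 0).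
  have J1 := zintB J0 (zintZ (x n) i1).
  have J2 := zintB J1 (zintZ (x n ^+ 2 / 2) i2).
  have J3 := zintB J2 (zintZ (x n ^+ 3 / 6) i3).
  exact: (zintB J3 (zintZ (x n ^+ 4 / 24) i4)).
have qE : zmean (q n) = (x n ^+ 4)^-1 * zmean (r n) by exact: zmeanZ.
move: L; rewrite [X in `|X| < _]qE normrM ger0_norm ?invr_ge0 ?(ltW x4)//.
rewrite mulrC ltr_pdivrMr// => /(lt_trans xP).
by rewrite ltxx.
Unshelve. all: by end_near. Qed.

End zonal_means.

(** * Global quartic growth and second moments of the increments *)

Section quartic_growth.
Context (R : realType) (k : nat).
Local Notation d := k.+2.
Variables (mu : probability 'rV[R]_d.+1 R) (p : 'rV[R]_d.+1) (f : R -> R).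
Hypothesis k2 : (2 <= k)%N.
Hypothesis p1 : sphere R d p.
Hypothesis f_meas : measurable_fun `[0, pi] f.
Hypothesis f_ge0 : forall t, 0 <= t <= pi -> 0 <= f t.
Hypothesis mu_density : forall A, measurable A ->
  mu A = (\int[svol R d]_(q in A `&` sphere R d) (f (sdist p q))%:E)%E.
Hypothesis f_bnd :
  exists s M : R, [/\ 0 < s, 0 <= M & forall t, pi - s < t <= pi -> f t <= M].
Variable w : 'rV[R]_d.+1.
Hypotheses (w1 : sphere R d w) (pw : dotp p w = 0).

Local Notation Phi x := (zonal_mean mu p w (half_sqdist x)).

Lemma half_sqdist_sdist (y : 'rV[R]_d.+1) x : sphere R d y ->
  2^-1 * sdist y (cos x *: p + sin x *: w) ^+ 2 = half_sqdist x (dotp p y, dotp w y).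
Proof.
by move=> y1; rewrite sdistE//; [rewrite dotpC dotp_polar|exact: polar_sphere].
Qed.

Lemma frechet_fun_zonal x : mu (sphere R d) = 1%E ->
  frechet_fun mu (cos x *: p + sin x *: w) = (Phi x)%:E.
Proof.
move=> mS; have mh := measurable_zonal p w (measurable_half_sqdist x).
have mSph := @measurable_sphere R d.
have ih : mu.-integrable setT (fun y => (half_sqdist x (dotp p y, dotp w y))%:E).
  apply: (@le_integrable _ _ _ mu _ measurableT _ (cst 8%:E)); first exact/measurable_EFinP.
    move=> y _; rewrite lee_fin; have /andP[h0 h8] := half_sqdist_itv x (dotp p y, dotp w y).
    by rewrite !ger0_norm.
  exact: finite_measure_integrable_cst.
have muC : mu (~` sphere R d) = 0%E by rewrite probability_setC// mS subee.
rewrite /frechet_fun /zonal_mean /Rintegral fineK; last exact: integrable_fin_num.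
rewrite (negligible_integral (measurableC mSph) measurableT ih muC) setTD setCK.
by apply: eq_integral => y /[!inE] y1; rewrite half_sqdist_sdist.
Qed.

(** Near 0 the expansion with error beta_d / 48 leaves beta_d / 24 - beta_d / 48. Away from 0 the
    Frechet function is Lipschitz in x and strictly above its value at p, so its minimum over a
    compact interval is strictly above too. *)
Lemma quartic_growth : alpha d f = 0 -> 0 < beta d f ->
  (forall x, 0 < x <= pi -> Phi 0 < Phi x) ->
  exists2 c : R, 0 < c & forall x, 0 <= x <= pi -> c * x ^+ 4 <= Phi x - Phi 0.
Proof.
move=> alpha0 beta0 Phi_gt; have b48 : 0 < beta d f / 48 by rewrite divr_gt0.
have [s s0 sP] := quartic_expansion k2 p1 f_meas f_ge0 mu_density f_bnd w1 pw alpha0 b48.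
have near0 x : 0 <= x < s -> beta d f / 48 * x ^+ 4 <= Phi x - Phi 0.
  by move=> /sP; rewrite ler_norml => /andP[+ _]; lra.
pose s' := Num.min s pi; have pi0 := pi_gt0 R.
have s'0 : 0 < s' by rewrite lt_min s0.
have s'pi : s' <= pi by rewrite ge_min lexx orbT.
have cPhi : {within `[s', pi], continuous (fun x => Phi x)}.
  apply: continuous_subspaceT => x; apply/cvgrPdist_lt => e e0.
  near=> y; have L := zmean_lip k2 p1 f_meas f_ge0 mu_density f_bnd w1 pw.
  have D : `|x - y| < e / 4.
    by near: y; exists (e / 4) => //=; rewrite divr_gt0.
  have [xy|/ltW yx] := leP x y.
    by rewrite distrC (le_lt_trans (L _ _ xy))// -ltr_pdivlMl// mulrC (le_lt_trans _ D)// distrC ler_norm.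
  by rewrite (le_lt_trans (L _ _ yx))// -ltr_pdivlMl// mulrC (le_lt_trans _ D)// ler_norm.
have [c /[!in_itv]/= /andP[c1 c2] cP] := EVT_min s'pi cPhi.
have Pc : 0 < Phi c - Phi 0 by rewrite subr_gt0 Phi_gt// c2 (lt_le_trans s'0).
(* 256 = 4^4 bounds x^4 on [0, pi]. *)
exists (Num.min (beta d f / 48) ((Phi c - Phi 0) / 256)).
  by rewrite lt_min b48 divr_gt0.
move=> x /andP[x0 xpi]; have x4 : 0 <= x ^+ 4 by rewrite exprn_ge0.
have [xs|sx] := ltP x s.
  apply: le_trans (near0 x _); last by rewrite x0.
  by rewrite ler_wpM2r// ge_min lexx.
have xI : x \in `[s', pi]%R by rewrite in_itv/= xpi andbT ge_min sx.
have xx : x ^+ 4 <= 4 ^+ 4 by rewrite lerXn2r ?nnegrE// (le_trans xpi)// pi_le4.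
apply: (@le_trans _ _ (Phi c - Phi 0)); last by rewrite lerD2r cP.
apply: (@le_trans _ _ ((Phi c - Phi 0) / 256 * x ^+ 4)).
  by rewrite ler_wpM2r// ge_min lexx orbT.
by rewrite mulrAC ler_pdivrMr// ler_pM2l//; lra.
Unshelve. all: by end_near. Qed.

(** The square of the bound C x^2 / r has the singularity r^(-2), which is at most 4 r^(-3) because
    r <= 4, and this is integrable. *)
Lemma mean_incr_sqr : exists2 C : R, 0 < C & forall x, 0 <= x ->
  mu.-integrable setT (fun y => (incr x (dotp p y, dotp w y) ^+ 2)%:E) /\
  zonal_mean mu p w (fun z => incr x z ^+ 2) <= C * x ^+ 4.
Proof.
have [C C0 HC] := incr_bound R.
have iA := integrable_antipodal k2 p1 f_meas f_ge0 mu_density f_bnd w1 pw.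
pose A := \int[mu]_y antipodal p y.
have A0 : 0 <= A by apply: Rintegral_ge0 => y _; exact: antipodal_ge0.
have mi x : measurable_fun setT (fun z : R * R => incr x z ^+ 2).
  by apply: measurable_funX; exact: measurable_incr.
have bnd x a b : 0 <= x -> a ^+ 2 + b ^+ 2 < 1 ->
    incr x (a, b) ^+ 2 <= (4 * C ^+ 2 * x ^+ 4) * (pi - acosr a)^-1 ^+ 3.
  move=> x0 ab1; have [H _] := HC a b x ab1 x0.
  have /andP[t0 tpi] := acosr_lt_pi ab1; have p4 := pi_le4 R.
  set r := (pi - acosr a)^-1 in H *.
  have r0 : 0 < r by rewrite invr_gt0 subr_gt0.
  have r4 : 4^-1 <= r by rewrite lef_pV2 ?posrE ?subr_gt0//; lra.
  rewrite -[leLHS](@real_normK _ _) ?num_real//.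
  apply: (@le_trans _ _ ((C * x ^+ 2 * r) ^+ 2)).
    by rewrite lerXn2r ?nnegrE// !mulr_ge0 ?sqr_ge0// ltW.
  have -> : (C * x ^+ 2 * r) ^+ 2 = (C ^+ 2 * x ^+ 4 * r ^+ 2) * 1 by ring.
  have -> : 4 * C ^+ 2 * x ^+ 4 * r ^+ 3 = (C ^+ 2 * x ^+ 4 * r ^+ 2) * (4 * r) by ring.
  by rewrite ler_wpM2l ?mulr_ge0 ?sqr_ge0 ?exprn_ge0//; lra.
exists (4 * C ^+ 2 * A + 1) => [|x x0].
  by rewrite ltr_pwDr// mulr_ge0// mulr_ge0// sqr_ge0.
have ii : mu.-integrable setT (fun y => (incr x (dotp p y, dotp w y) ^+ 2)%:E).
  apply: (zonal_integrable k2 p1 f_meas f_ge0 mu_density f_bnd w1 pw (mi x)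
    (C := 4 * C ^+ 2 * x ^+ 4)) => a b ab1.
  by rewrite ger0_norm ?sqr_ge0// bnd.
split => //.
have iZ := integrableZl measurableT (4 * C ^+ 2 * x ^+ 4) iA.
have x4 : 0 <= x ^+ 4 by rewrite exprn_ge0.
apply: (@le_trans _ _ (\int[mu]_y (4 * C ^+ 2 * x ^+ 4 * antipodal p y))); last first.
  rewrite RintegralZl// -/A.
  have -> : (4 * C ^+ 2 * A + 1) * x ^+ 4 = 4 * C ^+ 2 * x ^+ 4 * A + x ^+ 4 by ring.
  by rewrite lerDl.
apply: fine_le; [exact: integrable_fin_num|exact: integrable_fin_num|].
apply: ae_ge0_le_integral => //.
- by move=> y _; rewrite lee_fin sqr_ge0.
- by apply/measurable_EFinP; exact: (measurable_zonal p w (mi x)).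
- by move=> y _; rewrite lee_fin mulr_ge0 ?antipodal_ge0// mulr_ge0// mulr_ge0// sqr_ge0.
- exact: (measurable_int mu).
have aeb := ae_zonal_ball k2 p1 f_meas f_ge0 mu_density w1 pw.
by apply: filterS aeb => y yb _; rewrite lee_fin bnd.
Qed.

End quartic_growth.

(** * Concentration of the empirical process *)

Section independent_products.
Context dT (T : measurableType dT) (R : realType) (P : probability T R).
Context dV (V : measurableType dV) (X : nat -> {RV P >-> V}) (mu : probability V R).
Hypothesis X_indep : mutually_independent X.
Hypothesis X_law : identically_distributed X mu.

Let law i (A : set V) : measurable A -> P (X i @^-1` A) = mu A.
Proof. by move=> mA; rewrite -(X_law i mA). Qed.

Let mX i : measurable_fun setT (X i).
Proof. exact: measurable_funPT. Qed.

Let prod_indic (A : nat -> set V) n : (forall i, measurable (A i)) ->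
  (\int[P]_w (\prod_(0 <= i < n) \1_(A i) (X i w))%:E =
   (\prod_(0 <= i < n) fine (mu (A i)))%:E)%E.
Proof.
move=> mA; pose J := [fset i | i in iota 0 n]%fset.
have JE : index_iota 0 n = iota 0 n by rewrite /index_iota subn0.
have := X_indep J mA.
have -> : (\prod_(i <- J) P (X i @^-1` A i) = \prod_(0 <= i < n) P (X i @^-1` A i))%E.
  rewrite JE; apply: perm_big; rewrite uniq_perm ?fset_uniq ?iota_uniq//.
  by move=> i; rewrite in_fset.
have -> : (\prod_(0 <= i < n) P (X i @^-1` A i) = (\prod_(0 <= i < n) fine (mu (A i)))%:E)%E.
  elim: n {J JE} => [|n IH]; first by rewrite !big_nil.
  rewrite !big_nat_recr//= IH law// EFinM fineK//; exact: fin_num_measure.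
move=> <-.
have mS : measurable (\bigcap_(i in [set` J]) X i @^-1` A i).
  apply: fin_bigcap_measurable => // i _.
  by rewrite -[X in measurable X]setTI; exact: mX.
rewrite -[X in P X]setIT -integral_indic//; apply: eq_integral => w _; congr _%:E.
rewrite indicE; have [wS|wS] := pselect ((\bigcap_(i in [set` J]) X i @^-1` A i) w).
  rewrite mem_set//; rewrite big_seq big1// => i; rewrite JE => iI.
  by rewrite indicE mem_set//; apply: wS; rewrite /= in_fset.
rewrite memNset//; apply/eqP; rewrite prodf_seq_eq0.
have [i [iJ iA]] : exists i, i \in J /\ ~ A i (X i w).
  apply: contrapT => H; apply: wS => i iJ; apply: contrapT => iA.
  by apply: H; exists i.
apply/hasP; exists i; first by rewrite JE; move: iJ; rewrite in_fset.
by rewrite /= indicE memNset.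
Qed.

Variables (h : V -> R) (c : R).
Hypotheses (mh : measurable_fun setT h) (h0 : forall v, 0 <= h v).
Hypothesis hc : (\int[mu]_v (h v)%:E = c%:E)%E.

Let c0 : 0 <= c.
Proof. by rewrite -lee_fin -hc; apply: integral_ge0 => v _; rewrite lee_fin. Qed.

(** Independence is given for indicators only. The induction on m trades one indicator at a time for
    h, with any number n of further indicators left over. *)
Let mixed m n (A : nat -> set V) : (forall i, measurable (A i)) ->
  (\int[P]_w (\prod_(0 <= i < m) h (X i w) *
              \prod_(m <= i < m + n) \1_(A i) (X i w))%:E =
   (c ^+ m * \prod_(m <= i < m + n) fine (mu (A i)))%:E)%E.
Proof.
elim: m n A => [|m IH] n A mA.
  rewrite mul1r -prod_indic//.
  by apply: eq_integral => w _; rewrite big_nil mul1r.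
pose W w := \prod_(0 <= i < m) h (X i w) * \prod_(m.+1 <= i < m.+1 + n) \1_(A i) (X i w).
pose a := c ^+ m * \prod_(m.+1 <= i < m.+1 + n) fine (mu (A i)).
have a0 : 0 <= a.
  by rewrite mulr_ge0 ?exprn_ge0// prodr_ge0// => i _; rewrite fine_ge0.
have W0 w : 0 <= W w by rewrite mulr_ge0// prodr_ge0.
have mW : measurable_fun setT W.
  apply: measurable_funM; apply: measurable_prod => i _.
    exact: (measurableT_comp mh (mX i)).
  apply: (measurableT_comp _ (mX i)); exact: measurable_indic.
(* Under P weighted by [W], the variable X_m has law [mu] up to the factor [a]: this is the
   induction hypothesis with the indicator of B at place m. *)
have tr B : measurable B -> (mscale (NngNum a0) mu B = \int[P]_w ((W w)%:E * (\1_B (X m w))%:E))%E.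
  move=> mB; pose A' i := if i == m then B else A i.
  have mA' i : measurable (A' i) by rewrite /A'; case: ifP.
  have A'E i : (m < i)%N -> A' i = A i by rewrite /A' => /gtn_eqF ->.
  have A'm : A' m = B by rewrite /A' eqxx.
  have S (F : nat -> R) : \prod_(m <= i < m + n.+1) F i = F m * \prod_(m.+1 <= i < m.+1 + n) F i.
    by rewrite addnS -addSn big_ltn// ltn_addr.
  have := IH n.+1 A' mA'; rewrite S.
  have -> : \prod_(m.+1 <= i < m.+1 + n) fine (mu (A' i)) =
            \prod_(m.+1 <= i < m.+1 + n) fine (mu (A i)).
    by apply: eq_big_nat => i /andP[mi _]; rewrite A'E.
  rewrite A'm => E; rewrite /mscale/= -[mu B]fineK ?fin_num_measure// -EFinM.
  rewrite /a mulrAC -mulrA -E; apply: eq_integral => w _; rewrite S A'm -EFinM.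
  have -> : \prod_(m.+1 <= i < m.+1 + n) (\1_(A' i) (X i w) : R) =
            \prod_(m.+1 <= i < m.+1 + n) \1_(A i) (X i w).
    by apply: eq_big_nat => i /andP[mi _]; rewrite A'E.
  by rewrite /W; congr _%:E; ring.
have mhE : measurable_fun setT (EFin \o h) by exact/measurable_EFinP.
transitivity (\int[P]_w ((W w)%:E * (EFin \o h) (X m w)))%E.
  apply: eq_integral => w _; rewrite -EFinM /W big_nat_recr//=; congr _%:E; ring.
have hE0 v : (0 <= (EFin \o h) v)%E by rewrite lee_fin.
rewrite -(ge0_integral_transport W0 mW (mX m) tr mhE hE0).
rewrite ge0_integral_mscale// hc -EFinM /a/=; congr _%:E; rewrite exprS; ring.
Qed.

Lemma integral_iid_prod n : (\int[P]_w (\prod_(i < n) h (X i w))%:E = (c ^+ n)%:E)%E.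
Proof.
have := mixed n 0 (fun=> @measurableT _ V); rewrite addn0 big_geq// mulr1 => <-.
by apply: eq_integral => w _; rewrite big_mkord big_geq// mulr1.
Qed.

End independent_products.

Section chernoff.
Context (R : realType).

(** From exp(-u) >= 1 - u one gets (1 - u) exp u <= 1, and (1 - u)(1 + u + 2 u^2) = 1 + u^2 (1 - 2
    u) >= 1. *)
Lemma expR_quadratic (u : R) : u <= 2^-1 -> expR u <= 1 + u + 2 * u ^+ 2.
Proof.
move=> u2; have u1 : 0 < 1 - u by lra.
have : (1 - u) * expR u <= 1.
  by rewrite -[leRHS](expRxMexpNx_1 u) mulrC ler_wpM2l ?expR_ge0// (le_trans _ (expR_ge1Dx _)).
have u3 : 0 <= (1 - 2 * u) * u ^+ 2 by rewrite mulr_ge0 ?sqr_ge0//; lra.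
rewrite mulrC -ler_pdivlMr// => /le_trans; apply; rewrite ler_pdivrMr//; nra.
Qed.

Context dT (T : measurableType dT) (P : probability T R).
Context dV (V : measurableType dV) (X : nat -> {RV P >-> V}) (mu : probability V R).
Hypothesis X_indep : mutually_independent X.
Hypothesis X_law : identically_distributed X mu.

(** Integrate [expR_quadratic] at u = l Y, then use 1 + x <= exp x. Y is not centred, so the raw
    second moment appears; that is the quantity known to be of order x^4. *)
Lemma mgf_bound (Y : V -> R) b l : measurable_fun setT Y ->
  {ae mu, forall v, `|Y v| <= b} -> mu.-integrable setT (fun v => (Y v ^+ 2)%:E) ->
  `|l| * b <= 2^-1 ->
  exists c, [/\ (\int[mu]_v (expR (l * Y v))%:E = c%:E)%E, 0 <= c &
    c <= expR (l * \int[mu]_v Y v + 2 * l ^+ 2 * \int[mu]_v (Y v ^+ 2))].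
Proof.
move=> mY Yb iY2 lb.
have mE : measurable_fun setT (fun v => expR (l * Y v)).
  by apply: (measurableT_comp (@measurable_expR R)); exact: measurable_funM.
have i1 : mu.-integrable setT (fun=> (1 : R)%:E) by exact: finite_measure_integrable_cst.
have iY : mu.-integrable setT (fun v => (Y v)%:E).
  apply: (le_integrable measurableT _ _ (integrableD measurableT i1 iY2)).
    exact/measurable_EFinP.
  move=> v _; rewrite lee_fin (@ger0_norm _ (1 + _)) ?addr_ge0 ?sqr_ge0//.
  rewrite -[Y v ^+ 2]real_normK ?num_real//; move: `|Y v| (normr_ge0 (Y v)) => y y0; nra.
have ilY := integrableZl measurableT l iY.
have ilY2 := integrableZl measurableT (2 * l ^+ 2) iY2.
pose G v := 1 + l * Y v + 2 * l ^+ 2 * Y v ^+ 2.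
have iG : mu.-integrable setT (fun v => (G v)%:E).
  exact: (integrableD measurableT (integrableD measurableT i1 ilY) ilY2).
have GE : (\int[mu]_v (G v)%:E =
    (1 + l * \int[mu]_v Y v + 2 * l ^+ 2 * \int[mu]_v (Y v ^+ 2))%:E)%E.
  rewrite -[LHS]fineK; last exact: integrable_fin_num.
  congr _%:E; rewrite -/(Rintegral mu setT G).
  rewrite (RintegralD measurableT (integrableD measurableT i1 ilY) ilY2).
  rewrite (RintegralD measurableT i1 ilY) !RintegralZl// Rintegral_cst//.
  by rewrite [X in 1 * fine X](probability_setT mu) mulr1.
have G0 v : 0 <= G v.
  have -> : G v = 2^-1 + 2 * (l * Y v + 2^-1 / 2) ^+ 2 + (2^-1 - 2 / 16) by rewrite /G; field.
  by have := sqr_ge0 (l * Y v + 2^-1 / 2); move: (_ ^+ 2) => q; lra.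
have le : (\int[mu]_v (expR (l * Y v))%:E <= \int[mu]_v (G v)%:E)%E.
  apply: ae_ge0_le_integral => //.
  - exact/measurable_EFinP.
  - by move=> v _; rewrite lee_fin.
  - exact: (measurable_int mu).
  apply: filterS Yb => v vb _; rewrite lee_fin.
  have -> : G v = 1 + l * Y v + 2 * (l * Y v) ^+ 2 by rewrite /G; ring.
  apply: expR_quadratic; apply: le_trans lb; rewrite (le_trans (ler_norm _))// normrM.
  by rewrite ler_wpM2l.
have e0 : (0 <= \int[mu]_v (expR (l * Y v))%:E)%E.
  by apply: integral_ge0 => v _; rewrite lee_fin expR_ge0.
have fE : (\int[mu]_v (expR (l * Y v))%:E)%E \is a fin_num.
  by rewrite ge0_fin_numE// (le_lt_trans le)// GE ltry.
exists (fine (\int[mu]_v (expR (l * Y v))%:E)%E); split.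
- by rewrite fineK.
- exact: fine_ge0.
- rewrite -lee_fin fineK// (le_trans le)// GE lee_fin.
  by rewrite -addrA expR_ge1Dx.
Qed.

(* Bernstein's inequality with a fixed tilt l, for which the variance term is quadratic in l. *)
Lemma chernoff (Y : V -> R) b l s n : measurable_fun setT Y ->
  {ae mu, forall v, `|Y v| <= b} -> mu.-integrable setT (fun v => (Y v ^+ 2)%:E) ->
  0 <= l -> l * b <= 2^-1 ->
  (P [set w | (n%:R * (\int[mu]_v Y v + s) <= \sum_(i < n) Y (X i w))%R] <=
   (expR (n%:R * (2 * l ^+ 2 * \int[mu]_v (Y v ^+ 2) - l * s))%R)%:E)%E.
Proof.
move=> mY Yb iY2 l0 lb.
have lb' : `|l| * b <= 2^-1 by rewrite ger0_norm.
have [c [cE c0 cle]] := mgf_bound mY Yb iY2 lb'.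
set A := [set w | _].
have mX i : measurable_fun setT (X i) by exact: measurable_funPT.
have mS : measurable_fun setT (fun w => \sum_(i < n) Y (X i w)).
  by apply: measurable_sum => i; exact: (measurableT_comp mY (mX i)).
have mA : measurable A.
  by rewrite -[A]setTI; apply: measurable_fun_ler.
have mh : measurable_fun setT (fun v => expR (l * Y v)).
  by apply: (measurableT_comp (@measurable_expR R)); exact: measurable_funM.
have := integral_iid_prod X_indep X_law mh (fun v => expR_ge0 (l * Y v)) cE n.
set t := n%:R * (_ + s) in A mA *.
have E w : \prod_(i < n) expR (l * Y (X i w)) = expR (l * \sum_(i < n) Y (X i w)).
  by rewrite -expR_sum -mulr_sumr.
under eq_integral do rewrite E.
move=> IE; have : ((expR (l * t))%:E * P A <= (c ^+ n)%:E)%E.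
  rewrite -IE -[X in P X]setIT -integral_indic// -ge0_integralZl_EFin//; last first.
    by apply/measurable_EFinP; exact: measurable_indic.
  apply: ge0_le_integral => //.
  - by apply/measurable_EFinP; apply: measurable_funM => //; exact: measurable_indic.
  - apply/measurable_EFinP; apply: (measurableT_comp (@measurable_expR R)).
    exact: measurable_funM.
  - move=> w _; rewrite lee_fin indicE; have [wA|wA] := boolP (w \in A).
      by rewrite mulr1 ler_expR ler_wpM2l//; move: wA; rewrite inE.
    by rewrite mulr0 expR_ge0.
have PA : P A = (fine (P A))%:E by rewrite fineK// fin_num_measure.
rewrite PA -EFinM !lee_fin mulrC -ler_pdivlMr ?expR_gt0// => /le_trans; apply.
rewrite ler_pdivrMr ?expR_gt0// -expRD.
apply: (@le_trans _ _ (expR (l * \int[mu]_v Y v + 2 * l ^+ 2 * \int[mu]_v (Y v ^+ 2)) ^+ n)).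
  by rewrite lerXn2r ?nnegrE ?expR_ge0.
rewrite -expRM_natl ler_expR /t le_eqVlt; apply/orP; left; apply/eqP; ring.
Qed.

End chernoff.

Lemma coord_le_enorm (R : realType) n (v : 'rV[R]_n) i : `|v ord0 i| <= enorm v.
Proof.
rewrite -(@ler_pXn2r _ 2) ?nnegrE ?enorm_ge0// real_normK ?num_real// enorm_sqr /dotp.
rewrite (bigD1 i)//= -expr2 lerDl sumr_ge0// => j _.
by rewrite -expr2 sqr_ge0.
Qed.

(** * The Riemannian logarithm in closed form *)

Section logarithm.
Context (R : realType) (k : nat).
Implicit Types p v w y : 'rV[R]_k.+1.

Lemma dotpBl (u v y : 'rV[R]_k.+1) : dotp (u - v) y = dotp u y - dotp v y.
Proof. by rewrite dotpDl dotpNl. Qed.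

Lemma dotpBr (u v y : 'rV[R]_k.+1) : dotp y (u - v) = dotp y u - dotp y v.
Proof. by rewrite dotpDr dotpNr. Qed.

Lemma enorm_tangential p y : sphere R k p -> sphere R k y ->
  enorm (y - dotp p y *: p) = sin (acosr (dotp p y)).
Proof.
move=> /[dup] p1 /sphereE pp /[dup] y1 /sphereE yy.
have aI := dotp_sphere_itv p1 y1.
have s0 : 0 <= sin (acosr (dotp p y)) by apply/sin_ge0_pi/acosr_itv.
rewrite -[RHS]ger0_norm// -sqrtr_sqr /enorm; congr Num.sqrt.
rewrite sin_acosr_sqr// !(dotpBl, dotpBr) !(dotpZl, dotpZr) pp yy [dotp y p]dotpC.
ring.
Qed.

(** Any preimage of y has norm t = d(p, y), which fixes it to be t / sin t times the tangential part
    of y. The formula also covers the two degenerate points: at y = p the tangential part is 0, and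
    at the antipode division by 0 makes [psi1] vanish, in agreement with the default value of
    [slog]. *)
Lemma slogE p y : sphere R k p -> sphere R k y ->
  slog p y = - psi1 (acosr (dotp p y)) *: (y - dotp p y *: p).
Proof.
move=> p1 y1; have /sphereE pp := p1.
have aI := dotp_sphere_itv p1 y1.
set a := dotp p y in aI *; set t := acosr a.
have ct : cos t = a by exact: cos_acosr.
have tI : 0 <= t <= pi := acosr_itv a.
have uE : enorm (y - a *: p) = sin t by exact: enorm_tangential.
have set_t v : tangent p v -> sexp p v = y -> enorm v <= pi -> enorm v = t.
  move=> pv vy vpi; rewrite /t /a -vy /sexp dotpDr !dotpZr pp pv mulr1 mulr0 addr0.
  by rewrite acosr_cos// enorm_ge0.
(* At the antipode a preimage would have norm pi, outside the open ball, so [slog] takes its default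
   value. *)
have [tpi|tpi] := eqVneq t pi.
  rewrite tpi /psi1 sinpi invr0 mulr0 oppr0 scale0r /slog.
  apply: xgetPN => v [pv vpi vy]; move: (vpi).
  by rewrite (set_t v pv vy (ltW vpi)) tpi ltxx.
have {}tpi : t < pi by rewrite lt_neqAle tpi; case/andP: tI.
have [t0|t0] := eqVneq t 0.
  have y_p : y - a *: p = 0 by apply/eqP; rewrite -enorm_eq0 uE t0 sin0.
  have yp : y = p.
    have a1 : a = 1 by rewrite -ct t0 cos0.
    by apply/eqP; rewrite -subr_eq0 -y_p a1 scale1r.
  rewrite y_p scaler0; apply: xget_subset1.
    split; [by rewrite /tangent/= dotp0r|by rewrite enorm0 pi_gt0|].
    by rewrite /sexp enorm0 cos0 scale1r scaler0 addr0 yp.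
  move=> u v [pu upi uy] [pv vpi vy].
  have := set_t u pu uy (ltW upi); have := set_t v pv vy (ltW vpi).
  by rewrite t0 => /eqP; rewrite enorm_eq0 => /eqP -> /eqP; rewrite enorm_eq0 => /eqP ->.
have s0 : sin t != 0.
  by rewrite gt_eqF// sin_gt0_pi// tpi andbT lt_neqAle eq_sym t0; case/andP: tI.
have psiE : - psi1 t = t / sin t by rewrite /psi1; field.
have tp : 0 <= t by case/andP: tI.
have vE : enorm (- psi1 t *: (y - a *: p)) = t.
  rewrite enormZ uE psiE ger0_norm ?divfK// divr_ge0// sin_ge0_pi//.
apply: xget_subset1.
  split; last 2 first.
  - by rewrite vE.
  - rewrite /sexp vE scalerA psiE ct.
    have -> : sin t / t * (t / sin t) = 1 by field; rewrite s0 t0.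
    by rewrite scale1r addrC subrK.
  by rewrite /tangent/= dotpZr dotpBr dotpZr pp mulr1 subrr mulr0.
move=> u v [pu upi uy] [pv vpi vy].
have uu := set_t u pu uy (ltW upi); have vv := set_t v pv vy (ltW vpi).
have c0 : sin t / t != 0 by rewrite mulf_neq0// invr_eq0.
apply: (scalerI c0); apply: (addrI (cos t *: p)).
by move: uy vy; rewrite /sexp uu vv => -> ->.
Qed.

Lemma enorm_slog p y : sphere R k p -> sphere R k y -> enorm (slog p y) <= pi.
Proof.
move=> p1 y1; rewrite slogE// enormZ enorm_tangential// normrN.
have /andP[t0 tpi] := acosr_itv (dotp p y).
have s0 : 0 <= sin (acosr (dotp p y)) by apply/sin_ge0_pi/acosr_itv.
rewrite /psi1 normrM normrN normfV (ger0_norm t0) (ger0_norm s0).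
have [->|s1] := eqVneq (sin (acosr (dotp p y))) 0; first by rewrite mulr0 pi_ge0.
by rewrite divfK.
Qed.

Lemma slog_tangent p y : sphere R k p -> sphere R k y -> dotp p (slog p y) = 0.
Proof.
move=> p1 y1; have /sphereE pp := p1.
by rewrite slogE// dotpZr dotpBr dotpZr pp mulr1 subrr mulr0.
Qed.

Lemma tay1_slog p w y : sphere R k p -> sphere R k y -> dotp p w = 0 ->
  tay1 (dotp p y, dotp w y) = - dotp w (slog p y).
Proof.
move=> p1 y1 pw; rewrite slogE// dotpZr dotpBr dotpZr [dotp w p]dotpC pw mulr0 subr0.
by rewrite mulNr opprK.
Qed.

Lemma dotp_diff_le (w w' v : 'rV[R]_k.+1) h M : (forall i, `|w ord0 i - w' ord0 i| <= h) ->
  enorm v <= M -> `|dotp w v - dotp w' v| <= k.+1%:R * (h * M).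
Proof.
move=> wh vM; rewrite -dotpBl /dotp (le_trans (ler_norm_sum _ _ _))//.
rewrite -[X in _ <= X%:R * _]card_ord -sumr_const mulr_suml.
apply: ler_sum => i _; rewrite mul1r !mxE normrM ler_pM//.
exact: (le_trans (coord_le_enorm _ _)).
Qed.

End logarithm.

Section increment_modulus.
Context (R : realType) (k : nat).

(** With half sum u and half difference v of the two angles, the cosines differ by 2 sin u sin v,
    where sin u >= sin v >= v / 8. The exponent 1/2 is the price for including the points at
    distance 0 and pi, where acos is not Lipschitz. *)
Lemma acosr_holder (a b : R) : -1 <= a <= 1 -> -1 <= b <= 1 ->
  (acosr a - acosr b) ^+ 2 <= 128 * `|a - b|.
Proof.
wlog ab : a b / b <= a => [H aI bI|aI bI].
  have [ba|/ltW ab] := leP b a; first exact: H.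
  by rewrite -sqrrN opprB distrC H.
have st : acosr a <= acosr b.
  by rewrite !acosrE//; case/andP: aI => _ a1; case/andP: bI => b1 _; exact: ler_acos.
rewrite -[in leRHS](cos_acosr aI) -[in leRHS](cos_acosr bI).
move: st (acosr_itv a) (acosr_itv b); move: (acosr a) (acosr b) => t s ts /andP[t0 tpi] /andP[s0 spi].
set u := (s + t) / 2; set v := (s - t) / 2.
have -> : s = u + v by rewrite /u /v; field.
have -> : t = u - v by rewrite /u /v; field.
have pi0 := pi_gt0 R.
have v0 : 0 <= v by rewrite /v; lra.
have sv0 : 0 <= sin v by apply: sin_ge0_pi; rewrite /v; lra.
have suv : sin v <= sin u.
  have -> : u = s / 2 + t / 2 by rewrite /u; field.
  have -> : v = s / 2 - t / 2 by rewrite /v; field.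
  rewrite sinB sinD.
  have : 0 <= cos (s / 2) * sin (t / 2).
    apply: mulr_ge0; [apply: cos_ge0_pihalf|apply: sin_ge0_pi]; lra.
  lra.
have sv : v / 8 <= sin v by apply: sin_ge_eighth; rewrite /v; lra.
have -> : cos (u - v) - cos (u + v) = 2 * (sin u * sin v) by rewrite cosB cosD; ring.
have vv : (v / 8) ^+ 2 <= sin u * sin v.
  have v8 : 0 <= v / 8 by rewrite divr_ge0.
  by rewrite expr2; apply: ler_pM => //; exact: le_trans suv.
have -> : u - v - (u + v) = - (2 * v) by ring.
rewrite sqrrN ger0_norm; last by rewrite mulr_ge0// mulr_ge0// (le_trans sv0).
have -> : (2 * v) ^+ 2 = 128 * (2 * (v / 8) ^+ 2) by field.
by rewrite ler_pM2l// ler_pM2l.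
Qed.

Lemma sin_cos_lip (x y : R) : `|cos x - cos y| <= `|x - y| /\ `|sin x - sin y| <= `|x - y|.
Proof.
wlog xy : x y / y <= x => [H|].
  have [yx|/ltW xy] := leP y x; first exact: H.
  by rewrite (distrC (cos x)) (distrC (sin x)) (distrC x); exact: H.
move: xy; rewrite le_eqVlt => /predU1P[->|xy]; first by rewrite !subrr normr0.
have x_y : 0 < x - y by rewrite subr_gt0.
split.
- have [z _ ->] := @mvt_is_derive R cos (fun z => - sin z) y x xy (fun z _ => is_derive_cos z).
  rewrite normrM normrN -[leRHS]mul1r ler_wpM2r//; exact: sin_max.
- have [z _ ->] := @mvt_is_derive R sin cos y x xy (fun z _ => is_derive_sin z).
  rewrite normrM -[leRHS]mul1r ler_wpM2r//; exact: cos_max.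
Qed.

(** A deterministic bound for every y of the sphere, not merely almost every y, since it is applied
    to the samples. The square root comes from [acosr_holder]; the linear part is Lipschitz because
    the logarithm has norm at most pi. *)
Lemma incr_modulus : exists2 C : R, 0 < C & forall (p w w' y : 'rV[R]_k.+1) x x' h,
  sphere R k p -> sphere R k y -> sphere R k w -> sphere R k w' ->
  dotp p w = 0 -> dotp p w' = 0 -> 0 <= x <= pi -> 0 <= x' <= pi -> h <= 1 ->
  `|x - x'| <= h ->  (forall i, `|w ord0 i - w' ord0 i| <= h) ->
  `|incr x (dotp p y, dotp w y) - incr x' (dotp p y, dotp w' y)| <= C * Num.sqrt h.
Proof.
pose n : R := k.+1%:R; have n0 : 0 < n by rewrite ltr0n.
exists (4 * Num.sqrt (128 * (n + 2)) + (4 + 16 * n)).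
  by rewrite ltr_wpDl// ?mulr_ge0//; lra.
move=> p w w' y x x' h p1 y1 w1 w'1 pw pw' /andP[x0 xpi] /andP[x'0 x'pi] h1 xh wh.
have h0 : 0 <= h by exact: le_trans xh.
have p4 := pi_le4 R.
have hs : h <= Num.sqrt h.
  by rewrite -{1}(sqr_sqrtr h0) expr2 ler_piMl ?sqrtr_ge0// -sqrtr1 ler_wsqrtr.
have yn : enorm y <= 1 by rewrite y1.
have bb := dotp_diff_le wh yn; rewrite mulr1 -/n in bb.
have dd := dotp_diff_le wh (enorm_slog p1 y1); rewrite -/n in dd.
have sl := enorm_slog p1 y1.
have Dw (u : 'rV[R]_k.+1) : sphere R k u -> `|dotp u (slog p y)| <= 4.
  move=> u1; rewrite (le_trans (CauchySchwarz _ _))// [enorm u]u1 mul1r.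
  exact: le_trans p4.
rewrite /incr !tay1_slog//.
set D := dotp w _ in dd *; set D' := dotp w' _ in dd *.
have -> : half_sqdist 0 (dotp p y, dotp w' y) = half_sqdist 0 (dotp p y, dotp w y).
  by rewrite /half_sqdist/= sin0 !mulr0.
have lin : `|x * D - x' * D'| <= (4 + 16 * n) * Num.sqrt h.
  have -> : x * D - x' * D' = (x - x') * D + x' * (D - D') by ring.
  apply: (@le_trans _ _ (h * 4 + 4 * (n * (h * 4)))).
    rewrite (le_trans (ler_normD _ _))// !normrM; apply: lerD.
      by apply: ler_pM => //; exact: Dw.
    apply: ler_pM => //; first by rewrite ger0_norm//; lra.
    apply: (le_trans dd); rewrite ler_wpM2l ?(ltW n0)// ler_wpM2l//.
  have -> : h * 4 + 4 * (n * (h * 4)) = (4 + 16 * n) * h by ring.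
  by rewrite ler_wpM2l//; lra.
pose c := dotp p y * cos x + dotp w y * sin x.
pose c' := dotp p y * cos x' + dotp w' y * sin x'.
have cI : -1 <= c <= 1.
  by rewrite /c -dotp_polar; apply: dotp_sphere_itv => //; exact: polar_sphere.
have c'I : -1 <= c' <= 1.
  by rewrite /c' -dotp_polar; apply: dotp_sphere_itv => //; exact: polar_sphere.
have cc : `|c - c'| <= (n + 2) * h.
  have -> : c - c' = dotp p y * (cos x - cos x') + dotp w y * (sin x - sin x')
     + (dotp w y - dotp w' y) * sin x' by rewrite /c /c'; ring.
  have [C1 C2] := sin_cos_lip x x'.
  have U (u : 'rV[R]_k.+1) z : sphere R k u -> `|z| <= `|x - x'| -> `|dotp u y * z| <= 1 * h.
    move=> u1 zx; rewrite normrM; apply: ler_pM => //; last exact: le_trans xh.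
    by rewrite (le_trans (CauchySchwarz _ _))// [enorm u]u1 [enorm y]y1 mulr1.
  have B3 : `|(dotp w y - dotp w' y) * sin x'| <= n * h * 1.
    by rewrite normrM; apply: ler_pM => //; exact: sin_max.
  have := U p _ p1 C1; have := U w _ w1 C2.
  move: (ler_normD (dotp p y * (cos x - cos x')) (dotp w y * (sin x - sin x'))).
  move: (ler_normD (dotp p y * (cos x - cos x') + dotp w y * (sin x - sin x'))
     ((dotp w y - dotp w' y) * sin x')) B3; rewrite mulrDl; lra.
have hold : `|acosr c - acosr c'| <= Num.sqrt (128 * (n + 2)) * Num.sqrt h.
  rewrite -sqrtr_sqr -sqrtrM ?mulr_ge0 ?addr_ge0 ?(ltW n0)//; apply: ler_wsqrtr.
  rewrite (le_trans (acosr_holder cI c'I))// -mulrA ler_wpM2l//.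
have sq : `|half_sqdist x (dotp p y, dotp w y) - half_sqdist x' (dotp p y, dotp w' y)| <=
    4 * Num.sqrt (128 * (n + 2)) * Num.sqrt h.
  rewrite /half_sqdist/= -/c -/c'.
  have /andP[t0 t1] := acosr_itv c; have /andP[s0 s1] := acosr_itv c'.
  have -> : 2^-1 * acosr c ^+ 2 - 2^-1 * acosr c' ^+ 2 =
    ((acosr c + acosr c') / 2) * (acosr c - acosr c') by field.
  rewrite normrM -mulrA; apply: ler_pM => //; rewrite ger0_norm; lra.
rewrite mulrDl; apply: le_trans (lerD sq lin).
rewrite -[leRHS]addrC; apply: le_trans (ler_normD _ _).
by rewrite le_eqVlt; apply/orP; left; apply/eqP; congr `|_|; ring.
Qed.

End increment_modulus.

Section two_sided_deviation.
Context (R : realType) dT (T : measurableType dT) (P : probability T R).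
Context dV (V : measurableType dV) (X : nat -> {RV P >-> V}) (mu : probability V R).
Hypothesis X_indep : mutually_independent X.
Hypothesis X_law : identically_distributed X mu.

Lemma chernoff_two_sided (Y : V -> R) b l s n : (0 < n)%N -> measurable_fun setT Y ->
  {ae mu, forall v, `|Y v| <= b} -> mu.-integrable setT (fun v => (Y v)%:E) ->
  mu.-integrable setT (fun v => (Y v ^+ 2)%:E) -> 0 <= l -> l * b <= 2^-1 ->
  measurable [set w | s < `|n%:R^-1 * \sum_(i < n) Y (X i w) - \int[mu]_v Y v|] /\
  (P [set w | (s < `|n%:R^-1 * \sum_(i < n) Y (X i w) - \int[mu]_v Y v|)%R] <=
   (2 * expR (n%:R * (2 * l ^+ 2 * \int[mu]_v (Y v ^+ 2) - l * s)))%R%:E)%E.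
Proof.
move=> n0 mY Yb iY iY2 l0 lb.
have nR : 0 < n%:R :> R by rewrite ltr0n.
have mX i : measurable_fun setT (X i) by exact: measurable_funPT.
have mS : measurable_fun setT (fun w => \sum_(i < n) Y (X i w)).
  by apply: measurable_sum => i; exact: (measurableT_comp mY (mX i)).
have mA : measurable [set w | s < `|n%:R^-1 * \sum_(i < n) Y (X i w) - \int[mu]_v Y v|].
  rewrite -[X in measurable X]setTI; apply: measurable_fun_ltr => //.
  apply: measurableT_comp => //; apply: measurable_funB => //; exact: measurable_funM.
split => //.
have mNY : measurable_fun setT (fun v => - Y v) by exact: measurableT_comp.
have NYb : {ae mu, forall v, `|- Y v| <= b} by apply: filterS Yb => v; rewrite normrN.
have NiY2 : mu.-integrable setT (fun v => ((- Y v) ^+ 2)%:E).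
  by apply: eq_integrable iY2 => // v _; rewrite sqrrN.
have NY : \int[mu]_v (- Y v) = - \int[mu]_v Y v.
  rewrite -mulN1r -RintegralZl//; apply: eq_Rintegral => v _; by rewrite mulN1r.
have NY2 : \int[mu]_v ((- Y v) ^+ 2) = \int[mu]_v (Y v ^+ 2).
  by apply: eq_Rintegral => v _; rewrite sqrrN.
have H1 := chernoff X_indep X_law s n mY Yb iY2 l0 lb.
have H2 := chernoff X_indep X_law s n mNY NYb NiY2 l0 lb.
rewrite NY NY2 in H2.
set A1 := [set w | _] in H1; set A2 := [set w | _] in H2.
have mA1 : measurable A1 by rewrite -[A1]setTI; apply: measurable_fun_ler.
have mA2 : measurable A2.
  rewrite -[A2]setTI; apply: measurable_fun_ler => //.
  by apply: measurable_sum => i; exact: (measurableT_comp mNY (mX i)).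
rewrite mulrDl mul1r EFinD.
apply: (@le_trans _ _ (P (A1 `|` A2))); last first.
  by apply: (le_trans (measureU2 _ mA1 mA2)); exact: leeD.
apply: le_measure; rewrite ?inE//; first exact: measurableU.
move=> w /=; rewrite lter_normr => /orP[L|L]; [left|right]; rewrite /A1 /A2/=.
  by rewrite mulrC -ler_pdivlMr// mulrC; move: L; lra.
rewrite sumrN mulrC -ler_pdivlMr// mulrC; move: L; rewrite mulrN; lra.
Qed.

End two_sided_deviation.

(** * Finite nets and exponential rates *)

Section cells.
Context (R : realType).

Lemma measure_bigsetU_le dT (T : measurableType dT) (P : probability T R) (I : Type)
    (s : seq I) (A : I -> set T) (e : R) :
  (forall i, measurable (A i)) -> (forall i, (P (A i) <= e%:E)%E) ->
  (P (\big[setU/set0]_(i <- s) A i) <= ((size s)%:R * e)%:E)%E.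
Proof.
move=> mA Ae; elim: s => [|i s IH]; first by rewrite big_nil measure0 mul0r.
rewrite big_cons (le_trans (measureU2 _ (mA i) _))//; first exact: bigsetU_measurable.
by rewrite /= -natr1 mulrDl mul1r addrC EFinD; exact: leeD.
Qed.

(* The cell of (x, w) in a cubical grid of mesh 1/N of [0, pi] x [-1, 1]^(k+1). *)
Definition cell k N (t : R * 'rV[R]_k.+1) :
    'I_(4 * N).+1 * {ffun 'I_k.+1 -> 'I_(4 * N).+1} :=
  (inord (Num.truncn (t.1 * N%:R)), [ffun i => inord (Num.truncn ((t.2 ord0 i + 1) * N%:R))]).

(** Equal integer parts mean a difference of at most 1. The range hypotheses ensure that [inord]
    does not fall back on its default value. *)
Lemma truncn_close (a b : R) n : 0 <= a <= n%:R -> 0 <= b <= n%:R ->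
  inord (Num.truncn a) = inord (Num.truncn b) :> 'I_n.+1 -> `|a - b| <= 1.
Proof.
move=> /andP[a0 an] /andP[b0 bn] /(congr1 val)/=.
have T (c : R) : 0 <= c -> c <= n%:R -> (Num.truncn c < n.+1)%N.
  move=> c0 cn; rewrite ltnS -(ler_nat R); apply: le_trans cn.
  by have /andP[] := truncn_itv c0.
rewrite !inordK ?T// => E.
have := truncn_itv a0; have := truncn_itv b0; rewrite E -natr1 => /andP[? ?] /andP[? ?].
by rewrite ler_norml; lra.
Qed.

(** 4 N cells per axis suffice, as pi <= 4 and the coordinates of w shifted by 1 lie in [0, 2]. *)
Lemma cell_close k N (x x' : R) (w w' : 'rV[R]_k.+1) : (0 < N)%N ->
  0 <= x <= pi -> 0 <= x' <= pi -> sphere R k w -> sphere R k w' ->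
  cell N (x, w) = cell N (x', w') ->
  `|x - x'| <= N%:R^-1 /\ forall i, `|w ord0 i - w' ord0 i| <= N%:R^-1.
Proof.
move=> N0 /andP[x0 xpi] /andP[x'0 x'pi] w1 w'1 [E1 E2].
have NR : 0 < N%:R :> R by rewrite ltr0n.
have p4 := pi_le4 R.
have S (a b : R) : `|a * N%:R - b * N%:R| <= 1 -> `|a - b| <= N%:R^-1.
  by rewrite -mulrBl normrM (gtr0_norm NR) -ler_pdivlMr// mul1r.
have W (u : 'rV[R]_k.+1) i : sphere R k u -> 0 <= (u ord0 i + 1) * N%:R <= (4 * N)%:R.
  move=> u1; have := coord_le_enorm u i; rewrite [enorm u]u1 ler_norml => /andP[u2 u3].
  by rewrite natrM mulr_ge0 ?(ltW NR)//= ?ler_wpM2r ?(ltW NR)//; lra.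
split.
  apply: S; apply: truncn_close E1; rewrite natrM mulr_ge0 ?(ltW NR)//= ler_wpM2r ?(ltW NR)//.
    exact: le_trans p4.
  exact: le_trans p4.
move=> i; have -> : w ord0 i - w' ord0 i = (w ord0 i + 1) - (w' ord0 i + 1) by ring.
apply: S; apply: (truncn_close (W w i w1) (W w' i w'1)).
by have := congr1 (fun g : {ffun _ -> _} => g i) E2; rewrite !ffunE.
Qed.

Definition rate (n : nat) : R := n%:R `^ (1 / 6).

Lemma rate_gt0 n : (0 < n)%N -> 0 < rate n.
Proof. by move=> n0; rewrite powR_gt0// ltr0n. Qed.

Lemma rate_exp6 n : rate n ^+ 6 = n%:R.
Proof.
rewrite -powR_mulrn ?powR_ge0// -powRrM.
have -> : 1 / 6 * 6%:R = 1 :> R by field.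
by rewrite powRr1.
Qed.

Lemma expR_decay m (c K : R) : 0 < c -> 0 <= K ->
  (K * (n%:R ^+ 4) ^+ m * expR (- c * rate n ^+ 2)) @[n --> \oo] --> (0 : R).
Proof.
(* q + 1 = 3 (4 m + 1), so the term of order q + 1 of the exponential series at c n^(1/3) is of
   order n^(4m+1), one power more than the polynomial factor. *)
move=> c0 K0; pose q := (3 * (4 * m) + 2)%N.
pose L := K * q.+1`!%:R / c ^+ q.+1.
have L0 : 0 <= L by rewrite divr_ge0 ?mulr_ge0// exprn_ge0// ltW.
have LE n : (0 < n)%N -> K * (n%:R ^+ 4) ^+ m * expR (- c * rate n ^+ 2) <= L * n%:R^-1.
  move=> n0; have nR : 0 < n%:R :> R by rewrite ltr0n.
  have := expR_ge1Dxn q (mulr_ge0 (ltW c0) (sqr_ge0 (rate n))).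
  have -> : (c * rate n ^+ 2) ^+ q.+1 = c ^+ q.+1 * (n%:R ^+ (4 * m) * n%:R).
    rewrite exprMn -exprM -exprSr -(rate_exp6 n) -exprM; congr (_ * _ ^+ _).
    by rewrite /q -addnS addnC -mulnS mulnA.
  set F := q.+1`!%:R; have F0 : 0 < F :> R by rewrite ltr0n fact_gt0.
  have cq : 0 < c ^+ q.+1 by rewrite exprn_gt0.
  rewrite -exprM mulNr expRN => H.
  rewrite ler_pdivrMr ?expR_gt0//.
  have {}H : c ^+ q.+1 * (n%:R ^+ (4 * m) * n%:R) / F <= expR (c * rate n ^+ 2) by lra.
  apply: (@le_trans _ _ (L * n%:R^-1 * (c ^+ q.+1 * (n%:R ^+ (4 * m) * n%:R) / F))).
    rewrite /L -/F le_eqVlt; apply/orP; left; apply/eqP; field.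
    by rewrite !gt_eqF.
  by rewrite ler_wpM2l// mulr_ge0// invr_ge0 ltW.
apply/cvgrPdist_le => e e0; near=> n.
have n0 : (0 < n)%N by near: n; exists 1%N.
rewrite sub0r normrN ger0_norm; last by rewrite !mulr_ge0 ?exprn_ge0 ?expR_ge0.
apply: (le_trans (LE n n0)); have nR : 0 < n%:R :> R by rewrite ltr0n.
rewrite ler_pdivrMr// mulrC -ler_pdivrMr//.
near: n; exact: nbhs_infty_ger.
Unshelve. all: by end_near. Qed.

End cells.

Lemma exprD4_le (R : realFieldType) (x h : R) : 0 <= x -> 0 <= h ->
  (x + h) ^+ 4 <= 8 * x ^+ 4 + 8 * h ^+ 4.
Proof.
move=> x0 h0; have s2 : (x + h) ^+ 2 <= 2 * (x ^+ 2 + h ^+ 2).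
  by have := sqr_ge0 (x - h); nra.
have -> : (x + h) ^+ 4 = ((x + h) ^+ 2) ^+ 2 by ring.
apply: (@le_trans _ _ ((2 * (x ^+ 2 + h ^+ 2)) ^+ 2)).
  by rewrite lerXn2r ?nnegrE ?sqr_ge0// mulr_ge0// addr_ge0 ?sqr_ge0.
rewrite -subr_ge0.
have -> : 8 * x ^+ 4 + 8 * h ^+ 4 - (2 * (x ^+ 2 + h ^+ 2)) ^+ 2 = 4 * (x ^+ 2 - h ^+ 2) ^+ 2.
  by ring.
by rewrite mulr_ge0 ?sqr_ge0.
Qed.

(** * Uniform control of the empirical mean of the increments *)

Section uniform_concentration.
Context (R : realType) (k : nat).
Local Notation d := k.+2.
Variables (mu : probability 'rV[R]_d.+1 R) (p : 'rV[R]_d.+1) (f : R -> R).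
Hypothesis k2 : (2 <= k)%N.
Hypothesis p1 : sphere R d p.
Hypothesis f_meas : measurable_fun `[0, pi] f.
Hypothesis f_ge0 : forall t, 0 <= t <= pi -> 0 <= f t.
Hypothesis mu_density : forall A, measurable A ->
  mu A = (\int[svol R d]_(q in A `&` sphere R d) (f (sdist p q))%:E)%E.
Hypothesis f_bnd :
  exists s M : R, [/\ 0 < s, 0 <= M & forall t, pi - s < t <= pi -> f t <= M].
Variable w0 : 'rV[R]_d.+1.
Hypotheses (w01 : sphere R d w0) (pw0 : dotp p w0 = 0).
Context dT (T : measurableType dT) (P : probability T R).
Variable X : nat -> {RV P >-> 'rV[R]_d.+1}.
Hypothesis X_sphere : forall i w, sphere R d (X i w).
Hypothesis X_indep : mutually_independent X.
Hypothesis X_law : identically_distributed X mu.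

Definition mean_of_incr n x w (o : T) : R :=
  n%:R^-1 * \sum_(i < n) incr x (dotp p (X i o), dotp w (X i o)).

Let level n (x : R) : R := Num.max (x ^+ 4) (rate R n ^+ 4)^-1.

Let bad K x w n : set T :=
  [set o | K * level n x < `|mean_of_incr n x w o - zonal_mean mu p w (incr x)|].

(** The level is at least n^(-2/3), so n times the level is at least n^(1/3). It is also at least
    x^4, so the variance term is absorbed by half of the linear term of the exponent. The second
    moment is taken in the direction [w0] and transferred to w by symmetry, which makes c uniform in
    (x, w). *)
Let bad_small K : 0 < K -> exists2 c : R, 0 < c & forall x w n,
  0 <= x <= pi -> sphere R d w -> dotp p w = 0 -> (0 < n)%N ->
  measurable (bad K x w n) /\ (P (bad K x w n) <= (2 * expR (- c * rate R n ^+ 2))%:E)%E.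
Proof.
move=> K0; have [C C0 HC] := mean_incr_sqr k2 p1 f_meas f_ge0 mu_density f_bnd w01 pw0.
(* The bound 1/64 gives l 32 <= 1/2, where 32 >= 16 + 4 pi bounds the increments; the bound K / (4
   C) gives 2 l^2 C <= l K / 2. *)
pose l : R := Num.min 64^-1 (K / (4 * C)).
have l0 : 0 < l by rewrite lt_min invr_gt0 ltr0n/= divr_gt0// mulr_gt0.
have lb : l * 32 <= 2^-1.
  have : l <= 64^-1 by rewrite ge_min lexx.
  by move: (l) => z; lra.
have lC : l * (4 * C) <= K by rewrite -ler_pdivlMr ?mulr_gt0// ge_min lexx orbT.
exists (l * K / 2) => [|x w n xI w1 pw n0]; first by rewrite divr_gt0// mulr_gt0.
have /andP[x0 xpi] := xI; have p4 := pi_le4 R.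
have mY := measurable_zonal p w (measurable_incr x).
have B32 a b : a ^+ 2 + b ^+ 2 < 1 -> `|incr x (a, b)| <= 32.
  have [D D0 HD] := incr_bound R => ab1; have [_] := HD a b x ab1 x0.
  by move/le_trans; apply; lra.
have Yb : {ae mu, forall v, `|incr x (dotp p v, dotp w v)| <= 32}.
  by apply: filterS (ae_zonal_ball k2 p1 f_meas f_ge0 mu_density w1 pw) => v; exact: B32.
have iY : mu.-integrable setT (fun v => (incr x (dotp p v, dotp w v))%:E).
  apply: (zonal_integrable k2 p1 f_meas f_ge0 mu_density f_bnd w1 pw (C := 32 * 64)).
    exact: measurable_incr.
  move=> a b ab1; apply: (le_trans (B32 a b ab1)).
  by rewrite -mulrA -[leLHS]mulr1 ler_pM2l// (antipodal_ge1 ab1).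
have [C' _ HC'] := mean_incr_sqr k2 p1 f_meas f_ge0 mu_density f_bnd w1 pw.
have [iY2 _] := HC' x x0; have [_ Y2] := HC x x0.
have EY2 : \int[mu]_v (incr x (dotp p v, dotp w v) ^+ 2) <= C * x ^+ 4.
  apply: le_trans Y2; rewrite le_eqVlt; apply/orP; left; apply/eqP.
  apply: (zonal_mean_eq p1 f_meas f_ge0 mu_density w1 pw w01 pw0 (g := fun z => incr x z ^+ 2)).
  by apply: measurable_funX; exact: measurable_incr.
have [mB PB] := chernoff_two_sided X_indep X_law (K * level n x) n0 mY Yb iY iY2 (ltW l0) lb.
split; first exact: mB.
apply: (le_trans PB); rewrite lee_fin ler_pM2l// ler_expR.
have r0 := rate_gt0 R n0; have nE := rate_exp6 R n.
have lv1 : x ^+ 4 <= level n x by rewrite le_max lexx.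
have lv2 : (rate R n ^+ 4)^-1 <= level n x by rewrite le_max lexx orbT.
have lv0 : 0 <= level n x by apply: le_trans lv1; rewrite exprn_ge0.
have nlv : rate R n ^+ 2 <= n%:R * level n x.
  have -> : rate R n ^+ 2 = n%:R * (rate R n ^+ 4)^-1.
    by rewrite -nE; field; rewrite gt_eqF.
  by rewrite ler_wpM2l.
set E := \int[mu]_v _ in EY2 *.
have H1 : 2 * l ^+ 2 * E <= l * (K / 2) * level n x.
  apply: (@le_trans _ _ (2 * l ^+ 2 * (C * level n x))).
    apply: ler_wpM2l; first by rewrite mulr_ge0 ?sqr_ge0.
    by apply: (le_trans EY2); apply: ler_wpM2l => //; exact: ltW.
  have -> : 2 * l ^+ 2 * (C * level n x) = l * (l * (4 * C) / 2) * level n x by field.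
  by apply: ler_wpM2r => //; apply: ler_wpM2l; [exact: ltW|exact: ler_wpM2r].
apply: (@le_trans _ _ (n%:R * (- (l * K / 2) * level n x))).
  by rewrite ler_wpM2l//; move: H1; lra.
rewrite mulrCA !mulNr lerN2; apply: ler_wpM2l => //.
by apply: ltW; rewrite divr_gt0// mulr_gt0.
Qed.

Let params (t : R * 'rV[R]_d.+1) :=
  [/\ 0 <= t.1 <= pi, sphere R d t.2 & dotp p t.2 = 0].

(** [B n] collects the bad events of one admissible representative per cell; the cells that contain
    no admissible pair get the default (0, w0). Off [B n], an arbitrary pair is compared with the
    representative of its cell. *)
Lemma uniform_concentration K : 0 < K -> exists B : nat -> set T,
  [/\ forall n, (0 < n)%N -> measurable (B n),
      forall e : R, 0 < e -> \forall n \near \oo, (P (B n) <= e%:E)%E &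
      \forall n \near \oo, forall o, ~ B n o -> forall x w,
        0 <= x <= pi -> sphere R d w -> dotp p w = 0 ->
        `|mean_of_incr n x w o -
          (zonal_mean mu p w0 (half_sqdist x) - zonal_mean mu p w0 (half_sqdist 0))| <=
        K * Num.max (x ^+ 4) (rate R n ^+ 4)^-1].
Proof.
(* The final count is 8 x^4 + 9 u from the level at the representative plus u from the
   discretization, at most 18 times the maximum; 20 leaves room. *)
move=> K0; have K20 : 0 < K / 20 by rewrite divr_gt0.
have [c c0 Pbad] := bad_small K20; have [C C0 modulus] := incr_modulus R d.
have repE n : {r : 'I_(4 * n ^ 4).+1 * {ffun 'I_d.+1 -> 'I_(4 * n ^ 4).+1} -> R * 'rV[R]_d.+1 |
    forall z, params (r z) /\ forall t, params t -> cell (n ^ 4) t = z -> cell (n ^ 4) (r z) = z}.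
  apply: cid; suff /choice[r rP] : forall z, exists t', params t' /\
      forall t, params t -> cell (n ^ 4) t = z -> cell (n ^ 4) t' = z by exists r.
  move=> z; have [[t [tp tz]]|H] := pselect (exists t, params t /\ cell (n ^ 4) t = z).
    by exists t; split.
  exists (0, w0); split; first by split; rewrite //= lexx pi_ge0.
  by move=> t tp tz; exfalso; apply: H; exists t.
pose rep n := sval (repE n).
have repP n z : params (rep n z) by have [] := svalP (repE n) z.
have repC n t : params t -> cell (n ^ 4) (rep n (cell (n ^ 4) t)) = cell (n ^ 4) t.
  by move=> tp; have [_ /(_ t tp erefl)] := svalP (repE n) (cell (n ^ 4) t).
pose B n := \big[setU/set0]_z bad (K / 20) (rep n z).1 (rep n z).2 n.
have mbad n z : (0 < n)%N -> measurable (bad (K / 20) (rep n z).1 (rep n z).2 n).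
  by move=> n0; have [h1 h2 h3] := repP n z; have [] := Pbad _ _ n h1 h2 h3 n0.
have p4 := pi_le4 R.
exists B; split.
- by move=> n n0; apply: bigsetU_measurable => z _; exact: mbad.
(* m = d + 2 counts the axes of the grid, one for x and d + 1 for w; the number of cells is at most
   (5 n^4)^m. *)
- move=> e e0; pose m := d.+2.
  have KK : 0 <= 2 * 5 ^+ m :> R by rewrite mulr_ge0// exprn_ge0.
  have /cvgrPdist_le /(_ e e0) decay := expR_decay m c0 KK.
  near=> n; have n0 : (0 < n)%N by near: n; exists 1%N.
  have PB : forall z, (P (bad (K / 20) (rep n z).1 (rep n z).2 n) <=
      (2 * expR (- c * rate R n ^+ 2))%:E)%E.
    by move=> z; have [h1 h2 h3] := repP n z; have [] := Pbad _ _ n h1 h2 h3 n0.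
  apply: (le_trans (measure_bigsetU_le _ (fun z => mbad n z n0) PB)); rewrite lee_fin.
  have dn : `|0 - 2 * 5 ^+ m * (n%:R ^+ 4) ^+ m * expR (- c * rate R n ^+ 2)| <= e by near: n.
  apply: le_trans dn; rewrite sub0r normrN ger0_norm; last first.
    apply: mulr_ge0; last exact: expR_ge0.
    by apply: mulr_ge0 => //; apply: exprn_ge0; exact: exprn_ge0.
  have -> : 2 * 5 ^+ m * (n%:R ^+ 4) ^+ m * expR (- c * rate R n ^+ 2) =
    (5 * n%:R ^+ 4) ^+ m * (2 * expR (- c * rate R n ^+ 2)).
    have I (a b e' : R) : 2 * a * b * e' = a * b * (2 * e') by ring.
    by rewrite (exprMn m 5 (n%:R ^+ 4)); exact: I.
  apply: ler_wpM2r; first by rewrite mulr_ge0 ?expR_ge0.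
  have -> : size (index_enum ('I_(4 * n ^ 4).+1 * {ffun 'I_d.+1 -> 'I_(4 * n ^ 4).+1})%type) =
      ((4 * n ^ 4).+1 ^ m)%N.
    rewrite -[LHS]/(size (index_enum _)) -[index_enum _]enumT -cardE.
    by rewrite card_prod card_ffun !card_ord -expnS.
  rewrite natrX lerXn2r ?nnegrE ?mulr_ge0 ?exprn_ge0// -natr1 natrM natrX.
  have : 1 <= n%:R ^+ 4 :> R by rewrite exprn_ege1// ler1n.
  lra.
near=> n => o no x w xI w1 pw.
have n0 : (0 < n)%N by near: n; exists 1%N.
have nR : 0 < n%:R :> R by rewrite ltr0n.
have n1 : 1 <= n%:R :> R by rewrite ler1n.
have nC : (C + 4) / (K / 20) <= n%:R by near: n; exact: nbhs_infty_ger.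
have N0 : (0 < n ^ 4)%N by rewrite expn_gt0 n0.
set z := cell (n ^ 4) (x, w); have tp : params (x, w) by [].
have := repP n z; have := repC n _ tp; rewrite -/z.
have nbad : ~ bad (K / 20) (rep n z).1 (rep n z).2 n o.
  move=> zo; apply: no; rewrite /B -bigcup_seq; exists z => //=.
  exact: mem_index_enum.
case: (rep n z) nbad => x' w' nbad zE [/= x'I w'1 pw'].
have [xx' ww'] := cell_close N0 xI x'I w1 w'1 (esym zE).
set h := (n ^ 4)%:R^-1 in xx' ww'.
have hE : h = (n%:R ^+ 4)^-1 by rewrite /h natrX.
have h0 : 0 < h by rewrite hE invr_gt0 exprn_gt0.
have h1 : h <= 1 by rewrite hE invf_le1 ?exprn_gt0// exprn_ege1.
have sh : Num.sqrt h = (n%:R ^+ 2)^-1.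
  by rewrite hE -[4%N]/(2 * 2)%N exprM -exprVn sqrtr_sqr ger0_norm// invr_ge0 exprn_ge0.
set Phi := fun x => zonal_mean mu p w0 (half_sqdist x).
have mean_eq u v : sphere R d v -> dotp p v = 0 ->
    zonal_mean mu p v (incr u) = Phi u - Phi 0.
  move=> v1 pv; rewrite -(mean_incr k2 p1 f_meas f_ge0 mu_density f_bnd w01 pw0).
  by apply: (zonal_mean_eq p1 f_meas f_ge0 mu_density) => //; exact: measurable_incr.
have D1 : `|mean_of_incr n x w o - mean_of_incr n x' w' o| <= C * Num.sqrt h.
  rewrite /mean_of_incr -mulrBr -sumrB normrM ger0_norm ?invr_ge0//.
  rewrite mulrC ler_pdivrMr// (le_trans (ler_norm_sum _ _ _))//.
  rewrite -[X in _ * X%:R]card_ord -sum1_card natr_sum mulr_sumr ler_sum// => i _.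
  by rewrite mulr1; apply: modulus.
have D2 : `|Phi x - Phi x'| <= 4 * h.
  have L := zmean_lip k2 p1 f_meas f_ge0 mu_density f_bnd w01 pw0.
  have [xy|/ltW yx] := leP x x'.
    by rewrite distrC (le_trans (L _ _ xy))// ler_pM2l// (le_trans _ xx')// distrC ler_norm.
  by rewrite (le_trans (L _ _ yx))// ler_pM2l// (le_trans _ xx')// ler_norm.
have D3 : `|mean_of_incr n x' w' o - (Phi x' - Phi 0)| <= K / 20 * level n x'.
  by rewrite -(mean_eq x' w')// leNgt; apply/negP.
have r0 := rate_gt0 R n0; have nE := rate_exp6 R n.
have r1 : 1 <= rate R n by rewrite -(@ler_pXn2r _ 6) ?nnegrE// ?(ltW r0)// expr1n nE.
set u := (rate R n ^+ 4)^-1; have u0 : 0 < u by rewrite invr_gt0 exprn_gt0.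
have nu : n%:R^-1 <= u.
  by rewrite lef_pV2 ?posrE ?exprn_gt0// -nE ler_weXn2l.
have hu : h <= u.
  apply: le_trans nu; rewrite hE lef_pV2 ?posrE ?exprn_gt0//.
  by rewrite -[leLHS]expr1 ler_weXn2l.
have /andP[x0 _] := xI; have /andP[x'0 _] := x'I.
have lv' : level n x' <= 8 * x ^+ 4 + 9 * u.
  rewrite ge_max; apply/andP; split; last first.
    by rewrite -/u; have x4 := exprn_ge0 4 x0; move: (x ^+ 4) x4 => v v0; lra.
  have xh : x' <= x + h by move: xx'; rewrite ler_norml => /andP[]; lra.
  apply: (@le_trans _ _ ((x + h) ^+ 4)); first by rewrite lerXn2r ?nnegrE// addr_ge0// ltW.
  have := exprD4_le x0 (ltW h0).
  have h4 : h ^+ 4 <= u.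
    by apply: le_trans hu; rewrite exprS -[leRHS]mulr1 ler_wpM2l ?(ltW h0)// exprn_ile1// ltW.
  by move: (h ^+ 4) h4 (x ^+ 4) ((x + h) ^+ 4) => a a1 b b1 H; lra.
(* The mesh n^(-4) yields a discretization error of order n^(-2), while u >= 1/n; the choice of n in
   [nC] pays for the constants. *)
have D4 : C * Num.sqrt h + 4 * h <= K / 20 * u.
  have hs : h <= Num.sqrt h.
    by rewrite -{1}(sqr_sqrtr (ltW h0)) expr2 ler_piMl ?sqrtr_ge0// -sqrtr1 ler_wsqrtr.
  apply: (@le_trans _ _ ((C + 4) * Num.sqrt h)); first by move: hs; lra.
  rewrite sh; apply: (@le_trans _ _ (K / 20 * n%:R^-1)); last by rewrite ler_pM2l.
  rewrite ler_pdivrMr// in nC; rewrite ler_pdivrMr ?exprn_gt0//.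
  have -> : K / 20 * n%:R^-1 * n%:R ^+ 2 = K / 20 * n%:R by field; rewrite gt_eqF.
  by rewrite mulrC.
have -> : mean_of_incr n x w o - (Phi x - Phi 0) =
  (mean_of_incr n x w o - mean_of_incr n x' w' o) +
  (mean_of_incr n x' w' o - (Phi x' - Phi 0)) - (Phi x - Phi x') by ring.
rewrite (le_trans (ler_normB _ _))//.
have T2 := ler_normD (mean_of_incr n x w o - mean_of_incr n x' w' o)
  (mean_of_incr n x' w' o - (Phi x' - Phi 0)).
have D3' : `|mean_of_incr n x' w' o - (Phi x' - Phi 0)| <= K / 20 * (8 * x ^+ 4 + 9 * u).
  by apply: (le_trans D3); rewrite ler_pM2l.
set M := Num.max (x ^+ 4) u.
have M1 : x ^+ 4 <= M by rewrite le_max lexx.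
have M2 : u <= M by rewrite le_max lexx orbT.
have : K / 20 * (8 * x ^+ 4 + 9 * u) + K / 20 * u <= K * M.
  have -> : K * M = K / 20 * (20 * M) by field.
  by rewrite -mulrDr ler_pM2l//; move: (x ^+ 4) (M) M1 M2 => a b M1 M2; lra.
move: D1 D2 D4 D3' T2; lra.
Unshelve. all: by end_near. Qed.

End uniform_concentration.

(** * Minimizers and convergence in distribution *)

Section quartic_minimization.
Context (R : realType) (n : nat).
Implicit Types (a h Z : 'rV[R]_n).

Lemma enormN a : enorm (- a) = enorm a.
Proof. by rewrite -scaleN1r enormZ normrN normr1 mul1r. Qed.

Lemma dotp_le_enorm a h : dotp a h <= enorm a * enorm h.
Proof. exact: le_trans (ler_norm _) (CauchySchwarz a h). Qed.

(** With v = h - a, A = |a|^2, D = |v|^2 and s = <a, v>, the difference of the two sides is 2 (A D -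
    s^2) + 6 (s + D / 3)^2, nonnegative by Cauchy-Schwarz. The constant 1/3 is sharp, with equality
    at v = - 3 a. *)
Lemma enorm4_expansion a h : enorm a ^+ 4 + 4 * enorm a ^+ 2 * dotp a (h - a) +
  enorm (h - a) ^+ 4 / 3 <= enorm h ^+ 4.
Proof.
set v := h - a; have hE : h = a + v by rewrite addrC subrK.
have h2 : enorm h ^+ 2 = enorm a ^+ 2 + 2 * dotp a v + enorm v ^+ 2.
  have sq (x y : 'rV[R]_n) : enorm (x + y) ^+ 2 = enorm x ^+ 2 + 2 * dotp x y + enorm y ^+ 2.
    by rewrite !enorm_sqr !(dotpDl, dotpDr) [dotp y x]dotpC; ring.
  by rewrite [in LHS]hE sq.
have cs : dotp a v ^+ 2 <= enorm a ^+ 2 * enorm v ^+ 2.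
  rewrite -exprMn -[leLHS](@real_normK _ _) ?num_real//.
  by rewrite lerXn2r ?nnegrE ?mulr_ge0 ?enorm_ge0// CauchySchwarz.
have -> : enorm h ^+ 4 = (enorm h ^+ 2) ^+ 2 by ring.
have -> : enorm v ^+ 4 = (enorm v ^+ 2) ^+ 2 by ring.
have -> : enorm a ^+ 4 = (enorm a ^+ 2) ^+ 2 by ring.
rewrite h2; move: (enorm a ^+ 2) (enorm v ^+ 2) (dotp a v) cs => A D s cs.
rewrite -subr_ge0; have -> : (A + 2 * s + D) ^+ 2 - (A ^+ 2 + 4 * A * s + D ^+ 2 / 3) =
  2 * (A * D - s ^+ 2) + 6 * (s + D / 3) ^+ 2 by field.
by rewrite addr_ge0// mulr_ge0 ?sqr_ge0// subr_ge0.
Qed.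

Lemma smearN0 b : smear b (0 : 'rV[R]_n) = 0.
Proof. by rewrite /smear scaler0. Qed.

(* [smear b Z] is the critical point of h |-> b / 24 |h|^4 - <h, Z>. *)
Lemma smear_gradient b Z : 0 < b ->
  (b / 6 * enorm (smear b Z) ^+ 2) *: smear b Z = Z.
Proof.
move=> b0; have [->|Z0] := eqVneq Z 0; first by rewrite smearN0 scaler0.
have z0 : 0 < enorm Z by rewrite lt_neqAle enorm_ge0 eq_sym enorm_eq0 Z0.
set z := enorm Z in z0 *.
pose c6 : R := 6 `^ (1 / 3); pose cb := b `^ (- (1 / 3)); pose cz := z `^ (- (2 / 3)).
have cube (x y e : R) : 0 < x -> e * 3 = y -> (x `^ e) ^+ 3 = x `^ y.
  by move=> x0 <-; rewrite -powR_mulrn ?powR_ge0// -powRrM.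
have c63 : c6 ^+ 3 = 6 by rewrite (cube 6 1)// ?powRr1//; field.
have cb3 : cb ^+ 3 = b^-1 by rewrite (cube b (- 1))// ?powR_inv1 ?ltW//; field.
have cz3 : cz ^+ 3 = z^-1 ^+ 2.
  rewrite (cube z (- 2))//; last by field.
  by rewrite powRN powR_mulrn ?ltW// exprVn.
have c0 : 0 <= c6 * cb * cz by rewrite !mulr_ge0 ?powR_ge0.
rewrite /smear -/c6 -/cb -/z -/cz enormZ (ger0_norm c0) -/z scalerA.
have -> : b / 6 * (c6 * cb * cz * z) ^+ 2 * (c6 * cb * cz) = 1.
  have -> : b / 6 * (c6 * cb * cz * z) ^+ 2 * (c6 * cb * cz) =
    b / 6 * (c6 ^+ 3) * (cb ^+ 3) * (cz ^+ 3) * z ^+ 2 by ring.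
  by rewrite c63 cb3 cz3; field; rewrite !gt_eqF.
by rewrite scale1r.
Qed.

Lemma smear_norm b Z : 0 < b -> b / 6 * enorm (smear b Z) ^+ 3 = enorm Z.
Proof.
move=> b0; apply: (etrans _ (congr1 (@enorm R n) (smear_gradient Z b0))).
rewrite (enormZ (b / 6 * enorm (smear b Z) ^+ 2) (smear b Z)) ger0_norm; first by ring.
by rewrite mulr_ge0 ?sqr_ge0// divr_ge0// ltW.
Qed.

Lemma smear_bound b Z B : 0 < b -> enorm Z <= B -> enorm (smear b Z) <= 1 + 6 * B / b.
Proof.
move=> b0 ZB; have := smear_norm Z b0; set s := enorm (smear b Z) => sE.
have s0 : 0 <= s by exact: enorm_ge0.
have B0 : 0 <= B by apply: le_trans ZB; exact: enorm_ge0.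
have [s1|s1] := leP s 1; first by rewrite (le_trans s1)// lerDl divr_ge0 ?mulr_ge0// ltW.
rewrite -[leLHS]add0r lerD// ler_pdivlMr//.
apply: (@le_trans _ _ (s ^+ 3 * b)).
  by rewrite ler_wpM2r ?(ltW b0)// -[leLHS]expr1 ler_weXn2l// ltW.
by move: ZB; rewrite -sE; lra.
Qed.

(** Adding the quartic inequality at the two images, in both orders, gives strong monotonicity of
    the gradient map that [smear] inverts, hence 1/3-Holder continuity of [smear]. This avoids the
    negative power in its formula and covers the origin. *)
Lemma smear_holder b Z Z' : 0 < b ->
  enorm (smear b Z - smear b Z') ^+ 3 <= 36 / b * enorm (Z - Z').
Proof.
move=> b0; have := smear_gradient Z b0; have := smear_gradient Z' b0.
move: (smear b Z) (smear b Z') => h a ga gh.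
have := enorm4_expansion a h; have := enorm4_expansion h a.
have E : enorm (a - h) = enorm (h - a) by rewrite -enormN opprB.
rewrite E; set D := enorm (h - a); have D0 : 0 <= D by exact: enorm_ge0.
have cs := dotp_le_enorm (Z - Z') (h - a); rewrite -/D in cs.
have dE : dotp (Z - Z') (h - a) = - (b / 6 * (enorm h ^+ 2 * dotp h (a - h))) -
    b / 6 * (enorm a ^+ 2 * dotp a (h - a)).
  rewrite -[in LHS]gh -[in LHS]ga dotpDl dotpNl !dotpZl.
  by rewrite -[X in _ * _ * dotp h X]opprB dotpNr; ring.
move=> H1 H2; have [D1|D1] := eqVneq D 0.
  by rewrite D1 expr0n mulr_ge0 ?enorm_ge0// divr_ge0// ltW.
have {}D1 : 0 < D by rewrite lt_neqAle eq_sym D1.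
rewrite -(@ler_pM2r _ D)// -exprSr; set z := enorm (Z - Z') in cs *.
have key : D ^+ 4 / 3 * 2 <= 4 * (6 / b) * dotp (Z - Z') (h - a).
  have -> : 4 * (6 / b) * dotp (Z - Z') (h - a) =
    - (4 * enorm h ^+ 2 * dotp h (a - h)) - 4 * enorm a ^+ 2 * dotp a (h - a).
    by rewrite dE; field; rewrite gt_eqF.
  by move: H1 H2; lra.
have k2 : 4 * (6 / b) * dotp (Z - Z') (h - a) <= 4 * (6 / b) * (z * D).
  by rewrite ler_wpM2l// mulr_ge0// divr_ge0// ltW.
have -> : 36 / b * z * D = (4 * (6 / b) * (z * D)) * (3 / 2) by field; rewrite gt_eqF.
by lra.
Qed.

End quartic_minimization.

Section argmin.
Context (R : realType) (k : nat).
Variables (p w0 : 'rV[R]_k.+1) (G : R -> R) (b c : R).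
Hypotheses (w01 : sphere R k w0) (pw0 : dotp p w0 = 0) (b0 : 0 < b) (c0 : 0 < c).
Hypothesis G0 : G 0 = 0.
Hypothesis G_growth : forall x, 0 <= x <= pi -> c * x ^+ 4 <= G x.
Hypothesis G_quartic : forall e, 0 < e -> exists2 s : R, 0 < s &
  forall x, 0 <= x < s -> `|G x - b / 24 * x ^+ 4| <= e * x ^+ 4.

Let params (x : R) (w : 'rV[R]_k.+1) := [/\ 0 <= x <= pi, sphere R k w & dotp p w = 0].

Lemma tangent_direction (v : 'rV[R]_k.+1) : dotp p v = 0 ->
  exists w, [/\ sphere R k w, dotp p w = 0 & v = enorm v *: w].
Proof.
move=> pv; have [->|v0] := eqVneq v 0; first by exists w0; rewrite enorm0 scale0r.
have n0 : enorm v != 0 by rewrite enorm_eq0.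
exists ((enorm v)^-1 *: v); split.
- by rewrite /sphere/= enormZ normfV ger0_norm ?enorm_ge0// mulVf.
- by rewrite dotpZr pv mulr0.
- by rewrite scalerA divff// scale1r.
Qed.

(* r is the scale n^(1/6), M the rescaled centred empirical process. *)
Lemma argmin_smear (B e : R) : 0 < e -> 0 <= B -> exists K r0 : R, [/\ 0 < K, 0 < r0 &
  forall (r : R) (Z : 'rV[R]_k.+1) (M : R -> 'rV[R]_k.+1 -> R) x w,
  r0 <= r -> dotp p Z = 0 -> enorm Z <= B -> params x w ->
  (forall x w, params x w -> `|M x w - G x| <= K * Num.max (x ^+ 4) (r ^+ 4)^-1) ->
  (forall x' w', params x' w' -> r ^+ 4 * M x w - r * x * dotp w Z <=
     r ^+ 4 * M x' w' - r * x' * dotp w' Z) ->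
  x < pi /\ enorm ((r * x) *: w - smear b Z) <= e].
Proof.
(* [Y0] will bound the rescaled minimizer, by comparison with p; [Y1] bounds [smear b Z]. *)
move=> e0 B0; pose Y0 := 1 + 2 * B / c; pose Y1 := 1 + 6 * B / b.
pose Y := Y0 + Y1; pose Q := 4 * (Y ^+ 4 + 1).
have Y00 : 1 <= Y0 by rewrite lerDl divr_ge0 ?mulr_ge0// ltW.
have Y10 : 1 <= Y1 by rewrite lerDl divr_ge0 ?mulr_ge0// ltW.
have Yge : 0 <= Y by rewrite /Y; lra.
have Y4 : 0 <= Y ^+ 4 by exact: exprn_ge0.
have Q0 : 0 < Q by rewrite /Q; lra.
(* c / 4 leaves most of the quartic growth for the localization. The second bound makes K [Q] at
   most b e^4 / 72, where [Q] dominates four errors: two from replacing G by its quartic, two from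
   replacing M by G. *)
pose K := Num.min (c / 4) (b * e ^+ 4 / 72 / Q).
have K0 : 0 < K by rewrite lt_min !divr_gt0// mulr_gt0// exprn_gt0.
have Kc : K <= c / 4 by rewrite ge_min lexx.
have KQ : K * Q <= b * e ^+ 4 / 72 by rewrite -ler_pdivlMr// ge_min lexx orbT.
have [s s0 sP] := G_quartic K0.
(* For r >= [r0] a rescaled radius at most [Y] corresponds to x < min(s, pi), where the quartic
   approximation holds and the logarithm is defined. *)
have pi0 := pi_gt0 R; pose s' := Num.min s pi; have s'0 : 0 < s' by rewrite lt_min s0.
pose r0 := (Y + 1) / s'; have r00 : 0 < r0 by rewrite divr_gt0//; lra.
exists K, r0; split => // r Z M x w rr0 pZ ZB xw MG opt.
have r_gt0 : 0 < r by exact: lt_le_trans rr0.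
have r4 : 0 < r ^+ 4 by rewrite exprn_gt0.
have [/andP[x0 xpi] w1 pw] := xw.
have MG' u v : params u v ->
    `|r ^+ 4 * M u v - r ^+ 4 * G u| <= K * Num.max ((r * u) ^+ 4) 1.
  move=> /MG H; rewrite -mulrBr normrM (gtr0_norm r4).
  apply: (le_trans (ler_wpM2l (ltW r4) H)); rewrite mulrCA ler_pM2l//.
  by rewrite maxr_pMr ?(ltW r4)// (exprMn 4 r u) divff// gt_eqF.
have max_le (u : R) : 0 <= u -> Num.max u 1 <= u + 1.
  by move=> u0; rewrite ge_max lerDl lerDr ler01.
have small u : 0 <= u -> r * u <= Y -> [/\ 0 <= u < s, u < pi & 0 <= (r * u) ^+ 4 <= Y ^+ 4].
  move=> u0 ruY; have us : u < s'.
    rewrite -(ltr_pM2l r_gt0) (le_lt_trans ruY)// (@lt_le_trans _ _ (r0 * s'))//.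
      by rewrite /r0 divfK ?gt_eqF// ltrDl.
    by rewrite ler_pM2r.
  have ru0 : 0 <= r * u by rewrite mulr_ge0// ltW.
  split; [|by move: us; rewrite lt_min => /andP[]|by rewrite exprn_ge0//= lerXn2r ?nnegrE].
  by rewrite u0; move: us; rewrite lt_min => /andP[].
set y := r * x; have y0 : 0 <= y by rewrite mulr_ge0// ltW.
have y4 : 0 <= y ^+ 4 by exact: exprn_ge0.
have wZ : dotp w Z <= B.
  by rewrite (le_trans (dotp_le_enorm _ _))// [enorm w]w1 mul1r.
have P0 : params 0 w0 by split; rewrite ?lexx ?pi_ge0.
(* Localization: comparing with x = 0 and using the growth c x^4 gives 3 c / 4 y^4 <= c / 2 + y B
   when y > 1, which bounds y. *)
have yY : y <= Y.
  have [y1|y1] := leP y 1; first by rewrite /Y; lra.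
  have := opt 0 w0 P0; have := MG' _ _ P0; have := MG' _ _ xw.
  rewrite G0 !mulr0 expr0n/= mul0r !subr0 -/y !ler_norml => /andP[H1 _] /andP[_ H2] H3.
  have H4 := max_le _ y4; have H5 : Num.max (0 : R) 1 = 1 by rewrite max_r.
  rewrite H5 mulr1 in H2.
  have gr := G_growth (introT andP (conj x0 xpi)).
  have gr4 : c * y ^+ 4 <= r ^+ 4 * G x.
    by rewrite /y exprMn mulrCA ler_pM2l.
  have yB : y * dotp w Z <= y * B by rewrite ler_wpM2l.
  have KH : K * Num.max (y ^+ 4) 1 <= K * (y ^+ 4 + 1) by rewrite ler_pM2l.
  have Ky : K * (y ^+ 4 + 1) + K <= c / 4 * (y ^+ 4 + 2).
    have -> : K * (y ^+ 4 + 1) + K = K * (y ^+ 4 + 2) by ring.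
    by rewrite ler_wpM2r// addr_ge0.
  have main : 3 * c / 4 * y ^+ 4 <= c / 2 + y * B by move: H1 H2 H3 gr4 yB KH Ky; lra.
  have y3 : 1 <= y ^+ 3 by rewrite exprn_ege1// ltW.
  have yy3 : y <= y ^+ 3 by rewrite -[leLHS]expr1 ler_weXn2l// ltW.
  have yB3 : y * B <= y ^+ 3 * B by rewrite ler_wpM2r.
  have c3 : c / 2 <= c / 2 * y ^+ 3 by rewrite -[leLHS]mulr1 ler_wpM2l// divr_ge0// ltW.
  have : (3 * c / 4 * y) * y ^+ 3 <= (c / 2 + B) * y ^+ 3.
    have -> : 3 * c / 4 * y * y ^+ 3 = 3 * c / 4 * y ^+ 4 by ring.
    by move: main yB3 c3; lra.
  rewrite ler_pM2r; last by rewrite (lt_le_trans _ y3).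
  move=> yc; have : y <= Y0; last by rewrite /Y; lra.
  rewrite /Y0; have -> : 1 + 2 * B / c = (c + 2 * B) / c by field; rewrite gt_eqF.
  by rewrite ler_pdivlMr//; move: yc; nra.
have [xs xp /andP[_ y4Y]] := small x x0 yY.
split=> //; set H := smear b Z; set h := y *: w.
have pH : dotp p H = 0 by rewrite /H /smear dotpZr pZ mulr0.
(* The competitor is the point whose rescaled logarithm is exactly H = [smear b Z]; the quartic
   inequality at H then turns near-minimality into closeness. *)
have [w' [w'1 pw' HE]] := tangent_direction pH.
set y' := enorm H in HE; have y'0 : 0 <= y' by exact: enorm_ge0.
have y'Y : y' <= Y by rewrite (le_trans (smear_bound b0 ZB))// -/Y1 /Y; lra.
pose x' := y' / r; have x'0 : 0 <= x' by rewrite divr_ge0// ltW.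
have rx' : r * x' = y' by rewrite /x' mulrC divfK// gt_eqF.
have x'Y : r * x' <= Y by rewrite rx'.
have [x's x'p] := small x' x'0 x'Y; rewrite rx' => /andP[y'4 y'4Y].
have P' : params x' w' by split; rewrite // x'0 ltW.
have hn : enorm h = y by rewrite enormZ [enorm w]w1 mulr1 ger0_norm.
have HZ : y' * dotp w' Z = dotp H Z by rewrite HE dotpZl.
have hZ : y * dotp w Z = dotp h Z by rewrite dotpZl.
have := opt x' w' P'; rewrite rx' -/y HZ hZ.
have := MG' _ _ P'; have := MG' _ _ xw; rewrite rx' -/y.
have := sP x xs; have := sP x' x's.
rewrite !ler_norml => /andP[_ g1] /andP[g2 _] /andP[m1 _] /andP[_ m2] H3.
have g1' : r ^+ 4 * G x' <= (b / 24 + K) * y' ^+ 4.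
  have -> : (b / 24 + K) * y' ^+ 4 = r ^+ 4 * (b / 24 * x' ^+ 4 + K * x' ^+ 4).
    by rewrite -rx' exprMn; ring.
  by rewrite ler_pM2l//; move: g1; lra.
have g2' : (b / 24 - K) * y ^+ 4 <= r ^+ 4 * G x.
  have -> : (b / 24 - K) * y ^+ 4 = r ^+ 4 * (b / 24 * x ^+ 4 - K * x ^+ 4).
    by rewrite /y exprMn; ring.
  by rewrite ler_pM2l//; move: g2; lra.
have := max_le _ y4; have := max_le _ y'4; rewrite -(ler_pM2l K0) => n1; rewrite -(ler_pM2l K0) => n2.
have := enorm4_expansion H h; rewrite -/y' hn => ex.
have grad : b / 6 * y' ^+ 2 * dotp H (h - H) = dotp h Z - dotp H Z.
  by rewrite -dotpZl /y' smear_gradient// dotpBr ![dotp Z _]dotpC.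
have ex' : b / 24 * y' ^+ 4 + (dotp h Z - dotp H Z) + b / 72 * enorm (h - H) ^+ 4 <= b / 24 * y ^+ 4.
  rewrite -grad; have -> : b / 24 * y' ^+ 4 + b / 6 * y' ^+ 2 * dotp H (h - H) +
    b / 72 * enorm (h - H) ^+ 4 = b / 24 * (y' ^+ 4 + 4 * y' ^+ 2 * dotp H (h - H) +
    enorm (h - H) ^+ 4 / 3) by field.
  by rewrite ler_pM2l// divr_gt0.
have fin : b / 72 * enorm (h - H) ^+ 4 <= K * Q.
  have k1 : K * y ^+ 4 <= K * Y ^+ 4 by rewrite ler_pM2l.
  have k2 : K * y' ^+ 4 <= K * Y ^+ 4 by rewrite ler_pM2l.
  have -> : K * Q = 4 * (K * Y ^+ 4) + 4 * K by rewrite /Q; ring.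
  by move: ex' H3 m1 m2 g1' g2' n1 n2 k1 k2 K0; lra.
have b72 : 0 < b / 72 by rewrite divr_gt0.
have {}fin : enorm (h - H) ^+ 4 <= e ^+ 4.
  rewrite -(ler_pM2l b72) (le_trans fin)// (le_trans KQ)// le_eqVlt.
  by apply/orP; left; apply/eqP; field.
by rewrite -(@ler_pXn2r _ 4) ?nnegrE ?enorm_ge0// ltW.
Qed.

End argmin.

(** * Continuity in terms of the Euclidean norm *)

Section euclidean_topology.
Context (R : realType) (n : nat).
Implicit Types (u v x y : 'rV[R]_n).

Lemma enorm_triangle u v : enorm (u + v) <= enorm u + enorm v.
Proof.
rewrite -(@ler_pXn2r _ 2) ?nnegrE ?addr_ge0 ?enorm_ge0//.
have -> : enorm (u + v) ^+ 2 = enorm u ^+ 2 + 2 * dotp u v + enorm v ^+ 2.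
  by rewrite !enorm_sqr !(dotpDl, dotpDr) [dotp v u]dotpC; ring.
by have := dotp_le_enorm u v; rewrite sqrrD; lra.
Qed.

Lemma enorm_dist u v : `|enorm u - enorm v| <= enorm (u - v).
Proof.
have := enorm_triangle (u - v) v; have := enorm_triangle (v - u) u.
rewrite !subrK -(enormN (v - u)) opprB => H1 H2.
by rewrite ler_norml; apply/andP; split; lra.
Qed.

Lemma nbhs_enormP x (A : set 'rV[R]_n) :
  nbhs x A <-> exists2 e : R, 0 < e & forall y, enorm (x - y) < e -> A y.
Proof.
split=> [/nbhs_ballP[e /= e0 eA]|[e e0 eA]].
  exists e => // y xy; apply: eA; split=> // i j; rewrite -ball_normE /= !ord1.
  by have := coord_le_enorm (x - y) j; rewrite !mxE => /le_lt_trans; apply.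
(* A sup-norm radius e / (n+1) suffices since n / (n+1)^2 < 1, including for n = 0. *)
apply/nbhs_ballP; exists (e / n.+1%:R) => /=; first by rewrite divr_gt0.
move=> y xy; apply: eA.
have r0 : 0 < e / n.+1%:R by rewrite divr_gt0.
have c i : (x ord0 i - y ord0 i) ^+ 2 <= (e / n.+1%:R) ^+ 2.
  have := xy.2 ord0 i; rewrite -ball_normE /= => /ltW c.
  rewrite -[leLHS](@real_normK _ _) ?num_real// lerXn2r ?nnegrE//; exact: ltW.
rewrite -(@ltr_pXn2r _ 2) ?nnegrE ?enorm_ge0 ?(ltW e0)// enorm_sqr /dotp.
apply: (@le_lt_trans _ _ (\sum_(i < n) (e / n.+1%:R) ^+ 2)).
  by apply: ler_sum => i _; rewrite !mxE -expr2 c.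
rewrite sumr_const card_ord -[_ *+ n]mulr_natl.
have -> : n%:R * (e / n.+1%:R) ^+ 2 = e ^+ 2 * (n%:R / n.+1%:R ^+ 2) :> R by field.
rewrite -[ltRHS]mulr1 ltr_pM2l ?exprn_gt0// ltr_pdivrMr ?exprn_gt0// mul1r.
have := ler0n R n; rewrite -natr1 => N0; nra.
Qed.

Lemma lip_continuous (F : 'rV[R]_n -> R) :
  (forall u v, `|F u - F v| <= enorm (u - v)) -> continuous F.
Proof.
move=> lipF x A /nbhs_ballP[e /= e0 eA]; apply/nbhs_enormP; exists e => // y xy.
by apply: eA; rewrite -ball_normE /=; exact: le_lt_trans xy.
Qed.

(** Only u is confined to a bounded set; v is any nearby vector. In the application u is the image
    of a bounded variable and v the variable approximating it. *)
Lemma unif_continuous_enorm (g : 'rV[R]_n -> R) (L e : R) : continuous g -> 0 < e ->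
  exists2 s : R, 0 < s & forall u v, enorm u <= L -> enorm (u - v) < s -> `|g u - g v| <= e.
Proof.
move=> cg e0.
have cK : compact [set u : 'rV[R]_n | forall i, `[- L, L]%classic (u ord0 i)].
  exact: (@rV_compact R n (fun=> `[- L, L]%classic) (fun=> @segment_compact R (- L) L)).
pose Q (m : nat) u := forall v, enorm (u - v) < m.+1%:R^-1 -> `|g u - g v| <= e.
have [|m _ /(_ m (leqnn m)) mQ] := (compact_near_coveringP _).1 cK nat \oo Q _; last first.
  exists m.+1%:R^-1 => [|u v uL uv]; first by rewrite invr_gt0.
  apply: mQ => // i; rewrite /= in_itv/= -ler_norml.
  exact: le_trans (coord_le_enorm u i) uL.
move=> x _; have e2 : 0 < e / 2 by rewrite divr_gt0.
have /nbhs_enormP[s s0 sP'] : nbhs x (g @^-1` ball (g x) (e / 2)).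
  by apply: cg; exact: nbhsx_ballx.
have sP y : enorm (x - y) < s -> `|g x - g y| < e / 2.
  by move=> /sP'; rewrite -ball_normE.
have s2 : 0 < s / 2 by rewrite divr_gt0.
exists ([set y | enorm (x - y) < s / 2], [set m | m.+1%:R^-1 < s / 2]); first split => /=.
- by apply/nbhs_enormP; exists (s / 2).
- exact: (near_infty_natSinv_lt (PosNum s2)).
move=> [y m] [/= xy ms] v yv.
have H1 : `|g x - g y| < e / 2 by apply: sP; lra.
have H2 : `|g x - g v| < e / 2.
  apply: sP; have -> : x - v = (x - y) + (y - v) by rewrite addrA subrK.
  by apply: (le_lt_trans (enorm_triangle _ _)); have := lt_trans yv ms; lra.
have -> : g y - g v = - (g x - g y) + (g x - g v) by ring.
by rewrite (le_trans (ler_normD _ _))// normrN; lra.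
Qed.

Lemma smear_continuous (b : R) : 0 < b -> continuous (@smear R n b).
Proof.
move=> b0 x A /nbhs_enormP[e e0 eA]; apply/nbhs_enormP.
exists (e ^+ 3 * b / 36) => [|y xy]; first by rewrite !divr_gt0// mulr_gt0// exprn_gt0.
apply: eA; rewrite -(@ltr_pXn2r _ 3) ?nnegrE ?enorm_ge0 ?(ltW e0)//.
apply: (le_lt_trans (smear_holder _ _ b0)).
have -> : e ^+ 3 = 36 / b * (e ^+ 3 * b / 36) by field; rewrite gt_eqF.
by rewrite ltr_pM2l// divr_gt0.
Qed.

End euclidean_topology.

(** * Tightness and Slutsky's argument *)

Section slutsky.
Context (R : realType) dT (T : measurableType dT) (P : probability T R) (m : nat).

Lemma integrable_bounded d' (V : measurableType d') (Q : probability V R) (h : V -> R) M :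
  measurable_fun setT h -> (forall x, `|h x| <= M) -> Q.-integrable setT (fun x => (h x)%:E).
Proof.
move=> mh hM; apply: (@le_integrable _ _ _ Q _ measurableT _ (cst M%:E)).
- exact/measurable_EFinP.
- by move=> x _; rewrite lee_fin (le_trans (hM x))// ler_norm.
- exact: finite_measure_integrable_cst.
Qed.

(** A continuous substitute for the indicator of large norm: 0 up to norm B, and 1 from norm B + 1
    on. *)
Let cutoff (B : nat) (z : 'rV[R]_m) : R := Num.min 1 (Num.max 0 (enorm z - B%:R)).

Let cutoff_itv B z : 0 <= cutoff B z <= 1.
Proof. by rewrite /cutoff le_min ler01 le_max lexx ge_min lexx. Qed.

Let cutoff_continuous B : continuous (cutoff B).
Proof.
apply: lip_continuous => u v; apply: le_trans (enorm_dist u v).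
rewrite /cutoff; move: (enorm u) (enorm v) (B%:R) => a b c.
have /andP[D1 D2] : - `|a - b| <= a - b <= `|a - b| by rewrite -ler_norml.
have lip0 (x y : R) D : - D <= x - y <= D -> - D <= Num.max 0 x - Num.max 0 y <= D.
  by case: (leP 0 x) => ?; case: (leP 0 y) => ? /andP[? ?]; apply/andP; split; lra.
have lip1 (x y : R) D : - D <= x - y <= D -> - D <= Num.min 1 x - Num.min 1 y <= D.
  by case: (leP 1 x) => ?; case: (leP 1 y) => ? /andP[? ?]; apply/andP; split; lra.
rewrite ler_norml; apply/lip1/lip0; apply/andP; split; lra.
Qed.

(** The integrals of [cutoff B] against N tend to 0 as B grows, by dominated convergence. For a good
    B, convergence in distribution carries the bound over to the [Z n], at the cost of passing from
    B to B + 1. *)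
Lemma tight_of_cvg (Z : nat -> T -> 'rV[R]_m) (N : probability 'rV[R]_m R) :
  (forall n, measurable_fun setT (Z n)) -> cvg_in_distribution P Z N ->
  forall e : R, 0 < e -> exists B : R, [/\ 0 <= B &
    \forall n \near \oo, (P [set w | (B < enorm (Z n w))%R] <= e%:E)%E].
Proof.
move=> mZ ZN e e0.
have mc B : measurable_fun setT (cutoff B).
  by apply: continuous_mx_measurable; exact: cutoff_continuous.
have cb B z : `|cutoff B z| <= 1.
  by have /andP[c0 c1] := cutoff_itv B z; rewrite ger0_norm.
have mce B : measurable_fun setT (fun z => (cutoff B z)%:E) by exact/measurable_EFinP.
have c0 : {ae N, forall z, setT z -> (cutoff B z)%:E @[B --> \oo] --> cst 0%E z}.
  apply: aeW => z _; apply: cvg_near_cst; near=> B.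
  have zB : enorm z <= B%:R by near: B; exact: nbhs_infty_ger.
  by rewrite /cutoff max_l ?min_r// subr_le0.
have c1 : {ae N, forall z B, setT z -> (`|(cutoff B z)%:E| <= cst 1%:E z)%E}.
  by apply: aeW => z B _; rewrite lee_fin; exact: cb.
have i1 : N.-integrable setT (cst (1 : R)%:E) by exact: finite_measure_integrable_cst.
have [_ _] := dominated_convergence measurableT mce (@measurable_cst _ _ _ _ _ 0%E) c0 i1 c1.
rewrite integral0 => /fine_cvg /cvgrPdist_lt /(_ _ e0) [B _ /(_ B (leqnn B))] /=.
rewrite sub0r normrN => intB.
have fin_int : (\int[N]_z (cutoff B z)%:E)%E \is a fin_num.
  by apply: integrable_fin_num => //; exact: (integrable_bounded _ (mc B) (cb B)).
exists (B%:R + 1); split; first by rewrite addr_ge0.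
have := ZN (cutoff B) (@cutoff_continuous B) (ex_intro _ 1 (cb B)).
rewrite -(fineK fin_int) => /fine_cvgP[_ /cvgrPdist_lt].
have gap : 0 < e - fine (\int[N]_z (cutoff B z)%:E)%E.
  by rewrite subr_gt0 (le_lt_trans (ler_norm _)).
move=> /(_ _ gap) near_Z; near=> n.
have En : `|fine (\int[N]_z (cutoff B z)%:E)%E - fine ('E_P[cutoff B \o Z n])| <
  e - fine (\int[N]_z (cutoff B z)%:E)%E by near: n.
set A := [set w | _].
have mA : measurable A.
  rewrite -[A]setTI; apply: measurable_fun_ltr => //; exact: measurable_enorm.
have iZ : P.-integrable setT (fun w => (cutoff B (Z n w))%:E).
  by apply: (integrable_bounded _ (measurableT_comp (mc B) (mZ n)) (M := 1)) => w; exact: cb.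
have PE : (P A <= 'E_P[cutoff B \o Z n])%E.
  rewrite unlock -[X in P X]setIT -integral_indic//; apply: ge0_le_integral => //.
  - by apply/measurable_EFinP; exact: measurable_indic.
  - exact: (measurable_int P).
  - move=> w _; rewrite lee_fin indicE; have [|_] := boolP (w \in A).
      rewrite inE /A/= => wA; rewrite /cutoff/=.
      have z1 : 1 <= enorm (Z n w) - B%:R by lra.
      by rewrite max_r ?min_l// (le_trans ler01).
    by have /andP[] := cutoff_itv B (Z n w).
apply: (le_trans PE).
have fE : ('E_P[cutoff B \o Z n])%E \is a fin_num.
  by rewrite unlock; apply: integrable_fin_num.
rewrite -(fineK fE) lee_fin; move: En; rewrite ltr_norml => /andP[]; lra.
Unshelve. all: by end_near. Qed.

(** The approximation of U_n by H(Z_n) is asked only where Z_n is bounded and off an event of small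
    probability; tightness bounds the probability that Z_n is large. Measurability of U_n is
    required from n = 1 on, since the empty sample constrains no mean. *)
Lemma slutsky (U Z : nat -> T -> 'rV[R]_m) (H : 'rV[R]_m -> 'rV[R]_m)
    (N : probability 'rV[R]_m R) :
  (forall n, (0 < n)%N -> measurable_fun setT (U n)) ->
  (forall n, measurable_fun setT (Z n)) -> continuous H -> measurable_fun setT H ->
  (forall B, exists L, forall z, enorm z <= B -> enorm (H z) <= L) ->
  cvg_in_distribution P Z N ->
  (forall B e t : R, 0 <= B -> 0 < e -> 0 < t -> \forall n \near \oo,
     exists E : set T, [/\ measurable E, (P E <= t%:E)%E & forall w, ~ E w ->
       enorm (Z n w) <= B -> enorm (U n w - H (Z n w)) <= e]) ->
  cvg_in_distribution P U (pushforward N H).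
Proof.
move=> mU mZ cH mH bH ZN approx g cg [M' gM'].
pose M := Num.max M' 1; have M0 : 0 < M by rewrite lt_max ltr01 orbT.
have gM x : `|g x| <= M by rewrite (le_trans (gM' x))// le_max lexx.
have mg : measurable_fun setT g by exact: continuous_mx_measurable.
have mgH : measurable_fun setT (g \o H) by exact: measurableT_comp.
have igH : N.-integrable setT (fun x => (g (H x))%:E).
  exact: (integrable_bounded _ mgH (fun x => gM (H x))).
have mgE : measurable_fun setT (fun x => (g x)%:E) by exact/measurable_EFinP.
have -> : (\int[pushforward N H]_x (g x)%:E = \int[N]_x (g (H x))%:E)%E.
  by apply: (etrans (integral_pushforward mH mgE igH measurableT)).
have cgH : continuous (g \o H) by move=> x; apply: continuous_comp; [exact: cH|exact: cg].
have := ZN _ cgH (ex_intro _ M (fun x => gM (H x))).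
have fgH : (\int[N]_x (g (H x))%:E)%E \is a fin_num by exact: integrable_fin_num.
rewrite -(fineK fgH) => /fine_cvgP[_ /cvgrPdist_lt ZH].
have iU n : (0 < n)%N -> P.-integrable setT (fun w => (g (U n w))%:E).
  by move=> n0; exact: (integrable_bounded _ (measurableT_comp mg (mU n n0)) (fun w => gM _)).
have iZ n : P.-integrable setT (fun w => (g (H (Z n w)))%:E).
  exact: (integrable_bounded _ (measurableT_comp mgH (mZ n)) (fun w => gM _)).
apply/fine_cvgP; split.
  near=> n; have n0 : (0 < n)%N by near: n; exists 1%N.
  by rewrite unlock; apply: integrable_fin_num => //; exact: iU.
apply/cvgrPdist_lt => e e0.
(* Each of the two exceptional events then contributes 2 M t = e / 8; with e / 8 from uniform
   continuity and e / 2 from the convergence for H(Z_n), the total is below e. *)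
pose t := e / (16 * M); have t0 : 0 < t by rewrite divr_gt0// mulr_gt0.
have [B [B0 tight]] := tight_of_cvg mZ ZN t0.
have [L HL] := bH B; have e4 : 0 < e / 8 by rewrite divr_gt0.
have [s s0 sP] := unif_continuous_enorm L cg e4.
have s2 : 0 < s / 2 by rewrite divr_gt0.
have nearE := approx B (s / 2) t B0 s2 t0.
have e2 : 0 < e / 2 by rewrite divr_gt0.
have nearZ := ZH _ e2.
near=> n; have n0 : (0 < n)%N by near: n; exists 1%N.
have [E [mE PE EU]] : exists E : set T, [/\ measurable E, (P E <= t%:E)%E & forall w, ~ E w ->
   enorm (Z n w) <= B -> enorm (U n w - H (Z n w)) <= s / 2] by near: n.
have PF : (P [set w | (B < enorm (Z n w))%R] <= t%:E)%E by near: n.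
set F := [set w | _] in PF.
have mF : measurable F.
  rewrite -[F]setTI; apply: measurable_fun_ltr => //; exact: measurable_enorm.
have En : `|fine (\int[N]_x (g (H x))%:E)%E - fine ('E_P[(g \o H) \o Z n])| < e / 2.
  by near: n.
have iE (A : set T) : measurable A -> P.-integrable setT (fun w => (\1_A w : R)%:E).
  move=> mA; apply: (integrable_bounded _ (measurable_indic mA) (M := 1)) => w.
  by rewrite indicE; case: (_ \in _); rewrite ?normr1 ?normr0.
have indE (A : set T) : measurable A -> (P A <= t%:E)%E -> \int[P]_w (\1_A w : R) <= t.
  move=> mA PA; rewrite /Rintegral integral_indic// setIT -lee_fin fineK//.
  exact: fin_num_measure.
have diff : `|\int[P]_w g (U n w) - \int[P]_w g (H (Z n w))| <= e / 8 + 2 * M * t + 2 * M * t.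
  have iUn := iU n n0; have iZn := iZ n.
  rewrite -RintegralB//; apply: (le_trans (le_normr_Rintegral measurableT (integrableB measurableT iUn iZn))).
  have ic : P.-integrable setT (fun=> (e / 8)%:E) by exact: finite_measure_integrable_cst.
  have j1 := integrableZl measurableT (2 * M) (iE _ mE).
  have j2 := integrableZl measurableT (2 * M) (iE _ mF).
  have j12 := integrableD measurableT (integrableD measurableT ic j1) j2.
  apply: (@le_trans _ _ (\int[P]_w (e / 8 + 2 * M * \1_E w + 2 * M * \1_F w))).
    apply: le_Rintegral => //.
      exact: (integrable_abse (integrableB measurableT iUn iZn)).
    move=> w _; rewrite /=; have bb : `|g (U n w) - g (H (Z n w))| <= 2 * M.
      by rewrite (le_trans (ler_normB _ _))// mulrDl mul1r lerD.
    rewrite !indicE; have [wE|wE] := boolP (w \in E).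
      have : 0 <= 2 * M * (w \in F)%:R by rewrite mulr_ge0// mulr_ge0// ltW.
      by rewrite mulr1; lra.
    have [wF|wF] := boolP (w \in F); first by rewrite mulr1 mulr0; lra.
    rewrite !mulr0 !addr0 distrC; apply: sP.
      by apply: HL; rewrite leNgt; apply/negP => BZ; move/negP: wF; apply; rewrite inE.
    rewrite -enormN opprB (@le_lt_trans _ _ (s / 2))//; last by lra.
    apply: EU; first by move=> Ew; move/negP: wE; apply; rewrite inE.
    by rewrite leNgt; apply/negP => BZ; move/negP: wF; apply; rewrite inE.
  rewrite (RintegralD measurableT (integrableD measurableT ic j1) j2) (RintegralD measurableT ic j1).
  rewrite (RintegralZl (2 * M) measurableT (iE _ mE)) (RintegralZl (2 * M) measurableT (iE _ mF)).
  rewrite Rintegral_cst// [X in _ * fine X](probability_setT P) mulr1.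
  apply: lerD; [apply: lerD => //|]; apply: ler_wpM2l; rewrite ?mulr_ge0 ?(ltW M0)//; exact: indE.
have UE : fine ('E_P[g \o U n]) = \int[P]_w g (U n w) by rewrite unlock.
have ZE : fine ('E_P[(g \o H) \o Z n]) = \int[P]_w g (H (Z n w)) by rewrite unlock.
rewrite ZE in En; rewrite /= UE.
have Mt : M * t = e / 16 by rewrite /t; field; rewrite gt_eqF.
set I0 := fine _ in En *; set I1 := Rintegral _ _ _ in En diff; set I2 := Rintegral _ _ _ in diff *.
have -> : I0 - I2 = (I0 - I1) - (I2 - I1) by ring.
rewrite (le_lt_trans (ler_normB _ _))//.
have {}diff : `|I2 - I1| <= 3 * (e / 8) by move: diff; rewrite -!mulrA Mt; lra.
by move: En diff e0; lra.
Unshelve. all: by end_near. Qed.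

End slutsky.

(** * Empirical Frechet functions and polar coordinates about the mean *)

Section empirical_frechet.
Context (R : realType) (k : nat).

Lemma frechet_fun_empirical (Y : nat -> 'rV[R]_k.+1) n q : (forall i, sphere R k (Y i)) ->
  sphere R k q -> frechet_fun (empirical Y n) q =
    (n%:R^-1 * \sum_(i < n) (2^-1 * sdist (Y i) q ^+ 2))%:E.
Proof.
move=> Y1 q1; have mS := @measurable_sphere R k.
have mf : measurable_fun (sphere R k) (fun y => (2^-1 * sdist y q ^+ 2)%:E).
  apply: (@eq_measurable_fun _ _ _ _ _ (fun y => (2^-1 * acosr (dotp y q) ^+ 2)%:E)).
    by move=> y /[!inE] y1; rewrite sdistE.
  apply: measurable_funTS; apply/measurable_EFinP; apply: measurable_funM => //.
  apply: measurable_funX; apply: (measurableT_comp (@measurable_acosr R)).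
  exact: measurable_dotp.
have f0 y : sphere R k y -> (0 <= (2^-1 * sdist y q ^+ 2)%:E)%E.
  by move=> _; rewrite lee_fin mulr_ge0// sqr_ge0.
rewrite /frechet_fun /empirical ge0_integral_mscale// ge0_integral_measure_sum//.
rewrite EFinM -sumEFin; congr (_ * _)%E; apply: eq_bigr => i _.
by rewrite integral_dirac// diracE mem_set// mul1e.
Qed.

(** The direction is that of the tangential part of q; when q is p or its antipode this part is 0,
    and w0 serves as an arbitrary direction. *)
Lemma polar_coordinates (p w0 q : 'rV[R]_k.+1) : sphere R k p -> sphere R k w0 ->
  dotp p w0 = 0 -> sphere R k q -> exists x w, [/\ 0 <= x <= pi, sphere R k w, dotp p w = 0 &
    q = cos x *: p + sin x *: w].
Proof.
move=> p1 w01 pw0 q1; have /sphereE pp := p1.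
have aI := dotp_sphere_itv p1 q1.
pose v := q - dotp p q *: p.
have pv : dotp p v = 0 by rewrite /v dotpBr dotpZr pp mulr1 subrr.
have [w [w1 pw vE]] := tangent_direction w01 pw0 pv.
exists (acosr (dotp p q)), w; split => //; first exact: acosr_itv.
by rewrite cos_acosr// -(enorm_tangential p1 q1) -/v -vE /v addrC subrK.
Qed.

(** The value x = pi has to be excluded because [slog] is 0 at the antipode; the minimization
    argument supplies x < pi for the sample mean. *)
Lemma slog_polar (p w : 'rV[R]_k.+1) x : sphere R k p -> sphere R k w -> dotp p w = 0 ->
  0 <= x < pi -> slog p (cos x *: p + sin x *: w) = x *: w.
Proof.
move=> p1 w1 pw /andP[x0 xpi]; have /sphereE pp := p1.
have xI : 0 <= x <= pi by rewrite x0 ltW.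
rewrite slogE//; last exact: polar_sphere.
have -> : dotp p (cos x *: p + sin x *: w) = cos x by rewrite dotpDr !dotpZr pp pw mulr1 mulr0 addr0.
rewrite acosr_cos// addrAC subrr add0r scalerA /psi1.
have -> : - (- x / sin x) * sin x = x / sin x * sin x by ring.
move: x0; rewrite le_eqVlt => /predU1P[<-|x0]; first by rewrite mul0r mul0r.
by rewrite divfK// gt_eqF// sin_gt0_pi// x0.
Qed.

Lemma exists_orthogonal_unit (p : 'rV[R]_k.+2) : sphere R k.+1 p ->
  exists w, sphere R k.+1 w /\ dotp p w = 0.
Proof.
move=> p1; have [Q [oQ _ Qp]] := svol_transitive p1.
have dd (i j : 'I_k.+2) : dotp (delta_mx ord0 i) (delta_mx ord0 j) = (i == j)%:R :> R.
  rewrite /dotp (bigD1 i)//= big1 => [|l li]; first by rewrite !mxE !eqxx/= mul1r addr0.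
  by rewrite !mxE (negbTE li) andbF mul0r.
exists (delta_mx ord0 (lift ord0 ord0) *m Q); split.
  by apply/sphereE; rewrite oQ dd eqxx.
by rewrite -Qp oQ dd.
Qed.

Lemma measurable_slog dT (T : measurableType dT) (p : 'rV[R]_k.+1) (Y : T -> 'rV[R]_k.+1) :
  sphere R k p -> (forall o, sphere R k (Y o)) -> measurable_fun setT Y ->
  measurable_fun setT (fun o => slog p (Y o)).
Proof.
move=> p1 Y1 mY.
have md : measurable_fun setT (fun o => dotp p (Y o)) by exact: measurable_dotp.
apply: (eq_measurable_fun (fun o => - psi1 (acosr (dotp p (Y o))) *:
    (Y o + (- dotp p (Y o)) *: p))).
  by move=> o _; rewrite (slogE p1 (Y1 o)) (scaleNr (dotp p (Y o))).
apply: measurable_fun_scalemx.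
  apply: measurableT_comp => //; apply: (measurableT_comp (@measurable_psi1 R)).
  exact: (measurableT_comp (@measurable_acosr R)).
apply: measurable_fun_mx => i j; under eq_fun do rewrite mxE.
apply: measurable_funD; first exact: measurable_fun_coord.
apply: measurable_fun_coord; apply: measurable_fun_scalemx => //.
exact: measurableT_comp.
Qed.

Lemma measurable_sum_rV dT (T : measurableType dT) n (Y : nat -> T -> 'rV[R]_k.+1) :
  (forall i, measurable_fun setT (Y i)) -> measurable_fun setT (fun o => \sum_(i < n) Y i o).
Proof.
move=> mY; apply: measurable_fun_mx => i j; under eq_fun do rewrite summxE.
by apply: measurable_sum => l; exact: measurable_fun_coord.
Qed.

End empirical_frechet.

Theorem theorem2p12 (R : realType) (d : nat) (hd : (4 <= d)%N)
  (mu : probability 'rV[R]_d.+1 R) (p : 'rV[R]_d.+1) (f : R -> R)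
  (mu_sphere : mu (sphere R d) = 1%E)
  (mean_unique : frechet_mean_set mu = [set p])
  (f_meas : measurable_fun `[0, pi] f)
  (f_ge0 : forall t, 0 <= t <= pi -> 0 <= f t)
  (mu_density : forall A, measurable A ->
     mu A = (\int[svol R d]_(q in A `&` sphere R d) (f (sdist p q))%:E)%E)
  (f_bounded : exists (U : set 'rV[R]_d.+1) (M : R),
     [/\ open U, cut_locus p `<=` U &
         forall q, sphere R d q -> U q -> f (sdist p q) <= M])
  (alpha0 : alpha d f = 0)
  (beta_gt0 : 0 < beta d f)
  (disp : measure_display) (T : measurableType disp) (P : probability T R)
  (X : nat -> {RV P >-> 'rV[R]_d.+1})
  (X_sphere : forall i w, sphere R d (X i w))
  (X_indep : mutually_independent X)
  (X_law : identically_distributed X mu)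
  (mbar : nat -> {RV P >-> 'rV[R]_d.+1})
  (mbar_mean : forall n w, (0 < n)%N ->
     frechet_mean_set (empirical (fun i => X i w) n) (mbar n w))
  (N : probability 'rV[R]_d.+1 R)
  (N_lim : tangent_limit_distribution X p N) :
  cvg_in_distribution P (fun n w => (n%:R `^ (1 / 6)) *: slog p (mbar n w))
    (pushforward N (smear (beta d f))).
Proof.
case: d hd mu p f mu_sphere mean_unique f_meas f_ge0 mu_density f_bounded alpha0
  beta_gt0 X X_sphere X_indep X_law mbar mbar_mean N N_lim => [//|[//|k]] hd mu p f mu_sphere
  mean_unique f_meas f_ge0 mu_density f_bounded alpha0 beta_gt0 X X_sphere X_indep X_law mbar
  mbar_mean N [_ _ N_lim].
have k2 : (2 <= k)%N by [].
have [p1 p_min] : frechet_mean_set mu p by rewrite mean_unique.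
have [w0 [w01 pw0]] := exists_orthogonal_unit p1.
have f_bnd := bounded_near_antipode p1 w01 pw0 f_bounded.
pose Phi x := zonal_mean mu p w0 (half_sqdist x).
have PhiE x w : sphere R k.+2 w -> dotp p w = 0 ->
    frechet_fun mu (cos x *: p + sin x *: w) = (Phi x)%:E.
  move=> w1 pw; rewrite (frechet_fun_zonal p1 w1 pw x mu_sphere); congr _%:E.
  apply: (zonal_mean_eq p1 f_meas f_ge0 mu_density) => //; exact: measurable_half_sqdist.
have p0E : p = cos 0 *: p + sin 0 *: w0 by rewrite cos0 sin0 scale1r scale0r addr0.
(* Uniqueness of the mean: a point at distance x > 0 with no larger value would be a second
   minimizer. *)
have Phi_gt x : 0 < x <= pi -> Phi 0 < Phi x.
  move=> /andP[x0 xpi]; rewrite ltNge; apply/negP => le.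
  pose q := cos x *: p + sin x *: w0.
  have q1 : sphere R k.+2 q by exact: polar_sphere.
  have : frechet_mean_set mu q.
    split => // y y1; apply: le_trans (p_min y y1).
    by rewrite [in leRHS]p0E !PhiE// lee_fin.
  rewrite mean_unique => /= qp; have /sphereE pp := p1.
  have xI : 0 <= x <= pi by rewrite (ltW x0).
  have : sdist p q = x by exact: sdist_polar.
  by rewrite qp /sdist pp acos1 => x0'; move: x0; rewrite -x0' ltxx.
pose G x := Phi x - Phi 0.
have [c c0 G_growth] := quartic_growth k2 p1 f_meas f_ge0 mu_density f_bnd w01 pw0
  alpha0 beta_gt0 Phi_gt.
have G_quartic := quartic_expansion k2 p1 f_meas f_ge0 mu_density f_bnd w01 pw0 alpha0.
have G_quartic' e : 0 < e -> exists2 s : R, 0 < s &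
    forall x, 0 <= x < s -> `|G x - beta k.+2 f / 24 * x ^+ 4| <= e * x ^+ 4.
  exact: G_quartic.
have G0 : G 0 = 0 by rewrite /G subrr.
have mX i : measurable_fun setT (X i) by exact: measurable_funPT.
have mlogX i : measurable_fun setT (fun o => slog p (X i o)) by exact: measurable_slog.
apply: (slutsky (Z := fun n o => (n%:R `^ 2^-1) *: (n%:R^-1 *: \sum_(i < n) slog p (X i o)))) => //.
- move=> n n0; apply: measurable_fun_scalemx => //; apply: measurable_slog => // o.
  by have [] := mbar_mean n o n0.
- move=> n; apply: measurable_fun_scalemx => //; apply: measurable_fun_scalemx => //.
  exact: (measurable_sum_rV n mlogX).
- exact: smear_continuous.
- apply: measurable_fun_mx => i j; apply: continuous_mx_measurable.
  move=> z A nA; have cz := @smear_continuous R k.+3 _ beta_gt0 z.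
  exact: (cz _ (@coord_continuous R 1 k.+3 i j (smear (beta k.+2 f) z) A nA)).
- by move=> B; exists (1 + 6 * B / beta k.+2 f) => z; exact: smear_bound.
move=> B e t B0 e0 t0.
(* The tolerance K and the threshold r0 depend on B and e only, so they are fixed before n and
   before the exceptional event. *)
have [K [r0 [K0 r00 argmin]]] := argmin_smear w01 pw0 beta_gt0 c0 G0 G_growth G_quartic' e0 B0.
have [Bad [mBad PBad conc]] := uniform_concentration k2 p1 f_meas f_ge0 mu_density f_bnd w01 pw0
  X_sphere X_indep X_law K0.
have PBt := PBad t t0.
near=> n; have n0 : (0 < n)%N by near: n; exists 1%N.
have nR : 0 < n%:R :> R by rewrite ltr0n.
have rn := rate_gt0 R n0; have nE := rate_exp6 R n.
have r0n : r0 <= rate R n.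
  have : r0 ^+ 6 <= n%:R by near: n; exact: nbhs_infty_ger.
  by rewrite -nE ler_pXn2r ?nnegrE// ltW.
exists (Bad n); split; [exact: mBad|by near: n|].
move=> o no; have cn : forall x w, 0 <= x <= pi -> sphere R k.+2 w -> dotp p w = 0 ->
    `|mean_of_incr p X n x w o - G x| <= K * Num.max (x ^+ 4) (rate R n ^+ 4)^-1.
  by move: o no; near: n.
set S := n%:R^-1 *: _; set Z := _ *: S => ZB.
(* n^(1/2) is the cube of the rate n^(1/6), which is what matches the linear term with the quartic
   one after rescaling. *)
have ZE : Z = rate R n ^+ 3 *: S.
  rewrite /Z /rate -powR_mulrn ?powR_ge0// -powRrM.
  by congr (_ `^ _ *: _); field.
have pS : dotp p S = 0.
  rewrite /S dotpZr /dotp; apply/eqP; rewrite mulf_eq0; apply/orP; right; apply/eqP.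
  under eq_bigr do rewrite summxE mulr_sumr.
  by rewrite exchange_big/= big1// => i _; exact: slog_tangent.
have dS w : dotp p w = 0 -> dotp w S = - (n%:R^-1 * \sum_(i < n) tay1 (dotp p (X i o), dotp w (X i o))).
  move=> pw; rewrite /S dotpZr -mulrN; congr (_ * _).
  rewrite -sumrN /dotp; under eq_bigr do rewrite summxE mulr_sumr.
  by rewrite exchange_big/=; apply: eq_bigr => i _; rewrite (tay1_slog p1 (X_sphere i o) pw) opprK.
have pZ : dotp p Z = 0 by rewrite ZE dotpZr pS mulr0.
(* The value of the empirical Frechet function at p. It does not depend on the direction, so it
   cancels when two points are compared. *)
pose base := n%:R^-1 * \sum_(i < n) half_sqdist 0 (dotp p (X i o), dotp w0 (X i o)).
have FE x w : sphere R k.+2 w -> dotp p w = 0 ->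
    frechet_fun (empirical (fun i => X i o) n) (cos x *: p + sin x *: w) =
    (mean_of_incr p X n x w o - x * dotp w S + base)%:E.
  move=> w1 pw; rewrite frechet_fun_empirical//; last exact: polar_sphere.
  congr _%:E; rewrite dS// /mean_of_incr /base mulrN opprK mulrCA -!mulrDr; congr (_ * _).
  rewrite mulr_sumr -!big_split/=; apply: eq_bigr => i _.
  rewrite (half_sqdist_sdist p1 w1 pw x (X_sphere i o)) /incr.
  have -> : half_sqdist 0 (dotp p (X i o), dotp w0 (X i o)) =
            half_sqdist 0 (dotp p (X i o), dotp w (X i o)).
    by rewrite /half_sqdist/= sin0 !mulr0.
  by ring.
have [m1 m_min] := mbar_mean n o n0.
have [x [w [xI w1 pw mE]]] := polar_coordinates p1 w01 pw0 m1.
(* The minimality of the sample mean, multiplied by the fourth power of the rate r: since Z = r^3 S,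
   the linear term r^4 x <w, S> becomes r x <w, Z>. *)
have opt x' w' : [/\ 0 <= x' <= pi, sphere R k.+2 w' & dotp p w' = 0] ->
    rate R n ^+ 4 * mean_of_incr p X n x w o - rate R n * x * dotp w Z <=
    rate R n ^+ 4 * mean_of_incr p X n x' w' o - rate R n * x' * dotp w' Z.
  move=> [x'I w'1 pw']; have q1 := polar_sphere x' p1 w'1 pw'.
  have := m_min _ q1; rewrite mE !FE// lee_fin lerD2r => H.
  have E y v : rate R n ^+ 4 * mean_of_incr p X n y v o - rate R n * y * dotp v Z =
    rate R n ^+ 4 * (mean_of_incr p X n y v o - y * dotp v S).
    by rewrite ZE dotpZr; ring.
  by rewrite !E ler_wpM2l// exprn_ge0// ltW.
have cn' y v : [/\ 0 <= y <= pi, sphere R k.+2 v & dotp p v = 0] ->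
    `|mean_of_incr p X n y v o - G y| <= K * Num.max (y ^+ 4) (rate R n ^+ 4)^-1.
  by move=> [yI v1 pv]; exact: cn.
have xw : [/\ 0 <= x <= pi, sphere R k.+2 w & dotp p w = 0] by [].
have [xpi fin] := argmin _ _ (fun y v => mean_of_incr p X n y v o) x w r0n pZ ZB xw cn' opt.
have /andP[x0 _] := xI.
by rewrite mE slog_polar ?x0// scalerA.
Unshelve. all: by end_near. Qed.
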